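(* Fix $m,n\in\mathbb{N}$, $q\in[2,\infty]$ and let $p$ be defined by $\frac{1}{p}+\frac{1}{q}=1$. Let $\mu$ be an isotropic Borel measure on the unit sphere $S^{m-1}$ of $\mathbb{R}^m$ and let $X=X_p(\mu)$ (an $m$-dimensional subspace of $L_p$ whose unit ball is in Lewis' position). Then for all unit vectors $\theta=(\theta_1,\ldots,\theta_n)$ and $\phi=(\phi_1,\ldots,\phi_n)$ in $\mathbb{R}^n$, we have $$(\theta_1^2,\ldots,\theta_n^2) \preceq (\phi_1^2,\ldots,\phi_n^2) \ \Longrightarrow\ w\big(\mathrm{Proj}_{H_\theta}(B_q^n(X^\ast))\big) \geq w\big(\mathrm{Proj}_{H_\phi}(B_q^n(X^\ast))\big),$$ where $w(A)$ is the mean width of the set $A$.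
   Context: A Borel measure $\mu$ on $S^{m-1}$ is isotropic if $\|x\|_2=\big(\int_{S^{m-1}}\langle x,u\rangle^2\,d\mu(u)\big)^{1/2}$ for every $x\in\mathbb{R}^m$. For such $\mu$, $X_p(\mu)=(\mathbb{R}^m,\|\cdot\|_{p,\mu})$ with $\|x\|_{p,\mu}=\big(\int_{S^{m-1}}|\langle x,u\rangle|^p\,d\mu(u)\big)^{1/p}$; a space of this form is said to have unit ball in Lewis' position. $X^*=(\mathbb{R}^m,\|\cdot\|_{X^*})$ is the dual space, identified with $\mathbb{R}^m$ via the standard inner product: $\|y\|_{X^*}=\sup\{\langle x,y\rangle:\|x\|_X\leq 1\}$. For a normed space $Y=(\mathbb{R}^m,\|\cdot\|_Y)$ with unit ball $B_Y$, $B_q^n(Y)=\{(y_1,\ldots,y_n)\in(\mathbb{R}^m)^n:\sum_{i=1}^n\|y_i\|_Y^q\leq1\}$ for $q<\infty$, and $B_\infty^n(Y)=B_Y^n$. For a unit vector (Euclidean norm) $\theta\in\mathbb{R}^n$, $H_\theta=\{(x_1,\ldots,x_n)\in(\mathbb{R}^m)^n:\sum_{i=1}^n\theta_ix_i=0\}\subseteq\mathbb{R}^{mn}$, and $\mathrm{Proj}_{H_\theta}$ is the orthogonal projection onto $H_\theta$. Mean width: for a normed space $E=(\mathbb{R}^\ell,\|\cdot\|_E)$ with unit ball $K$ and polar body $K^\circ$, $w(K^\circ)=\int_{S^{\ell-1}}\|u\|_E\,d\sigma(u)$ with $\sigma$ the rotation invariant probability measure on $S^{\ell-1}$; equivalently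 $w(A)=\int_{S^{\ell-1}}\sup_{a\in A}\langle a,u\rangle\,d\sigma(u)$ for a symmetric convex body $A$. For $A\subseteq H_\theta$, $w(A)$ is computed inside $H_\theta$ (with its induced Euclidean structure), i.e. integrating over the unit sphere of $H_\theta$. Majorization: for $\alpha,\beta\in\mathbb{R}^n$ with nonincreasing rearrangements $\alpha_1^*\geq\cdots\geq\alpha_n^*$ and $\beta_1^*\geq\cdots\geq\beta_n^*$, $\alpha\preceq\beta$ means $\sum_{j=1}^k\alpha_j^*\leq\sum_{j=1}^k\beta_j^*$ for every $k\in\{1,\ldots,n-1\}$ and $\sum_{j=1}^n\alpha_j=\sum_{j=1}^n\beta_j$. *)

(* Defs.v *)
From HB Require Import structures.
From mathcomp Require Import all_boot all_order all_algebra.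
From mathcomp Require Import all_classical all_reals all_analysis.

Set Implicit Arguments.
Unset Strict Implicit.
Unset Printing Implicit Defensive.

Import Order.TTheory GRing.Theory Num.Theory.
Import numFieldNormedType.Exports.

Local Open Scope classical_set_scope.
Local Open Scope ring_scope.

(* R^m is 'rV[R]_m, and (R^m)^n, i.e. R^(mn), is 'M[R]_(n, m), a point
   (x_1, ..., x_n) being the matrix with rows x_i. *)

Definition dotp (R : realType) (n m : nat) (x y : 'M[R]_(n, m)) : R :=
  \sum_(i < n) \sum_(j < m) x i j * y i j.

Definition enorm (R : realType) (n m : nat) (x : 'M[R]_(n, m)) : R :=
  Num.sqrt (dotp x x).

Definition usphere (R : realType) (n m : nat) (H : set 'M[R]_(n, m)) :
    set 'M[R]_(n, m) :=
  H `&` [set x | enorm x = 1].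

Definition borel_mx (R : realType) (n m : nat) :=
  g_sigma_algebraType (@open 'M[R]_(n, m)).

(* A Borel measure on the unit sphere is represented by a Borel measure on the
   ambient space that vanishes outside the sphere. *)
Definition isotropic (R : realType) (m : nat)
    (mu : {measure set (borel_mx R 1 m) -> \bar R}) : Prop :=
  mu (~` usphere setT) = 0%E /\
  forall x : 'rV[R]_m,
    (enorm x)%:E = Lnorm mu 2%:E (fun u : borel_mx R 1 m => (dotp x u)%:E).

Definition Xnorm (R : realType) (m : nat)
    (mu : {measure set (borel_mx R 1 m) -> \bar R}) (p : R) (x : 'rV[R]_m) : R :=
  fine (Lnorm mu p%:E (fun u : borel_mx R 1 m => (dotp x u)%:E)).

Definition dual_norm (R : realType) (m : nat) (N : 'rV[R]_m -> R)
    (y : 'rV[R]_m) : R :=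
  sup [set dotp x y | x in [set x | N x <= 1]].

Definition lq_ball (R : realType) (n m : nat) (N : 'rV[R]_m -> R) (q : \bar R) :
    set 'M[R]_(n, m) :=
  match q with
  | r%:E => [set y | \sum_(i < n) N (row i y) `^ r <= 1]
  | +oo%E => [set y | forall i : 'I_n, N (row i y) <= 1]
  | -oo%E => set0 (* junk value *)
  end.

Definition block_hyperplane (R : realType) (n m : nat) (theta : 'rV[R]_n) :
    set 'M[R]_(n, m) :=
  [set x | \sum_(i < n) theta 0 i *: row i x = 0].

(* Image of A under the orthogonal projection onto the linear subspace H. *)
Definition orth_proj (R : realType) (n m : nat) (H A : set 'M[R]_(n, m)) :
    set 'M[R]_(n, m) :=
  [set z | H z /\ exists2 x, A x & forall h, H h -> dotp (x - z) h = 0].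

(* sigma is the rotation invariant probability measure on the unit sphere of the
   linear subspace H, extended by 0 to the ambient space. Every isometry of H
   extends to a linear isometry of the ambient space, so it suffices to consider
   those that preserve H. When H = 0 its sphere is empty and sigma is the zero
   measure. *)
Definition rotation_invariant_on_usphere (R : realType) (n m : nat)
    (H : set 'M[R]_(n, m)) (sigma : {measure set (borel_mx R n m) -> \bar R}) :
    Prop :=
  [/\ sigma (~` usphere H) = 0%E,
      usphere H !=set0 -> sigma setT = 1%E &
      forall g : {linear 'M[R]_(n, m) -> 'M[R]_(n, m)},
        (forall x, enorm (g x) = enorm x) -> (forall x, H x -> H (g x)) ->
        forall A : set (borel_mx R n m), measurable A ->
          sigma (g @^-1` A) = sigma A].

Definition mean_width (R : realType) (n m : nat)
    (sigma : {measure set (borel_mx R n m) -> \bar R}) (A : set 'M[R]_(n, m)) :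
    \bar R :=
  (\int[sigma]_u ereal_sup [set (dotp a u)%:E | a in A])%E.

Definition decr_rearr (R : realType) (n : nat) (a : 'rV[R]_n) : seq R :=
  sort >=%R [seq a 0 i | i <- enum 'I_n].

Definition majorized (R : realType) (n : nat) (a b : 'rV[R]_n) : Prop :=
  (forall k, (1 <= k <= n.-1)%N ->
     \sum_(j < k) (decr_rearr a)`_j <= \sum_(j < k) (decr_rearr b)`_j) /\
  \sum_(j < n) a 0 j = \sum_(j < n) b 0 j.

(* Main.v *)
Require Import Defs.
From HB Require Import structures.
From mathcomp Require Import all_boot all_order all_algebra.
From mathcomp Require Import all_classical all_reals all_analysis.
From mathcomp Require Import measurable_realfun ring lra.

Set Implicit Arguments.
Unset Strict Implicit.
Unset Printing Implicit Defensive.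

Import Order.TTheory GRing.Theory Num.Theory.
Import numFieldNormedType.Exports.

Local Open Scope classical_set_scope.
Local Open Scope ring_scope.

(* By duality the mean width of the projection is the integral over the sphere
   of [H_theta] of [N y = (sum_i T (y_i)) ^ (1/p)], [T x = int |<x, u>| ^ p dmu],
   and [s ^ (1/p)] and [s ^ (p/2)] are limits of Bernstein functions
   [sum_j a_j (1 - exp (- l_j s))].  With a one-dimensional Gaussian factor [g]
   one has [N (g y) = |g| N y], so it suffices that
     [int E_g prod_i f (g y_i) dsigma_theta(y)]
   is at most the same integral for [phi] when [f = exp (- lam T)], hence when [f]
   is a power of a mixture of the functions [x |-> exp (- <x, v> ^ 2 / 2)].  For
   those, Gaussian linearization and rotation invariance turn the integral into an
   average of products [prod_i H (theta_i ^ 2)] with [H] log-convex (a mixture of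
   exponentials), to which Karamata's inequality applies. *)

(** * The standard Gaussian *)

(** The factor [g] keeps every kernel positive. For fixed vectors v_ij the product of mixtures
    contributes exp(- Q(y) / 2) with Q(y) = sum_ij <y_i, v_ij>^2. Expressing this through a random
    functional <Z, y> of variance Q(y) would call for the oscillating exp(i <Z, y>). Averaging exp(-
    g^2 Q(y) / 2) over g gives (1 + Q(y))^(-1/2) instead, which is also the mean of exp(- <Z, y>^2 /
    2) for Z_i = sum_j z_ij v_ij with normal z_ij. On the sphere of H_theta the law of <Z, y>
    depends only on the length of the projection P Z, and |P Z|^2 = |Z|^2 - |sum_i theta_i Z_i|^2.
    The last term enters the exponent with a plus sign, so a second Gaussian vector eta linearizes
    it; then the independent blocks Z_i separate, and block i sees theta only through theta_i^2. The
    inequality for products turns around for mean widths because of the minus sign in 1 - exp(- l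
    s). Both exponents 1/p and p/2 lie in (0, 1], since q >= 2 forces 1 <= p <= 2. *)

Lemma ge0_integral_normal_prob (R : realType) (m s : R) (f : R -> \bar R) :
  measurable_fun setT f -> (forall x, (0 <= f x)%E) ->
  (\int[normal_prob m s]_x f x =
   \int[lebesgue_measure]_x (f x * (normal_pdf m s x)%:E))%E.
Proof.
move=> mf f0.
have dom := normal_prob_dominates m s.
rewrite -(Radon_Nikodym_SigmaFinite.change_of_variables dom)//.
have mpdf : measurable_fun setT (EFin \o normal_pdf m s : R -> \bar R).
  by apply/measurable_EFinP; exact: measurable_normal_pdf.
have idf := Radon_Nikodym_SigmaFinite.f_integrable dom.
apply: ge0_ae_eq_integral => //.
- by apply: emeasurable_funM => //; exact: measurable_int idf.
- by apply: emeasurable_funM.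
- by move=> x _; rewrite mule_ge0// Radon_Nikodym_SigmaFinite.f_ge0.
- by move=> x _; rewrite mule_ge0// lee_fin normal_pdf_ge0.
- apply: ae_eqe_mul2l; apply: integral_ae_eq => //.
  by move=> E _ mE; rewrite -Radon_Nikodym_SigmaFinite.f_integral.
Qed.

Section gauss1.
Context {R : realType}.

Definition gauss : probability (measurableTypeR R) R := normal_prob (0 : R) 1.

Lemma gauss_expR (A b : R) : 0 <= A ->
  (\int[gauss]_x (expR (- (A * x ^+ 2) / 2 + b * x))%:E =
   ((Num.sqrt (1 + A))^-1 * expR (b ^+ 2 / (2 * (1 + A))))%:E)%E.
Proof.
move=> A0; have A1 : 0 < 1 + A by rewrite ltr_wpDr.
have me (a c : R) : measurable_fun setT (fun x : R => expR (- (a * x ^+ 2) / 2 + c * x)).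
  apply: measurableT_comp => //; apply: measurable_funD.
    apply: measurable_funM => //; apply: measurableT_comp => //.
    by apply: measurable_funM => //; exact: measurable_funX.
  exact: measurable_funM.
rewrite /gauss ge0_integral_normal_prob; last 2 first.
- by apply/measurable_EFinP.
- by move=> x; rewrite lee_fin expR_ge0.
(* Completing the square turns the integrand into [k] times the normal density of mean b / (1 + A)
   and standard deviation [s]. *)
pose s : R := (Num.sqrt (1 + A))^-1.
have s0 : 0 < s by rewrite invr_gt0 sqrtr_gt0.
have s2 : s ^+ 2 = (1 + A)^-1 by rewrite exprVn sqr_sqrtr// ltW.
have := integral_normal_pdf (b / (1 + A)) s.
pose k := s * expR (b ^+ 2 / (2 * (1 + A))) => H.
rewrite -/s -/k.
transitivity (\int[lebesgue_measure]_x
   (k%:E * (normal_pdf (b / (1 + A)) s x)%:E) : \bar R)%E.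
  apply: eq_integral => x _; rewrite -!EFinM; congr EFin.
  rewrite !normal_pdfE ?gt_eqF// /normal_peak /normal_fun.
  rewrite s2 /k; set u := expR _; set v := expR (_ / _); set w := expR _.
  rewrite [RHS]mulrACA.
  have -> : s * (Num.sqrt ((1 + A)^-1 * pi *+ 2))^-1 =
      (Num.sqrt (1 ^+ 2 * pi *+ 2))^-1.
    rewrite -(mulrnAr (1 + A)^-1) sqrtrM ?invr_ge0 1?ltW// sqrtrV 1?ltW//.
    rewrite invfM invrK mulrA /s mulVf ?mul1r ?expr1n ?mul1r//.
    by rewrite gt_eqF// sqrtr_gt0.
  rewrite [LHS]mulrCA; congr (_ * _); rewrite /u /v /w -!expRD; congr expR.
  field; by rewrite gt_eqF.
rewrite ge0_integralZl//; last 3 first.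
- by apply/measurable_EFinP; exact: measurable_normal_pdf.
- by move=> x _; rewrite lee_fin normal_pdf_ge0.
- by rewrite lee_fin mulr_ge0 ?invr_ge0 ?sqrtr_ge0 ?expR_ge0.
by rewrite H mule1.
Qed.

Lemma gauss_mgf (b : R) : (\int[gauss]_x (expR (b * x))%:E = (expR (b ^+ 2 / 2))%:E)%E.
Proof.
have := gauss_expR b (lexx 0); rewrite addr0 sqrtr1 invr1 mul1r mulr1 => <-.
by apply: eq_integral => x _; rewrite mul0r oppr0 mul0r add0r.
Qed.

Lemma gauss_norm_fin : (\int[gauss]_x `|x|%:E < +oo)%E.
Proof.
have me (b : R) : measurable_fun setT (fun x : R => (expR (b * x))%:E).
  by apply/measurable_EFinP; apply: measurableT_comp => //; exact: measurable_funM.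
apply: (@le_lt_trans _ _
  (\int[gauss]_x ((expR (1 * x))%:E + (expR (-1 * x))%:E))%E).
  apply: ge0_le_integral => //.
  - by apply/measurable_EFinP; exact: normr_measurable.
  - by apply: emeasurable_funD; exact: me.
  - move=> x _; rewrite -EFinD lee_fin mul1r mulN1r.
    have := expR_ge1Dx x; have := expR_ge1Dx (- x).
    have := expR_gt0 x; have := expR_gt0 (- x).
    by rewrite ler_norml => *; apply/andP; split; lra.
rewrite ge0_integralD//; [|exact: me|exact: me].
by rewrite !gauss_mgf -EFinD ltry.
Qed.

Lemma gauss_norm_gt0 : (0 < \int[gauss]_x `|x|%:E)%E.
Proof.
rewrite lt0e integral_ge0 ?andbT//.
apply/negP => /eqP I0.
have mn : measurable_fun setT (fun x : R => `|x|%:E).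
  by apply/measurable_EFinP; exact: normr_measurable.
have /ae_eq_integral_abs : (\int[gauss]_x `| `|x|%:E | = 0)%E.
  by rewrite -[RHS]I0; apply: eq_integral => x _; rewrite gee0_abs.
move=> /(_ measurableT mn) ae0.
(* If x vanished almost surely, the mean of exp(- x^2 / 2) would be 1, whereas the formula with A =
   1 gives 1 / sqrt 2. *)
have := gauss_expR 0 (ler01 : 0 <= 1 :> R).
rewrite (@ge0_ae_eq_integral _ _ _ _ _ _ (cst 1%E))//.
- rewrite integral_cst//= probability_setT mule1 expr0n/= mul0r expR0 mulr1.
  move=> [] /esym/eqP; rewrite invr_eq1 => /eqP h.
  have := @sqr_sqrtr R (1 + 1) ltac:(lra); rewrite h; lra.
- apply/measurable_EFinP; apply: measurableT_comp => //.
  under eq_fun do rewrite mul0r addr0.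
  apply: measurable_funM => //; apply: measurableT_comp => //.
  by apply: measurable_funM => //; exact: measurable_funX.
- apply: filterS ae0 => x /(_ I) [] /eqP; rewrite normr_eq0 => /eqP -> _.
  by rewrite expr0n/= !mulr0 addr0 oppr0 mul0r expR0.
Qed.

End gauss1.

(** * Independent tuples and sums of independent normal variables *)

Section tuple_measure.
Context d (T : measurableType d) (R : realType).

Definition cons_tuple n (x : T * n.-tuple T) : n.+1.-tuple T :=
  [tuple of x.1 :: x.2].

Lemma measurable_cons_tuple n : measurable_fun setT (@cons_tuple n).
Proof. exact: measurable_cons. Qed.

HB.instance Definition _ n :=
  isMeasurableFun.Build _ _ _ _ (@cons_tuple n) (@measurable_cons_tuple n).

(** Built by recursion so that Tonelli peels off one coordinate at a time; nesting [iid (iid P N) n]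
    produces doubly indexed independent families. *)
Fixpoint iid (P : probability T R) n : probability (n.-tuple T) R :=
  match n return probability (n.-tuple T) R with
  | 0 => \d_ ([tuple] : 0.-tuple T)
  | n.+1 => distribution (P \x iid P n)%E (@cons_tuple n)
  end.

Lemma integral_iidS (P : probability T R) n (f : n.+1.-tuple T -> \bar R) :
  measurable_fun setT f -> (forall t, (0 <= f t)%E) ->
  (\int[iid P n.+1]_t f t =
   \int[P]_x \int[iid P n]_t f [tuple of x :: t])%E.
Proof.
move=> mf f0; rewrite /= ge0_integral_distribution// fubini_tonelli1//=.
by apply: measurableT_comp => //; exact: measurable_cons_tuple.
Qed.

Lemma integral_iid0 (P : probability T R) (f : 0.-tuple T -> \bar R) :
  measurable_fun setT f -> (\int[iid P 0]_t f t = f [tuple])%E.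
Proof. by move=> mf; rewrite /= integral_dirac// diracT mul1e. Qed.

Lemma measurable_prod_tnth n (h : 'I_n -> T -> R) :
  (forall i, measurable_fun setT (h i)) ->
  measurable_fun [set: n.-tuple T] (fun t => \prod_(i < n) h i (tnth t i)).
Proof.
move=> mh; apply: measurable_prod => i _.
by apply: measurableT_comp => //; exact: measurable_tnth.
Qed.

Lemma measurable_sum_tnth n (h : 'I_n -> T -> R) :
  (forall i, measurable_fun setT (h i)) ->
  measurable_fun [set: n.-tuple T] (fun t => \sum_(i < n) h i (tnth t i)).
Proof.
move=> mh; apply: measurable_sum => i.
by apply: measurableT_comp => //; exact: measurable_tnth.
Qed.

Lemma integral_iid_prod (P : probability T R) n (h : 'I_n -> T -> R) (a : 'I_n -> R) :
  (forall i, measurable_fun setT (h i)) -> (forall i x, 0 <= h i x) ->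
  (forall i, \int[P]_x (h i x)%:E = (a i)%:E)%E ->
  (\int[iid P n]_t (\prod_(i < n) h i (tnth t i))%:E = (\prod_(i < n) a i)%:E)%E.
Proof.
elim: n h a => [|n IH] h a mh h0 ha.
  rewrite integral_iid0 ?big_ord0//.
  by apply/measurable_EFinP; exact: measurable_prod_tnth.
rewrite integral_iidS; last 2 first.
- by apply/measurable_EFinP; exact: measurable_prod_tnth.
- by move=> t; rewrite lee_fin prodr_ge0.
have a0 i : 0 <= a i.
  by rewrite -lee_fin -ha; apply: integral_ge0 => x _; rewrite lee_fin.
under eq_integral => x _.
  under eq_integral do rewrite big_ord_recl tnth0 EFinM.
  under eq_integral do under eq_bigr do rewrite tnthS.
  rewrite ge0_integralZl_EFin//; last 2 first.
  - by move=> t _; rewrite lee_fin prodr_ge0.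
  - by apply/measurable_EFinP; apply: (measurable_prod_tnth (h := fun i => h (lift ord0 i))).
  rewrite (IH (fun i => h (lift ord0 i)) (fun i => a (lift ord0 i)))//.
  over.
rewrite ge0_integralZr//; last 3 first.
- exact/measurable_EFinP.
- by move=> x _; rewrite lee_fin.
- by rewrite lee_fin prodr_ge0.
by rewrite ha big_ord_recl EFinM.
Qed.

End tuple_measure.

(* [xi] has the Gaussian-tail transform of a centered normal variable of
   variance [v]; this is the form in which normality passes to sums. *)
Definition gauss_transform d (T : measurableType d) (R : realType)
    (P : probability T R) (xi : T -> R) (v : R) :=
  forall s r : R, 0 <= s ->
    (\int[P]_x (expR (- (s * (xi x + r) ^+ 2) / 2))%:E =
     ((Num.sqrt (1 + s * v))^-1 *
        expR (- (s * r ^+ 2) / (2 * (1 + s * v))))%:E)%E.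

Lemma gauss_transform_gauss (R : realType) (b : R) :
  gauss_transform (@gauss R) (fun x => b * x) (b ^+ 2).
Proof.
move=> s r s0; have sb : 0 <= s * b ^+ 2 by rewrite mulr_ge0// sqr_ge0.
have sb1 : 1 + s * b ^+ 2 != 0 by rewrite gt_eqF// ltr_wpDr.
transitivity (\int[@gauss R]_x ((expR (- (s * r ^+ 2) / 2))%:E *
   (expR (- (s * b ^+ 2 * x ^+ 2) / 2 + (- s * b * r) * x))%:E))%E.
  apply: eq_integral => x _; rewrite -EFinM -expRD; congr (expR _)%:E.
  by field.
rewrite ge0_integralZl//; last first.
  apply/measurable_EFinP; apply: measurableT_comp => //; apply: measurable_funD.
    apply: measurable_funM => //; apply: measurableT_comp => //.
    by apply: measurable_funM => //; exact: measurable_funX.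
  exact: measurable_funM.
rewrite gauss_expR// -EFinM mulrCA -expRD; congr (_ * expR _)%:E.
by field.
Qed.

(** Integrating out a tail of total variance V replaces s by s / (1 + s V) and leaves the remaining
    variable as part of the shift. The transform is quantified over all s and r precisely so that
    the induction closes. *)
Lemma gauss_transform_sum d (T : measurableType d) (R : realType)
    (P : probability T R) n (xi : 'I_n -> T -> R) (v : 'I_n -> R) :
  (forall i, measurable_fun setT (xi i)) -> (forall i, 0 <= v i) ->
  (forall i, gauss_transform P (xi i) (v i)) ->
  gauss_transform (iid P n) (fun t => \sum_(i < n) xi i (tnth t i)) (\sum_(i < n) v i).
Proof.
elim: n xi v => [|n IH] xi v mxi v0 gxi s r s0.
  rewrite integral_iid0; last first.
    apply/measurable_EFinP; apply: measurableT_comp => //.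
    apply: measurable_funM => //; apply: measurableT_comp => //.
    apply: measurable_funM => //; apply: measurable_funX.
    by apply: measurable_funD => //; exact: measurable_sum_tnth.
  by rewrite !big_ord0 mulr0 addr0 sqrtr1 invr1 mul1r mulr1 add0r.
rewrite integral_iidS; last 2 first.
- apply/measurable_EFinP; apply: measurableT_comp => //.
  apply: measurable_funM => //; apply: measurableT_comp => //.
  apply: measurable_funM => //; apply: measurable_funX.
  by apply: measurable_funD => //; exact: measurable_sum_tnth.
- by move=> t; rewrite lee_fin expR_ge0.
set V := \sum_(i < n) v (lift ord0 i).
have V0 : 0 <= V by exact: sumr_ge0.
have sV : 0 < 1 + s * V by rewrite ltr_wpDr// mulr_ge0.
transitivity (\int[P]_x (((Num.sqrt (1 + s * V))^-1)%:E *
    (expR (- ((s / (1 + s * V)) * (xi ord0 x + r) ^+ 2) / 2))%:E))%E.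
  apply: eq_integral => x _.
  transitivity (\int[iid P n]_t (expR (- (s *
     ((\sum_(i < n) xi (lift ord0 i) (tnth t i)) + (xi ord0 x + r)) ^+ 2) / 2))%:E)%E.
    apply: eq_integral => t _; rewrite big_ord_recl tnth0.
    under eq_bigr do rewrite tnthS.
    by rewrite addrA [X in X + r]addrC.
  rewrite (IH (fun i => xi (lift ord0 i)) (fun i => v (lift ord0 i)))//.
  rewrite -/V -EFinM; congr (_ * expR _)%:E.
  by field; rewrite gt_eqF.
rewrite ge0_integralZl//; last first.
  apply/measurable_EFinP; apply: measurableT_comp => //.
  apply: measurable_funM => //; apply: measurableT_comp => //.
  apply: measurable_funM => //; apply: measurable_funX.
  by apply: measurable_funD.
have s'0 : 0 <= s / (1 + s * V) by rewrite divr_ge0// ltW.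
rewrite gxi// big_ord_recl -/V -EFinM mulrA.
have svV : 0 < 1 + s * (v ord0 + V) by rewrite ltr_wpDr// mulr_ge0// addr_ge0.
have e : 1 + s * (v ord0 + V) = (1 + s * V) * (1 + s / (1 + s * V) * v ord0).
  by field; rewrite gt_eqF.
congr (_ * expR _)%:E.
  by rewrite -invfM -sqrtrM ?(ltW sV)// -e.
have n1 : 1 + s * V != 0 by rewrite gt_eqF.
have n2 : 1 + s * (v ord0 + V) != 0 by rewrite gt_eqF.
by field; rewrite n1 n2.
Qed.

(** * Gaussian integrals of exponentials of quadratic forms *)

Section gauss_quadratic.
Context (R : realType) (V : lmodType R).

Definition is_lin (l : V -> R) :=
  (forall u w, l (u + w) = l u + l w) /\ (forall c u, l (c *: u) = c * l u).

Definition is_psd (B : V -> V -> R) :=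
  [/\ forall u w, B u w = B w u, forall w, is_lin (B^~ w) & forall u, 0 <= B u u].

Lemma is_lin_sum (l : V -> R) N (z : 'I_N -> R) (v : 'I_N -> V) : is_lin l ->
  l (\sum_j z j *: v j) = \sum_j z j * l (v j).
Proof.
move=> [lD lZ]; elim/big_ind2 : _ => [|x _ y _ <- <-//|//].
by have := lZ 0 0; rewrite scale0r mul0r.
Qed.

(** Positivity of [B] at (1 + B v v) u - (B u v) v. The summand 1 spares the case B v v = 0, and it
    is the denominator that appears when a standard normal coordinate is integrated out. *)
Lemma psd_cauchy (B : V -> V -> R) u v : is_psd B ->
  B u v ^+ 2 <= B u u * (1 + B v v).
Proof.
move=> [BC Bl B0].
have e : B ((1 + B v v) *: u - B u v *: v) ((1 + B v v) *: u - B u v *: v) =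
    (1 + B v v) ^+ 2 * B u u - 2 * (1 + B v v) * B u v ^+ 2 + B u v ^+ 2 * B v v.
  have D x y w : B (x + y) w = B x w + B y w by case: (Bl w).
  have Z c x w : B (c *: x) w = c * B x w by case: (Bl w).
  rewrite -scaleNr D !Z (BC u) (BC v) !D !Z (BC v u).
  by ring.
have := B0 ((1 + B v v) *: u - B u v *: v); rewrite e => h.
have Bv := B0 v; have Bv1 : 0 < 1 + B v v by rewrite ltr_wpDr.
have : 0 <= (1 + B v v) * ((1 + B v v) * B u u - B u v ^+ 2).
  have : 0 <= B u v ^+ 2 by exact: sqr_ge0.
  by nra.
by rewrite pmulr_rge0// subr_ge0 mulrC.
Qed.

Definition gsum N (v : 'I_N -> V) (z : N.-tuple R) : V := \sum_j tnth z j *: v j.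

Lemma measurable_lin_gsum N (v : 'I_N -> V) (l : V -> R) (u : V) : is_lin l ->
  measurable_fun [set: N.-tuple R] (fun z => l (u + gsum v z)).
Proof.
move=> ll; rewrite (_ : (fun _ => _) = fun z => l u + \sum_j tnth z j * l (v j)).
  apply: measurable_funD => //.
  apply: measurable_sum => j; apply: measurable_funM => //.
  exact: measurable_tnth.
by apply/funext => z; rewrite ll.1 is_lin_sum.
Qed.

Lemma measurable_psd_gsum N (v : 'I_N -> V) (B : V -> V -> R) (u : V) : is_psd B ->
  measurable_fun [set: N.-tuple R] (fun z => B (u + gsum v z) (u + gsum v z)).
Proof.
move=> [BC Bl B0].
rewrite (_ : (fun _ => _) = fun z => B (u + gsum v z) u +
    \sum_j tnth z j * B (u + gsum v z) (v j)).
  apply: measurable_funD; first exact: (measurable_lin_gsum v u (Bl u)).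
  apply: measurable_sum => j; apply: measurable_funM; first exact: measurable_tnth.
  exact: (measurable_lin_gsum v u (Bl (v j))).
apply/funext => z; rewrite {1}(Bl _).1 {1}BC; congr (_ + _).
rewrite /gsum (is_lin_sum _ _ (Bl (u + \sum_j tnth z j *: v j))).
by apply: eq_bigr => j _; rewrite BC.
Qed.

(* Completing the square one coordinate at a time; the class of positive
   semidefinite forms is stable under each step. *)
Lemma gauss_psd N (v : 'I_N -> V) (B : V -> V -> R) (l : V -> R) :
  is_psd B -> is_lin l ->
  exists W D B' l', [/\ 0 < W, 0 <= D, is_psd B', is_lin l' &
  forall u r, (\int[iid (@gauss R) N]_z
      (expR (- B (u + gsum v z) (u + gsum v z) / 2 + r * l (u + gsum v z)))%:E =
    (W * expR (r ^+ 2 * D / 2) * expR (- B' u u / 2 + r * l' u))%:E)%E].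
Proof.
move=> pB ll.
have mE n (w : 'I_n -> V) u r : measurable_fun [set: n.-tuple R] (fun z =>
    (expR (- B (u + gsum w z) (u + gsum w z) / 2 + r * l (u + gsum w z)))%:E).
  apply/measurable_EFinP; apply: measurableT_comp => //.
  apply: measurable_funD; apply: measurable_funM => //.
    by apply: measurableT_comp => //; exact: measurable_psd_gsum.
  exact: measurable_lin_gsum.
elim: N v => [|N IH] v.
  exists 1, 0, B, l; split => // u r.
  rewrite integral_iid0; last exact: mE.
  by rewrite /gsum big_ord0 addr0 mulr0 mul0r expR0 !mul1r.
have [W [D [B' [l' [W0 D0 pB' ll' E]]]]] := IH (fun j => v (lift ord0 j)).
have [BC Bl B0] := pB'; have [lD lZ] := ll'.
have BD x y w : B' (x + y) w = B' x w + B' y w by case: (Bl w).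
have BZ c x w : B' (c *: x) w = c * B' x w by case: (Bl w).
pose v0 := v ord0; pose A := B' v0 v0.
have A0 : 0 <= A by exact: B0.
have A1 : 0 < 1 + A by rewrite ltr_wpDr.
have A1n : 1 + A != 0 by rewrite gt_eqF.
(* The new coordinate contributes exp((r l'(v0) - B'(u, v0))^2 / (2 (1 + A))). Of the expanded
   square, the r^2 term goes to the constant, the cross term to the linear functional and the last
   term to the form, which becomes a Schur complement. *)
exists (W * (Num.sqrt (1 + A))^-1), (D + l' v0 ^+ 2 / (1 + A)),
  (fun u w => B' u w - B' u v0 * B' w v0 / (1 + A)),
  (fun u => l' u - l' v0 * B' u v0 / (1 + A)).
split.
- by rewrite mulr_gt0// invr_gt0 sqrtr_gt0.
- by rewrite addr_ge0// divr_ge0 ?sqr_ge0// ltW.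
- split => [u w|w|u].
  + by rewrite BC [B' u v0 * _]mulrC.
  + by split => [u u'|c u]; rewrite ?BD ?BZ; ring.
  + by rewrite subr_ge0 ler_pdivrMr// -expr2 psd_cauchy.
- by split => [u w|c u]; rewrite ?lD ?lZ ?BD ?BZ; ring.
move=> u r; rewrite integral_iidS; last 2 first.
- exact: mE.
- by move=> z; rewrite lee_fin expR_ge0.
pose k := W * expR (r ^+ 2 * D / 2) * expR (- B' u u / 2 + r * l' u).
transitivity (\int[@gauss R]_x (k%:E *
   (expR (- (A * x ^+ 2) / 2 + (r * l' v0 - B' u v0) * x))%:E))%E.
  apply: eq_integral => x _.
  transitivity (\int[iid (@gauss R) N]_z
     (expR (- B (u + x *: v0 + gsum (fun j => v (lift ord0 j)) z)
                (u + x *: v0 + gsum (fun j => v (lift ord0 j)) z) / 2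
            + r * l (u + x *: v0 + gsum (fun j => v (lift ord0 j)) z)))%:E)%E.
    apply: eq_integral => z _.
    have -> // : u + gsum v [tuple of x :: z] =
        u + x *: v0 + gsum (fun j => v (lift ord0 j)) z.
    rewrite /gsum big_ord_recl tnth0 addrA; congr (_ + _).
    by apply: eq_bigr => j _; rewrite tnthS.
  etransitivity; first exact: E.
  rewrite -EFinM /k -!mulrA -[in RHS]expRD; congr (W * (_ * expR _))%:E.
  by rewrite !BD !BZ !(BC _ (_ + _)) !BD !BZ lD lZ (BC v0 u) /A; field.
rewrite ge0_integralZl//; last 2 first.
- apply/measurable_EFinP; apply: measurableT_comp => //; apply: measurable_funD.
    apply: measurable_funM => //; apply: measurableT_comp => //.
    by apply: measurable_funM => //; exact: measurable_funX.
  exact: measurable_funM.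
- by rewrite lee_fin /k !mulr_ge0 ?expR_ge0// ltW.
rewrite gauss_expR// -EFinM /k; congr EFin.
set X := expR _; set Y := expR _; set Z := (Num.sqrt _)^-1; set T := expR _.
have -> : W * X * Y * (Z * T) = W * Z * (X * (Y * T)) by ring.
rewrite -!mulrA /X /Y /T -!expRD; congr (_ * (_ * expR _)).
by field.
Qed.

End gauss_quadratic.

(** * Majorization *)

Section karamata.
Context {R : realType}.

(** Summation by parts: as the weights decrease, the weighted partial sums stay above the plain ones
    multiplied by the current weight, and for the full sum this lower bound is 0. *)
Lemma abel_sum_ge0 (c x : nat -> R) (n : nat) :
  (forall i j, (i <= j < n)%N -> c j <= c i) ->
  (forall k, (k < n)%N -> 0 <= \sum_(0 <= j < k) x j) ->
  \sum_(0 <= j < n) x j = 0 -> 0 <= \sum_(0 <= j < n) c j * x j.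
Proof.
move=> cdec S0 Sn.
have key k : (k < n)%N ->
    c k * (\sum_(0 <= j < k) x j) <= \sum_(0 <= j < k) c j * x j.
  elim: k => [|k IH] kn; first by rewrite !big_nil// mulr0.
  rewrite !big_nat_recr//= mulrDr.
  have := IH (ltnW kn); have := S0 _ kn; rewrite big_nat_recr//=.
  have := S0 _ (ltnW kn); have : c k.+1 <= c k by apply: cdec; rewrite leqnSn.
  by nra.
case: n => [|n] in cdec S0 Sn key *; first by rewrite big_nil.
have := key n (ltnSn n); rewrite !big_nat_recr//= in Sn *.
by nra.
Qed.

Lemma size_decr_rearr n (a : 'rV[R]_n) : size (decr_rearr a) = n.
Proof. by rewrite size_sort size_map size_enum_ord. Qed.

Lemma big_decr_rearr (S : Type) (idx : S) (op : Monoid.com_law idx) n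
    (a : 'rV[R]_n) (F : R -> S) :
  \big[op/idx]_(i < n) F (a 0 i) =
  \big[op/idx]_(0 <= j < n) F (decr_rearr a)`_j.
Proof.
transitivity (\big[op/idx]_(x <- decr_rearr a) F x); last first.
  by rewrite (big_nth 0) size_decr_rearr.
rewrite (perm_big [seq a 0 i | i <- enum 'I_n])/=; last by rewrite perm_sort.
by rewrite big_map big_enum.
Qed.

Lemma decr_rearr_nonincr n (a : 'rV[R]_n) i j : (i <= j < n)%N ->
  (decr_rearr a)`_j <= (decr_rearr a)`_i.
Proof.
move=> /andP[ij jn].
have s : sorted >=%R (decr_rearr a).
  by apply: sort_sorted => x y; exact: le_total.
apply: (sorted_leq_nth _ _ _ s) => //.
- by move=> x y z /= xy yz; exact: le_trans yz xy.
- by move=> x /=.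
- by rewrite inE size_decr_rearr (leq_ltn_trans ij).
- by rewrite inE size_decr_rearr.
Qed.

(* Karamata's inequality for the logarithm of [H]: [c t] is a slope of a
   tangent line to [ln H] at [t]. *)
Lemma karamata_prod (H c : R -> R) n (a b : 'rV[R]_n) :
  (forall t, 0 <= t -> 0 < H t) ->
  (forall t t', 0 <= t -> 0 <= t' -> H t * expR (c t * (t' - t)) <= H t') ->
  (forall i, 0 <= a 0 i) -> (forall i, 0 <= b 0 i) ->
  majorized a b ->
  \prod_(i < n) H (a 0 i) <= \prod_(i < n) H (b 0 i).
Proof.
move=> H0 Hc a0 b0 [maj sab].
(* Going from t to t' and back along the two tangent inequalities forces (c t - c t') (t' - t) <=
   0. *)
have cmono t t' : 0 <= t -> t <= t' -> c t <= c t'.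
  move=> t0; rewrite le_eqVlt => /predU1P[->//|tt'].
  have t'0 : 0 <= t' by rewrite (le_trans t0)// ltW.
  have h1 := Hc _ _ t0 t'0; have h2 := Hc _ _ t'0 t0.
  have : H t * expR (c t * (t' - t)) * expR (c t' * (t - t')) <= H t.
    by apply: le_trans h2; rewrite ler_wpM2r// expR_ge0.
  rewrite -mulrA -expRD ger_pMr ?H0// expR_le1.
  have -> : c t * (t' - t) + c t' * (t - t') = (c t - c t') * (t' - t) by ring.
  by rewrite pmulr_lle0 ?subr_gt0// subr_le0.
rewrite !big_decr_rearr.
pose A := decr_rearr a; pose B := decr_rearr b.
have nth0 (x : 'rV[R]_n) (x0 : forall i, 0 <= x 0 i) j : (j < n)%N ->
    0 <= (decr_rearr x)`_j.
  move=> jn; have : (decr_rearr x)`_j \in decr_rearr x.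
    by rewrite mem_nth// size_decr_rearr.
  by rewrite mem_sort => /mapP[i _ ->].
have step : \prod_(0 <= j < n) H A`_j *
    expR (\sum_(0 <= j < n) c A`_j * (B`_j - A`_j)) <= \prod_(0 <= j < n) H B`_j.
  rewrite expR_sum -big_split/= !big_mkord; apply: ler_prod => j _.
  by rewrite mulr_ge0 ?expR_ge0 ?(ltW (H0 _ _))//= ?nth0// Hc// nth0.
apply: le_trans step; rewrite ler_peMr//.
  by rewrite big_mkord prodr_ge0// => j _; rewrite ltW// H0// nth0.
(* The slopes [c] at the decreasing entries of [A] decrease, and majorization says that the partial
   sums of B - A are nonnegative with total 0. *)
rewrite -[leLHS]expR0 ler_expR; apply: abel_sum_ge0.
- move=> i j ijn; apply: cmono; last exact: decr_rearr_nonincr.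
  by rewrite nth0//; case/andP: ijn.
- move=> k kn; case: k => [|k] in kn *; first by rewrite big_nil.
  rewrite sumrB subr_ge0 !big_mkord; apply: maj.
  by rewrite ltn0Sn/=; case: (n) kn => // n'; rewrite ltnS.
- rewrite sumrB.
  have := sab; rewrite (big_decr_rearr _ a id) (big_decr_rearr _ b id)/= => ->.
  by rewrite subrr.
Qed.

(** Jensen's inequality for the tilted measure W exp(t D) P / H(t): the slope is the tilted mean of
    D, that is H'(t) / H(t). Concretely, exp((t' - t) (D - c)) is bounded below by its tangent at 0,
    whose linear term has tilted mean 0. *)
Lemma log_mixture_tangent d (T : measurableType d) (P : probability T R)
    (W D : T -> R) (H : R -> R) :
  measurable_fun setT W -> measurable_fun setT D ->
  (forall x, 0 < W x) -> (forall x, 0 <= D x) ->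
  (forall t, 0 <= t -> (\int[P]_x (W x * expR (t * D x))%:E = (H t)%:E)%E) ->
  (forall t, 0 <= t -> 0 < H t) /\
  exists c : R -> R, forall t t', 0 <= t -> 0 <= t' ->
    H t * expR (c t * (t' - t)) <= H t'.
Proof.
move=> mW mD W0 D0 HE.
have mE t : measurable_fun setT (fun x => W x * expR (t * D x)).
  by apply: measurable_funM => //; apply: measurableT_comp => //; exact: measurable_funM.
have E0 t x : 0 < W x * expR (t * D x) by rewrite mulr_gt0 ?expR_gt0.
have iE t : 0 <= t -> P.-integrable setT (fun x => (W x * expR (t * D x))%:E).
  move=> t0; apply/integrableP; split; first exact/measurable_EFinP.
  under eq_integral do rewrite gee0_abs ?lee_fin 1?ltW//.
  by rewrite HE// ltry.
(* Since D <= exp(D), the integrand is dominated by the mixture at t + 1. *)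
have iDE t : 0 <= t -> P.-integrable setT (fun x => (D x * (W x * expR (t * D x)))%:E).
  move=> t0; apply: (le_integrable measurableT _ _ (iE _ (addr_ge0 t0 ler01))).
    by apply/measurable_EFinP; exact: measurable_funM.
  move=> x _; rewrite !gee0_abs ?lee_fin ?mulr_ge0 ?expR_ge0 ?(ltW (W0 _))//.
  rewrite [leRHS](_ : _ = expR (D x) * (W x * expR (t * D x))); last first.
    by rewrite mulrDl mul1r expRD; ring.
  rewrite ler_wpM2r ?(ltW (E0 _ _))//.
  by rewrite (le_trans _ (expR_ge1Dx _))// lerDr.
have Hge0 t : 0 <= t -> 0 <= H t.
  by move=> t0; rewrite -lee_fin -HE//; apply: integral_ge0 => x _; rewrite lee_fin ltW.
split.
  move=> t t0; rewrite lt_neqAle Hge0// andbT eq_sym; apply/eqP => Ht.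
  have /ae_eq_integral_abs : (\int[P]_x `| (W x * expR (t * D x))%:E | = 0)%E.
    by under eq_integral do rewrite gee0_abs ?lee_fin 1?ltW//; rewrite HE// Ht.
  move=> /(_ measurableT); rewrite measurable_EFinP => /(_ (mE t)) ae0.
  have : (\int[P]_x cst 1 x = \int[P]_x cst 0 x)%E.
    apply: ge0_ae_eq_integral => //; apply: filterS ae0 => x /(_ I) [] h.
    by have := E0 t x; rewrite h ltxx.
  rewrite integral_cst//= integral_cst//= probability_setT mule1 mul0e.
  by case=> /eqP; rewrite oner_eq0.
pose G t := fine (\int[P]_x (D x * (W x * expR (t * D x)))%:E)%E.
have GE t : 0 <= t -> (\int[P]_x (D x * (W x * expR (t * D x)))%:E = (G t)%:E)%E.
  by move=> t0; rewrite /G fineK//; exact: integrable_fin_num (iDE _ t0).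
exists (fun t => G t / H t) => t t' t0 t'0.
have [->|Ht] := eqVneq (H t) 0; first by rewrite mul0r Hge0.
set c := G t / H t; set k := expR (c * (t' - t)).
rewrite -lee_fin -(HE t')//.
have -> : ((H t * k)%:E = \int[P]_x ((k * (1 - (t' - t) * c))%:E * (W x * expR (t * D x))%:E
    + (k * (t' - t))%:E * (D x * (W x * expR (t * D x)))%:E))%E.
  rewrite integralD//; last 2 first.
  - by apply: integrableZl => //; exact: iE.
  - by apply: integrableZl => //; exact: iDE.
  rewrite !integralZl//; [|exact: iDE|exact: iE].
  rewrite HE// GE// -!EFinM -EFinD; congr EFin.
  by rewrite /c; field.
apply: le_integral => //.
- by apply: integrableD => //; apply: integrableZl => //; [exact: iE|exact: iDE].
- exact: iE.
move=> x _; rewrite -!EFinM -EFinD lee_fin.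
have -> : t' * D x = t * D x + (c * (t' - t) + (t' - t) * (D x - c)) by ring.
rewrite !expRD -/k.
have := expR_ge1Dx ((t' - t) * (D x - c)); set e := expR ((t' - t) * _) => he.
have kE : 0 <= k * (W x * expR (t * D x)) by rewrite mulr_ge0 ?expR_ge0// ltW.
rewrite [leLHS](_ : _ = k * (W x * expR (t * D x)) * (1 + (t' - t) * (D x - c))); last by ring.
rewrite [leRHS](_ : _ = k * (W x * expR (t * D x)) * e); last by ring.
exact: ler_wpM2l.
Qed.

End karamata.

(** * The Frobenius inner product and block hyperplanes *)

Section dotp_theory.
Context {R : realType} {n m : nat}.
Implicit Types x y z : 'M[R]_(n, m).

Lemma dotpE x y : dotp x y = \tr (x *m y^T).
Proof.
by apply: eq_bigr => i _; rewrite mxE; apply: eq_bigr => j _; rewrite mxE.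
Qed.

Lemma dotpC x y : dotp x y = dotp y x.
Proof. by apply: eq_bigr => i _; apply: eq_bigr => j _; rewrite mulrC. Qed.

Lemma dotpDl x y z : dotp (x + y) z = dotp x z + dotp y z.
Proof. by rewrite !dotpE mulmxDl mxtraceD. Qed.

Lemma dotpZl c x y : dotp (c *: x) y = c * dotp x y.
Proof. by rewrite !dotpE -scalemxAl mxtraceZ. Qed.

Lemma dotpNl x y : dotp (- x) y = - dotp x y.
Proof. by rewrite -scaleN1r dotpZl mulN1r. Qed.

Lemma dotpBl x y z : dotp (x - y) z = dotp x z - dotp y z.
Proof. by rewrite dotpDl dotpNl. Qed.

Lemma dotpDr x y z : dotp x (y + z) = dotp x y + dotp x z.
Proof. by rewrite !(dotpC x) dotpDl. Qed.

Lemma dotpZr c x y : dotp x (c *: y) = c * dotp x y.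
Proof. by rewrite !(dotpC x) dotpZl. Qed.

Lemma dotpNr x y : dotp x (- y) = - dotp x y.
Proof. by rewrite !(dotpC x) dotpNl. Qed.

Lemma dotpBr x y z : dotp x (y - z) = dotp x y - dotp x z.
Proof. by rewrite !(dotpC x) dotpBl. Qed.

Lemma dotp0l x : dotp 0 x = 0.
Proof. by rewrite -(scale0r 0) dotpZl mul0r. Qed.

Lemma dotp0r x : dotp x 0 = 0. Proof. by rewrite dotpC dotp0l. Qed.

Lemma dotp_ge0 x : 0 <= dotp x x.
Proof. by apply: sumr_ge0 => i _; apply: sumr_ge0 => j _; rewrite -expr2 sqr_ge0. Qed.

Lemma dotp_eq0 x : dotp x x = 0 -> x = 0.
Proof.
move=> /eqP; rewrite psumr_eq0; last first.
  by move=> i _; apply: sumr_ge0 => j _; rewrite -expr2 sqr_ge0.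
move=> /allP h; apply/matrixP => i j; rewrite mxE.
have := h i (mem_index_enum i); rewrite psumr_eq0; last first.
  by move=> k _; rewrite -expr2 sqr_ge0.
by move=> /allP/(_ j (mem_index_enum j)); rewrite mulf_eq0 orbb => /eqP.
Qed.

Lemma enorm_sqr x : enorm x ^+ 2 = dotp x x.
Proof. by rewrite sqr_sqrtr// dotp_ge0. Qed.

Lemma enorm_ge0 x : 0 <= enorm x. Proof. exact: sqrtr_ge0. Qed.

Lemma enorm1P x : enorm x = 1 <-> dotp x x = 1.
Proof.
split=> [h|h]; first by rewrite -enorm_sqr h expr1n.
by rewrite /enorm h sqrtr1.
Qed.

Lemma enorm_eq0 x : enorm x = 0 -> x = 0.
Proof. by move=> h; apply: dotp_eq0; rewrite -enorm_sqr h expr0n. Qed.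

Lemma dotp_sqr_le x y : dotp x y ^+ 2 <= dotp x x * dotp y y.
Proof.
have [y0|y0] := eqVneq (dotp y y) 0.
  by rewrite (dotp_eq0 y0) !dotp0r mulr0 expr0n.
have := dotp_ge0 (dotp y y *: x - dotp x y *: y).
rewrite dotpBl !dotpBr !dotpZl !dotpZr (dotpC y x) => h.
have yp : 0 < dotp y y by rewrite lt_neqAle eq_sym y0 dotp_ge0.
rewrite -subr_ge0 -(pmulr_rge0 _ yp); apply: le_trans h _.
by rewrite le_eqVlt; apply/orP; left; apply/eqP; ring.
Qed.

Lemma dotp_norm_le x y : `|dotp x y| <= enorm x * enorm y.
Proof.
rewrite -ler_sqr ?nnegrE ?mulr_ge0 ?enorm_ge0// real_normK ?num_real//.
by rewrite exprMn !enorm_sqr dotp_sqr_le.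
Qed.

Lemma dotp_sum_row x y : dotp x y = \sum_i dotp (row i x) (row i y).
Proof.
by apply: eq_bigr => i _; rewrite /dotp big_ord1; apply: eq_bigr => j _; rewrite !mxE.
Qed.

(** The reflection in the hyperplane orthogonal to v. As division by 0 yields 0, it is the identity
    for v = 0, so [refl_swap] also covers x = y. *)
Definition refl (v x : 'M[R]_(n, m)) := x - (2 * dotp x v / dotp v v) *: v.

Lemma refl_is_linear v : linear (refl v).
Proof.
move=> c x y; rewrite /refl dotpDl dotpZl scalerBr [RHS]addrACA; congr (_ + _).
rewrite -opprD scalerA -scalerDl; congr (- (_ *: _)).
by rewrite mulrDr mulrDl mulrCA !mulrA.
Qed.

HB.instance Definition _ v :=
  GRing.isLinear.Build R 'M[R]_(n, m) 'M[R]_(n, m) *:%R (refl v) (refl_is_linear v).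

Lemma refl_adj v x y : dotp (refl v x) y = dotp x (refl v y).
Proof.
by rewrite /refl dotpBl dotpBr dotpZl dotpZr (dotpC v y); ring.
Qed.

Lemma refl_isom v x : dotp (refl v x) (refl v x) = dotp x x.
Proof.
rewrite /refl !dotpBl !dotpBr !dotpZl !dotpZr (dotpC v x).
have [v0|v0] := eqVneq (dotp v v) 0; last by field.
by rewrite v0 invr0 !(mulr0, mul0r, subr0).
Qed.

Lemma reflN v x : refl (- v) x = refl v x.
Proof. by rewrite /refl !(dotpNl, dotpNr) opprK mulrN mulNr scalerN scaleNr opprK. Qed.

Lemma reflK v x : refl v (refl v x) = x.
Proof.
rewrite {1}/refl {2}/refl dotpBl dotpZl /refl.
have [v0|v0] := eqVneq (dotp v v) 0.
  by rewrite v0 invr0 !mulr0 scale0r !subr0.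
rewrite -addrA -opprD -scalerDl [X in _ - X *: _](_ : _ = 0) ?scale0r ?subr0//.
by field.
Qed.

Lemma refl_swap x y : dotp x x = dotp y y -> refl (x - y) x = y.
Proof.
move=> xy; rewrite /refl.
have [v0|v0] := eqVneq (dotp (x - y) (x - y)) 0.
  have /eqP := dotp_eq0 v0; rewrite subr_eq0 => /eqP ->.
  by rewrite subrr scaler0 subr0.
have -> : 2 * dotp x (x - y) / dotp (x - y) (x - y) = 1.
  have e : dotp (x - y) (x - y) = 2 * dotp x (x - y).
    by rewrite !dotpBl !dotpBr -xy (dotpC y x); ring.
  by rewrite -e divff.
by rewrite scale1r opprB addrC subrK.
Qed.

End dotp_theory.

Section hyperplane.
Context {R : realType} {n m : nat}.
Implicit Types (theta phi : 'rV[R]_n) (x y : 'M[R]_(n, m)).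

Lemma block_hyperplaneE theta x :
  block_hyperplane theta x <-> theta *m x = 0.
Proof. by rewrite /block_hyperplane/= mulmx_sum_row. Qed.

Lemma dotp_mulmxl (A : 'M[R]_n) x y : dotp (A *m x) y = dotp x (A^T *m y).
Proof. by rewrite !dotpE trmx_mul trmxK mxtrace_mulC !mulmxA mxtrace_mulC !mulmxA. Qed.

Lemma dotp_mulmx_row theta y (b : 'rV[R]_m) :
  dotp (theta^T *m b) y = dotp b (theta *m y).
Proof. by rewrite !dotpE trmx_mul mulmxA -mulmxA mxtrace_mulC. Qed.

Lemma unit_row theta : enorm theta = 1 -> theta *m theta^T = 1%:M.
Proof.
move=> /enorm1P; rewrite /dotp big_ord1 => h.
by apply/matrixP => i j; rewrite !ord1 !mxE eqxx -h; apply: eq_bigr => k _; rewrite mxE.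
Qed.

Definition hproj theta x := x - theta^T *m (theta *m x).

Lemma hproj_in theta x : enorm theta = 1 -> block_hyperplane theta (hproj theta x).
Proof.
move=> t1; apply/block_hyperplaneE.
by rewrite /hproj mulmxBr (mulmxA theta) unit_row// mul1mx subrr.
Qed.

Lemma dotp_hproj theta x y : block_hyperplane theta y ->
  dotp (hproj theta x) y = dotp x y.
Proof.
move=> /block_hyperplaneE ty.
by rewrite /hproj dotpBl dotp_mulmx_row ty dotp0r subr0.
Qed.

Lemma hproj_id theta x : block_hyperplane theta x -> hproj theta x = x.
Proof. by move=> /block_hyperplaneE h; rewrite /hproj h mulmx0 subr0. Qed.

Lemma dotp_hproj_sqr theta x : enorm theta = 1 ->
  dotp (hproj theta x) (hproj theta x) = dotp x x - dotp (theta *m x) (theta *m x).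
Proof.
move=> t1; rewrite dotp_hproj; last exact: hproj_in.
by rewrite /hproj dotpC dotpBl dotp_mulmx_row.
Qed.

Lemma block_hyperplaneB theta x y : block_hyperplane theta x ->
  block_hyperplane theta y -> block_hyperplane theta (x - y).
Proof.
by move=> /block_hyperplaneE h /block_hyperplaneE k; apply/block_hyperplaneE;
  rewrite mulmxBr h k subrr.
Qed.

Lemma block_hyperplaneZ theta c x : block_hyperplane theta x ->
  block_hyperplane theta (c *: x).
Proof.
by move=> /block_hyperplaneE h; apply/block_hyperplaneE; rewrite -scalemxAr h scaler0.
Qed.

Lemma refl_hyperplane theta v x : block_hyperplane theta v ->
  block_hyperplane theta x -> block_hyperplane theta (refl v x).
Proof. by move=> hv hx; apply: block_hyperplaneB => //; exact: block_hyperplaneZ. Qed.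

(** The reflection of R^n that exchanges theta and phi, acting on the block index. It is a symmetric
    involution, so it exchanges the two block hyperplanes and moves freely across the inner
    product. *)
Lemma hyperplane_isometry theta phi : enorm theta = 1 -> enorm phi = 1 ->
  exists A : 'M[R]_n, [/\ forall x y, dotp (A *m x) y = dotp x (A *m y),
    forall x, dotp (A *m x) (A *m x) = dotp x x,
    forall x, block_hyperplane theta x -> block_hyperplane phi (A *m x) &
    forall x, block_hyperplane phi x -> block_hyperplane theta (A *m x)].
Proof.
move=> /enorm1P t1 /enorm1P p1.
pose v := theta - phi; pose k := 2 / dotp v v.
pose A := 1%:M - k *: (v^T *m v).
have At : A^T = A by rewrite /A linearB/= trmx1 linearZ/= trmx_mul trmxK.
have uA (u : 'rV[R]_n) : u *m A = refl v u.
  rewrite /A mulmxBr mulmx1 -scalemxAr mulmxA /refl; congr (_ - _).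
  have -> : u *m v^T = (dotp u v)%:M.
    apply/matrixP => i j; rewrite !ord1 !mxE eqxx mulr1n /dotp big_ord1.
    by apply: eq_bigr => l _; rewrite mxE.
  by rewrite mul_scalar_mx scalerA /k mulrAC.
have tA : theta *m A = phi by rewrite uA refl_swap// t1 p1.
have pA : phi *m A = theta.
  rewrite uA -[RHS](@refl_swap _ _ _ phi theta) ?p1 ?t1//.
  by rewrite /v -reflN opprB.
have AA : A *m A = 1%:M.
  by apply/row_matrixP => i; rewrite row_mul !rowE !uA reflK mulmx1.
exists A; split => [x y|x|x|x].
- by rewrite dotp_mulmxl At.
- by rewrite dotp_mulmxl At mulmxA AA mul1mx.
- by move=> /block_hyperplaneE h; apply/block_hyperplaneE; rewrite mulmxA pA.
- by move=> /block_hyperplaneE h; apply/block_hyperplaneE; rewrite mulmxA tA.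
Qed.

End hyperplane.

Lemma measurable_dotp_fun (R : realType) n m d (T : measurableType d) (f : T -> 'M[R]_(n, m))
    (g : T -> 'M[R]_(n, m)) :
  (forall i j, measurable_fun setT (fun t => f t i j)) ->
  (forall i j, measurable_fun setT (fun t => g t i j)) ->
  measurable_fun setT (fun t => dotp (f t) (g t)).
Proof.
move=> mf mg; apply: measurable_sum => i; apply: measurable_sum => j.
exact: measurable_funM.
Qed.

Lemma measurable_mulmx_fun (R : realType) n m d (T : measurableType d) p (f : T -> 'M[R]_(n, m))
    (g : T -> 'M[R]_(m, p)) :
  (forall i j, measurable_fun setT (fun t => f t i j)) ->
  (forall i j, measurable_fun setT (fun t => g t i j)) ->
  forall i j, measurable_fun setT (fun t => (f t *m g t) i j).
Proof.
move=> mf mg i j; under eq_fun do rewrite mxE.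
by apply: measurable_sum => k; exact: measurable_funM.
Qed.

Section borel_mx_theory.
Context {R : realType} {n m : nat}.

Lemma measurable_coord (i : 'I_n) (j : 'I_m) :
  measurable_fun [set: borel_mx R n m] (fun x : borel_mx R n m => (x : 'M[R]_(n, m)) i j).
Proof.
apply: (measurability _ (RGenOpens.measurableE R)).
move=> _ [_ [a [b ->] <-]]; rewrite setTI; apply: sub_sigma_algebra => /=.
apply: open_comp; last exact: interval_open.
by move=> x _; exact: coord_continuous.
Qed.

Lemma measurable_dotp (a : 'M[R]_(n, m)) :
  measurable_fun [set: borel_mx R n m] (fun y => dotp a y).
Proof. by apply: measurable_dotp_fun => // i j; exact: measurable_coord. Qed.

Definition dotpf (a : 'M[R]_(n, m)) : borel_mx R n m -> R := fun y => dotp a y.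

HB.instance Definition _ a :=
  isMeasurableFun.Build _ _ _ _ (dotpf a) (measurable_dotp a).

Lemma measurable_usphere (theta : 'rV[R]_n) :
  measurable (usphere (block_hyperplane theta) : set (borel_mx R n m)).
Proof.
have -> : usphere (block_hyperplane theta) =
    (fun y : borel_mx R n m => dotp (theta *m y) (theta *m y)) @^-1` [set 0] `&`
    (fun y : borel_mx R n m => dotp y y) @^-1` [set 1] :> set (borel_mx R n m).
  apply/seteqP; split => y /=.
    move=> [/block_hyperplaneE h /enorm1P]; split => //=.
    by rewrite h dotp0l.
  by move=> [/= /dotp_eq0 h /enorm1P]; split => //; exact/block_hyperplaneE.
have mc := @measurable_coord.
apply: measurableI; rewrite -[X in measurable X]setTI.
  have mf : measurable_fun [set: borel_mx R n m]
      (fun y : borel_mx R n m => dotp (theta *m y) (theta *m y)).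
    apply: measurable_dotp_fun => i j; apply: measurable_mulmx_fun => //.
  exact: mf.
have mf : measurable_fun [set: borel_mx R n m] (fun y : borel_mx R n m => dotp y y).
  exact: measurable_dotp_fun.
exact: mf.
Qed.

End borel_mx_theory.

(** * Laws of linear functionals on the sphere of a block hyperplane *)

Section sphere_law.
Context {R : realType} {n m : nat}.
Notation B := (borel_mx R n m).

Lemma integral_usphere (theta : 'rV[R]_n) (sigma : {measure set B -> \bar R})
    (f g : B -> \bar R) :
  rotation_invariant_on_usphere (block_hyperplane theta) sigma ->
  measurable_fun setT f -> measurable_fun setT g ->
  (forall y, (0 <= f y)%E) -> (forall y, (0 <= g y)%E) ->
  (forall y, usphere (block_hyperplane theta) y -> f y = g y) ->
  (\int[sigma]_y f y = \int[sigma]_y g y)%E.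
Proof.
move=> [s0 _ _] mf mg f0 g0 fg; apply: ge0_ae_eq_integral => //.
exists (~` usphere (block_hyperplane theta)); split => //.
  by apply: measurableC; exact: measurable_usphere.
by move=> y; apply: contra_not => hy _; exact: fg.
Qed.

(** The reflection along e - e' preserves both the norm and H_theta, and it exchanges e and e'. *)
Lemma rotation_law (theta : 'rV[R]_n) (sigma : {measure set B -> \bar R})
    (e e' : 'M[R]_(n, m)) (psi : R -> \bar R) :
  rotation_invariant_on_usphere (block_hyperplane theta) sigma ->
  block_hyperplane theta e -> block_hyperplane theta e' -> dotp e e = dotp e' e' ->
  measurable_fun setT psi -> (forall x, (0 <= psi x)%E) ->
  (\int[sigma]_y psi (dotp e y) = \int[sigma]_y psi (dotp e' y))%E.
Proof.
move=> [_ _ inv] he he' ee' mpsi psi0.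
have law a : (\int[sigma]_y psi (dotp a y) = \int[pushforward sigma (dotpf a)]_x psi x)%E.
  by rewrite (ge0_integral_pushforward (measurable_dotp a)).
rewrite (law e) (law e'); apply: eq_measure_integral => A mA _.
change (sigma (dotpf e @^-1` A) = sigma (dotpf e' @^-1` A)).
have -> : dotpf e @^-1` A =
    refl (e - e') @^-1` (dotpf e' @^-1` A).
  have re' : refl (e - e') e' = e by rewrite -[in RHS](reflK (e - e') e) refl_swap.
  have E y : dotp e' (refl (e - e') y) = dotp e y by rewrite -refl_adj re'.
  by apply/seteqP; split => y; rewrite /preimage/= /dotpf E.
apply: inv.
- by move=> x; rewrite /enorm refl_isom.
- by move=> x hx; apply: refl_hyperplane => //; exact: block_hyperplaneB.
- by rewrite -[X in measurable X]setTI; exact: (measurable_dotp e').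
Qed.

(** Average psi(<A x, y>) over x on the sphere of H_phi and y on that of H_theta, with [A] the
    isometry between them. For fixed x the inner average does not depend on x, because A x is a unit
    vector of H_theta; for fixed y, symmetry of [A] gives <x, A y> and the same argument in H_phi.
    Tonelli equates the two constants. *)
Lemma sphere_law (theta phi : 'rV[R]_n) (st sp : probability B R)
    (e u : 'M[R]_(n, m)) (psi : R -> \bar R) :
  enorm theta = 1 -> enorm phi = 1 ->
  rotation_invariant_on_usphere (block_hyperplane theta) st ->
  rotation_invariant_on_usphere (block_hyperplane phi) sp ->
  usphere (block_hyperplane phi) e -> usphere (block_hyperplane theta) u ->
  measurable_fun setT psi -> (forall x, (0 <= psi x)%E) ->
  (\int[st]_y psi (dotp u y) = \int[sp]_y psi (dotp e y))%E.
Proof.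
move=> t1 p1 rt rp [he /enorm1P e1] [hu /enorm1P u1] mpsi psi0.
have [A [adj isom At Ap]] := @hyperplane_isometry _ _ m _ _ t1 p1.
pose F (xy : B * B) := psi (dotp (A *m (xy.1 : 'M[R]_(n, m))) xy.2).
have mc1 i j : measurable_fun [set: B * B] (fun xy : B * B => (xy.1 : 'M[R]_(n, m)) i j).
  by apply: (measurableT_comp (measurable_coord i j)); exact: measurable_fst.
have mc2 i j : measurable_fun [set: B * B] (fun xy : B * B => (xy.2 : 'M[R]_(n, m)) i j).
  by apply: (measurableT_comp (measurable_coord i j)); exact: measurable_snd.
have mF : measurable_fun setT F.
  apply: measurableT_comp => //; apply: measurable_dotp_fun => // i j.
  exact: measurable_mulmx_fun.
have F0 xy : (0 <= F xy)%E by exact: psi0.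
have I1 : (\int[sp]_x \int[st]_y F (x, y) = \int[st]_y psi (dotp u y))%E.
  transitivity (\int[sp]_x (cst (\int[st]_y psi (dotp u y)) x))%E; last first.
    by rewrite integral_cst//= probability_setT mule1.
  apply: (integral_usphere rp) => //.
  - exact: measurable_fun_fubini_tonelli_F.
  - by move=> x; exact: integral_ge0.
  - by move=> x; exact: integral_ge0.
  move=> x [hx /enorm1P x1]; rewrite /F /=.
  apply: (rotation_law rt) => //; first exact: Ap.
  by rewrite isom x1 u1.
have I2 : (\int[st]_y \int[sp]_x F (x, y) = \int[sp]_y psi (dotp e y))%E.
  transitivity (\int[st]_x (cst (\int[sp]_y psi (dotp e y)) x))%E; last first.
    by rewrite integral_cst//= probability_setT mule1.
  apply: (integral_usphere rt) => //.
  - exact: measurable_fun_fubini_tonelli_G.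
  - by move=> x; exact: integral_ge0.
  - by move=> x; exact: integral_ge0.
  move=> y [hy /enorm1P y1]; rewrite /F /=.
  under eq_integral do rewrite adj dotpC.
  apply: (rotation_law rp) => //; first exact: At.
  by rewrite isom y1 e1.
by rewrite -I1 -I2; exact: fubini_tonelli.
Qed.

(** Transports the law to one reference vector [e] and one reference measure [sp], so that theta
    survives only in the length of the projection of a. *)
Lemma sphere_law_proj (theta phi : 'rV[R]_n) (st sp : probability B R)
    (e a : 'M[R]_(n, m)) (psi : R -> \bar R) :
  enorm theta = 1 -> enorm phi = 1 ->
  rotation_invariant_on_usphere (block_hyperplane theta) st ->
  rotation_invariant_on_usphere (block_hyperplane phi) sp ->
  usphere (block_hyperplane phi) e ->
  measurable_fun setT psi -> (forall x, (0 <= psi x)%E) ->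
  (\int[st]_y psi (dotp a y) =
   \int[sp]_y psi (enorm (hproj theta a) * dotp e y)%R)%E.
Proof.
move=> t1 p1 rt rp he mpsi psi0.
set r := enorm _.
have mr : measurable_fun [set: R] (fun x => psi (r * x)).
  by apply: measurableT_comp => //; exact: measurable_funM.
transitivity (\int[st]_y psi (dotp (hproj theta a) y))%E.
  apply: (integral_usphere rt) => //.
  - by apply: measurableT_comp => //; exact: (measurable_dotp a).
  - by apply: measurableT_comp => //; exact: (measurable_dotp (hproj theta a)).
  by move=> y [hy _]; rewrite dotp_hproj.
have [r0|r0] := eqVneq r 0.
  under eq_integral do rewrite (enorm_eq0 r0) dotp0l.
  under [RHS]eq_integral do rewrite r0 mul0r.
  by rewrite !integral_cst//= !probability_setT.
pose u := r^-1 *: hproj theta a.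
have -> : hproj theta a = r *: u by rewrite /u scalerA divff// scale1r.
under eq_integral do rewrite dotpZl.
apply: (sphere_law t1 p1 rt rp he _ mr) => //.
split; first exact/block_hyperplaneZ/hproj_in.
apply/enorm1P; rewrite /u dotpZl dotpZr -enorm_sqr -/r.
by field.
Qed.

End sphere_law.

(** * Products of Gaussian mixtures *)

Section gauss_mixture.
Context {R : realType} (m N : nat) (rho : probability (borel_mx R 1 m) R).

Definition mix1 (x : 'rV[R]_m) : R :=
  fine (\int[rho]_v (expR (- dotp x v ^+ 2 / 2))%:E)%E.

Definition mix (x : 'rV[R]_m) : R := mix1 x ^+ N.

Lemma measurable_mix_integrand d (T : measurableType d) (X : T -> 'rV[R]_m) :
  (forall i j, measurable_fun setT (fun t => X t i j)) ->
  measurable_fun [set: T * borel_mx R 1 m]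
    (fun u => (expR (- dotp (X u.1) u.2 ^+ 2 / 2))%:E).
Proof.
move=> mX; apply/measurable_EFinP; apply: measurableT_comp => //.
apply: measurable_funM => //; apply: measurableT_comp => //.
apply: measurable_funX; apply: measurable_dotp_fun => i j.
  by apply: (measurableT_comp (mX i j)); exact: measurable_fst.
by apply: (measurableT_comp (measurable_coord i j)); exact: measurable_snd.
Qed.

Lemma integral_mix1 x :
  (\int[rho]_v (expR (- dotp x v ^+ 2 / 2))%:E = (mix1 x)%:E)%E.
Proof.
have m1 : measurable_fun [set: borel_mx R 1 m]
    (fun v => (expR (- dotp x v ^+ 2 / 2))%:E).
  apply/measurable_EFinP; apply: measurableT_comp => //.
  apply: measurable_funM => //; apply: measurableT_comp => //.
  by apply: measurable_funX; exact: (measurable_dotp x).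
rewrite /mix1 fineK// ge0_fin_numE; last first.
  by apply: integral_ge0 => v _; rewrite lee_fin expR_ge0.
apply: (@le_lt_trans _ _ (\int[rho]_v (cst 1 v))%E); last first.
  by rewrite integral_cst//= probability_setT mule1 ltry.
apply: ge0_le_integral => //.
move=> v _; rewrite lee_fin expR_le1 mulNr oppr_le0.
by rewrite mulr_ge0// ?invr_ge0// sqr_ge0.
Qed.

Lemma mix1_ge0 x : 0 <= mix1 x.
Proof. by apply/fine_ge0/integral_ge0 => v _; rewrite lee_fin expR_ge0. Qed.

Lemma mix1_le1 x : mix1 x <= 1.
Proof.
rewrite -lee_fin -integral_mix1.
have -> : (1%:E = \int[rho]_v (cst 1 v) :> \bar R)%E.
  by rewrite integral_cst//= probability_setT mule1.
apply: ge0_le_integral => //.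
  apply/measurable_EFinP; apply: measurableT_comp => //.
  apply: measurable_funM => //; apply: measurableT_comp => //.
  by apply: measurable_funX; exact: (measurable_dotp x).
move=> v _; rewrite lee_fin expR_le1 mulNr oppr_le0.
by rewrite mulr_ge0// ?invr_ge0// sqr_ge0.
Qed.

Lemma measurable_mix d (T : measurableType d) (X : T -> 'rV[R]_m) :
  (forall i j, measurable_fun setT (fun t => X t i j)) ->
  measurable_fun setT (fun t => mix (X t)).
Proof.
move=> mX; apply: measurable_funX; apply: measurableT_comp => //.
apply: (@measurable_fun_fubini_tonelli_F _ _ _ _ _ rho
  (fun u : T * borel_mx R 1 m => (expR (- dotp (X u.1) u.2 ^+ 2 / 2))%:E)).
  exact: measurable_mix_integrand.
by move=> u; rewrite lee_fin expR_ge0.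
Qed.

Context (n : nat).
Notation VT := (n.-tuple (N.-tuple (borel_mx R 1 m))).
Notation ZT := (n.-tuple (N.-tuple (measurableTypeR R))).

Definition PV : probability VT R := iid (iid rho N) n.
Definition PZ : probability ZT R := iid (iid (@gauss R) N) n.

Definition Zrow (t : N.-tuple (borel_mx R 1 m)) (z : N.-tuple (measurableTypeR R)) : 'rV[R]_m :=
  gsum (fun j => tnth t j : 'rV[R]_m) z.

Definition Zmx (w : VT * ZT) : 'M[R]_(n, m) :=
  \matrix_(i < n) Zrow (tnth w.1 i) (tnth w.2 i).

Lemma measurable_Zrow d (T : measurableType d) (f : T -> N.-tuple (borel_mx R 1 m))
    (g : T -> N.-tuple (measurableTypeR R)) :
  measurable_fun setT f -> measurable_fun setT g ->
  forall i j, measurable_fun setT (fun t => Zrow (f t) (g t) i j).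
Proof.
move=> mf mg i j; rewrite /Zrow /gsum.
under eq_fun do rewrite summxE; under eq_fun do under eq_bigr do rewrite mxE.
apply: measurable_sum => k; apply: measurable_funM.
  exact: (measurableT_comp (measurable_tnth k) mg).
apply: (measurableT_comp (measurable_coord i j)).
exact: (measurableT_comp (measurable_tnth k) mf).
Qed.

Lemma measurable_Zmx i j : measurable_fun setT (fun w => Zmx w i j).
Proof.
under eq_fun do rewrite mxE.
apply: measurable_Zrow.
  by apply: (measurableT_comp (measurable_tnth i)); exact: measurable_fst.
by apply: (measurableT_comp (measurable_tnth i)); exact: measurable_snd.
Qed.

(** The conditional variance of <Z, y> given the vectors v. *)
Definition var_of (y : 'M[R]_(n, m)) (v : VT) : R :=
  \sum_(i < n) \sum_(j < N) dotp (row i y) (tnth (tnth v i) j) ^+ 2.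

Lemma var_of_ge0 y v : 0 <= var_of y v.
Proof. by apply: sumr_ge0 => i _; apply: sumr_ge0 => j _; exact: sqr_ge0. Qed.

Lemma measurable_var_of y : measurable_fun setT (var_of y).
Proof.
apply: measurable_sum => i; apply: measurable_sum => j; apply: measurable_funX.
apply: (measurableT_comp (measurable_dotp (row i y))).
apply: (measurableT_comp (measurable_tnth j)); exact: measurable_tnth.
Qed.

Lemma integral_Zmx y (v : VT) :
  (\int[PZ]_z (expR (- dotp (Zmx (v, z)) y ^+ 2 / 2))%:E =
   ((Num.sqrt (1 + var_of y v))^-1)%:E)%E.
Proof.
pose b i j := dotp (row i y) (tnth (tnth v i) j).
pose xi i (z : N.-tuple (measurableTypeR R)) := \sum_(j < N) b i j * tnth z j.
pose V i := \sum_(j < N) b i j ^+ 2.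
have G i : gauss_transform (iid (@gauss R) N) (xi i) (V i).
  have := @gauss_transform_sum _ (measurableTypeR R) R (@gauss R) N
    (fun j x => b i j * x) (fun j => b i j ^+ 2).
  apply.
  - by move=> j; exact: measurable_funM.
  - by move=> j; exact: sqr_ge0.
  - by move=> j; exact: gauss_transform_gauss.
have mxi i : measurable_fun setT (xi i).
  by apply: measurable_sum => j; apply: measurable_funM => //; exact: measurable_tnth.
have V0 i : 0 <= V i by apply: sumr_ge0 => j _; exact: sqr_ge0.
have E := gauss_transform_sum mxi V0 G 0 ler01.
transitivity (\int[PZ]_z
    (expR (- (1 * ((\sum_(i < n) xi i (tnth z i)) + 0) ^+ 2) / 2))%:E)%E; last first.
  by rewrite E expr0n/= mulr0 oppr0 mul0r expR0 mulr1 mul1r.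
apply: eq_integral => z _; rewrite mul1r addr0; congr (expR (- _ ^+ 2 / 2))%:E.
rewrite dotp_sum_row; apply: eq_bigr => i _.
rewrite rowK /Zrow /gsum dotpC.
have := @is_lin_sum R _ (fun x => dotp (row i y) x) N (fun j => tnth (tnth z i) j)
  (fun j => tnth (tnth v i) j : 'rV[R]_m).
move=> ->; last by split=> *; rewrite ?dotpDr ?dotpZr.
by apply: eq_bigr => j _; rewrite mulrC.
Qed.

(** For frozen v, both g sqrt([var_of y v]) and <Z, y> are centered normal with the same variance.
    This trades a product over blocks for a function of a single linear functional of y, to which
    the sphere laws apply. *)
Lemma integral_gauss_mix y :
  (\int[@gauss R]_g (\prod_(i < n) mix (g *: row i y))%:E =
   \int[PV]_v \int[PZ]_z (expR (- dotp (Zmx (v, z)) y ^+ 2 / 2))%:E)%E.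
Proof.
pose F (u : R * VT) : \bar R := (expR (- (var_of y u.2 * u.1 ^+ 2) / 2 + 0 * u.1))%:E.
have mF : measurable_fun setT F.
  apply/measurable_EFinP; apply: measurableT_comp => //.
  apply: measurable_funD; last by apply: measurable_funM => //; exact: measurable_fst.
  apply: measurable_funM => //; apply: measurableT_comp => //.
  apply: measurable_funM.
    by apply: (measurableT_comp (measurable_var_of y)); exact: measurable_snd.
  by apply: measurable_funX; exact: measurable_fst.
transitivity (\int[@gauss R]_g \int[PV]_v F (g, v))%E.
  apply: eq_integral => g _.
  have mE i : measurable_fun [set: borel_mx R 1 m]
      (fun v => expR (- dotp (g *: row i y) v ^+ 2 / 2)).
    apply: measurableT_comp => //; apply: measurable_funM => //.
    apply: measurableT_comp => //; apply: measurable_funX.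
    exact: (measurable_dotp (g *: row i y)).
  have := @integral_iid_prod _ _ _ (iid rho N) n
    (fun i t => \prod_(j < N) expR (- dotp (g *: row i y) (tnth t j) ^+ 2 / 2))
    (fun i => mix (g *: row i y)).
  move=> <-.
  - apply: eq_integral => v _; rewrite /F/= mul0r addr0; congr EFin.
    under eq_bigr do rewrite -expR_sum; rewrite -expR_sum; congr expR.
    rewrite /var_of mulr_suml -sumrN mulr_suml; apply: eq_bigr => i _.
    rewrite mulr_suml -sumrN mulr_suml; apply: eq_bigr => j _.
    by rewrite dotpZl exprMn; ring.
  - move=> i; apply: measurable_prod => j _.
    exact: (measurableT_comp (mE i) (measurable_tnth j)).
  - by move=> i t; rewrite prodr_ge0// => j _; exact: expR_ge0.
  - move=> i; rewrite (@integral_iid_prod _ _ _ rho N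
      (fun j v => expR (- dotp (g *: row i y) v ^+ 2 / 2)) (fun=> mix1 (g *: row i y))).
    + by rewrite prodr_const card_ord.
    + by move=> j; exact: mE.
    + by move=> j v; exact: expR_ge0.
    + by move=> j; exact: integral_mix1.
rewrite (@fubini_tonelli _ _ _ _ _ (@gauss R) PV F)//; last first.
  by move=> u; rewrite lee_fin expR_ge0.
apply: eq_integral => v _; rewrite integral_Zmx /F/= gauss_expR ?var_of_ge0//.
by rewrite expr0n/= mul0r expR0 mulr1.
Qed.

End gauss_mixture.

(** * Monotonicity under majorization for products of Gaussian mixtures *)

Section schur.
Context {R : realType} (m N n : nat) (rho : probability (borel_mx R 1 m) R).
Notation VT := (n.-tuple (N.-tuple (borel_mx R 1 m))).
Notation ZT := (n.-tuple (N.-tuple (measurableTypeR R))).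
Notation ET := (m.-tuple (measurableTypeR R)).

Definition Om : probability (VT * ZT)%type R := (PV N rho n \x PZ N n)%E.
Definition PE : probability ET R := iid (@gauss R) m.

Definition proj_kernel (theta : 'rV[R]_n) (c : R) (w : VT * ZT) : \bar R :=
  (expR (- (enorm (hproj theta (Zmx w)) * c) ^+ 2 / 2))%:E.

Lemma measurable_hproj_enorm d (T : measurableType d) (X : T -> 'M[R]_(n, m))
    (theta : 'rV[R]_n) : enorm theta = 1 ->
  (forall i j, measurable_fun setT (fun t => X t i j)) ->
  measurable_fun setT (fun t => enorm (hproj theta (X t)) ^+ 2).
Proof.
move=> t1 mX; under eq_fun do rewrite enorm_sqr (dotp_hproj_sqr _ t1).
apply: measurable_funB; apply: measurable_dotp_fun => i j //.
  exact: measurable_mulmx_fun.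
exact: measurable_mulmx_fun.
Qed.

Lemma measurable_proj_kernel theta (e : 'M[R]_(n, m)) : enorm theta = 1 ->
  measurable_fun [set: borel_mx R n m * (VT * ZT)]
    (fun u => proj_kernel theta (dotp e u.1) u.2).
Proof.
move=> t1; apply/measurable_EFinP; apply: measurableT_comp => //.
apply: measurable_funM => //; apply: measurableT_comp => //.
under eq_fun do rewrite exprMn.
apply: measurable_funM.
  apply: measurable_hproj_enorm => // i j.
  exact: (measurableT_comp (measurable_Zmx i j)).
by apply: measurable_funX; exact: (measurableT_comp (measurable_dotp e)).
Qed.

Lemma integral_mix_law (theta phi : 'rV[R]_n)
    (st sp : probability (borel_mx R n m) R) (e : 'M[R]_(n, m)) :
  enorm theta = 1 -> enorm phi = 1 ->
  rotation_invariant_on_usphere (block_hyperplane theta) st ->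
  rotation_invariant_on_usphere (block_hyperplane phi) sp ->
  usphere (block_hyperplane phi) e ->
  (\int[st]_y \int[@gauss R]_g (\prod_(i < n) mix N rho (g *: row i y))%:E =
   \int[sp]_y \int[Om]_w proj_kernel theta (dotp e y) w)%E.
Proof.
move=> t1 p1 rt rp he.
pose F (u : borel_mx R n m * (VT * ZT)) := (expR (- dotp (Zmx u.2) u.1 ^+ 2 / 2))%:E.
have mF : measurable_fun setT F.
  apply/measurable_EFinP; apply: measurableT_comp => //.
  apply: measurable_funM => //; apply: measurableT_comp => //.
  apply: measurable_funX; apply: measurable_dotp_fun => i j.
    exact: (measurableT_comp (measurable_Zmx i j)).
  exact: (measurableT_comp (measurable_coord i j)).
have F0 u : (0 <= F u)%E by rewrite lee_fin expR_ge0.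
transitivity (\int[st]_y \int[Om]_w F (y, w))%E.
  apply: eq_integral => y _; rewrite integral_gauss_mix.
  rewrite (@fubini_tonelli1 _ _ _ _ _ (PV N rho n) (PZ N n) (fun w => F (y, w)))//.
  by apply: measurableT_comp mF _; exact: measurable_pair1.
rewrite (@fubini_tonelli _ _ _ _ _ st Om F)//.
transitivity (\int[Om]_w \int[sp]_y proj_kernel theta (dotp e y) w)%E.
  apply: eq_integral => w _.
  pose psi (x : R) : \bar R := (expR (- x ^+ 2 / 2))%:E.
  have mpsi : measurable_fun setT psi.
    apply/measurable_EFinP; apply: measurableT_comp => //.
    by apply: measurable_funM => //; exact: measurableT_comp.
  have psi0 x : (0 <= psi x)%E by rewrite lee_fin expR_ge0.
  exact: (sphere_law_proj (Zmx w) t1 p1 rt rp he mpsi psi0).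
rewrite (@fubini_tonelli _ _ _ _ _ sp Om
  (fun u => proj_kernel theta (dotp e u.1) u.2))//.
  exact: measurable_proj_kernel.
by move=> u; rewrite lee_fin expR_ge0.
Qed.

Definition etarow (h : ET) : 'rV[R]_m := \row_k tnth h k.

Definition lin_kernel (theta : 'rV[R]_n) (c : R) (w : VT * ZT) (h : ET) : \bar R :=
  (expR (- (c ^+ 2 * dotp (Zmx w) (Zmx w)) / 2 +
         c * dotp (etarow h) (theta *m Zmx w)))%:E.

(** By Pythagoras the exponent contains + c^2 |theta Z|^2 / 2, which is the logarithm of the
    Gaussian moment generating function of c <eta, theta Z>. The resulting kernel is the exponential
    of a sum over blocks, because theta Z = sum_i theta_i Z_i. *)
Lemma proj_kernelE theta c w : enorm theta = 1 ->
  (\int[PE]_h lin_kernel theta c w h = proj_kernel theta c w)%E.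
Proof.
move=> t1; set b := theta *m Zmx w.
pose k := expR (- (c ^+ 2 * dotp (Zmx w) (Zmx w)) / 2).
have mE j : measurable_fun [set: R] (fun x : R => expR (c * b 0 j * x)).
  by apply: measurableT_comp => //; exact: measurable_funM.
have P : (\int[PE]_h (\prod_(j < m) expR (c * b 0 j * tnth h j))%:E =
    (\prod_(j < m) expR ((c * b 0 j) ^+ 2 / 2))%:E)%E.
  apply: (@integral_iid_prod _ (measurableTypeR R) R (@gauss R) m
    (fun j x => expR (c * b 0 j * x))) => [//|j x|j]; first exact: expR_ge0.
  exact: gauss_mgf.
transitivity (\int[PE]_h (k%:E * (\prod_(j < m) expR (c * b 0 j * tnth h j))%:E))%E.
  apply: eq_integral => h _; rewrite /lin_kernel -EFinM; congr EFin.
  rewrite expRD -/k -expR_sum; congr (_ * expR _).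
  rewrite /dotp big_ord1 mulr_sumr; apply: eq_bigr => j _.
  by rewrite mxE -/b; ring.
rewrite ge0_integralZl//; last 3 first.
- apply/measurable_EFinP; apply: measurable_prod => j _.
  exact: (measurableT_comp (mE j) (measurable_tnth j)).
- by move=> h _; rewrite lee_fin prodr_ge0// => j _; exact: expR_ge0.
- by rewrite lee_fin expR_ge0.
rewrite P -EFinM /proj_kernel -expR_sum /k -expRD; congr (expR _)%:E.
rewrite exprMn enorm_sqr dotp_hproj_sqr// -/b.
have -> : \sum_(j < m) (c * b 0 j) ^+ 2 / 2 = c ^+ 2 * dotp b b / 2.
  rewrite /dotp big_ord1 mulr_sumr mulr_suml; apply: eq_bigr => j _.
  by rewrite exprMn expr2.
by ring.
Qed.

Lemma measurable_lin_kernel theta c :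
  measurable_fun [set: (VT * ZT) * ET] (fun u => lin_kernel theta c u.1 u.2).
Proof.
have mZ i j : measurable_fun [set: (VT * ZT) * ET] (fun u => Zmx u.1 i j).
  exact: (measurableT_comp (measurable_Zmx i j)).
apply/measurable_EFinP; apply: measurableT_comp => //; apply: measurable_funD.
  apply: measurable_funM => //; apply: measurableT_comp => //.
  by apply: measurable_funM => //; exact: measurable_dotp_fun.
apply: measurable_funM => //; apply: measurable_dotp_fun => i j.
  under eq_fun do rewrite mxE.
  exact: (measurableT_comp (measurable_tnth j)).
exact: measurable_mulmx_fun.
Qed.

Lemma measurable_lin_kernel1 theta c h :
  measurable_fun setT (fun w => lin_kernel theta c w h).
Proof.
exact: (measurableT_comp (measurable_lin_kernel theta c) (measurable_pair2 h)).
Qed.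

Section block.
Variables (c : R) (eta : 'rV[R]_m).
Notation T := (N.-tuple (borel_mx R 1 m)).
Notation Z := (N.-tuple (measurableTypeR R)).

Definition block_fun (r : R) (u : T * Z) : R :=
  expR (- (c ^+ 2 * dotp (Zrow u.1 u.2) (Zrow u.1 u.2)) / 2
        + r * (c * dotp eta (Zrow u.1 u.2))).

Lemma measurable_block_fun r : measurable_fun setT (block_fun r).
Proof.
have mZ i j : measurable_fun [set: T * Z] (fun u => Zrow u.1 u.2 i j).
  by apply: measurable_Zrow.
apply: measurableT_comp => //; apply: measurable_funD.
  apply: measurable_funM => //; apply: measurableT_comp => //.
  by apply: measurable_funM => //; exact: measurable_dotp_fun.
by apply: measurable_funM => //; apply: measurable_funM => //; exact: measurable_dotp_fun.
Qed.

(** From |r eta - c z|^2 >= 0. The bound does not involve the random vectors, hence the block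
    averages are finite for every r. *)
Lemma block_fun_le r u : block_fun r u <= expR (r ^+ 2 * dotp eta eta / 2).
Proof.
rewrite ler_expR -subr_ge0; set z := Zrow _ _.
have := dotp_ge0 (r *: eta - c *: z).
rewrite dotpBl !dotpBr !dotpZl !dotpZr (dotpC z eta) => h.
rewrite [leRHS](_ : _ = (r * (r * dotp eta eta) - r * (c * dotp eta z) -
    (c * (r * dotp eta z) - c * (c * dotp z z))) / 2); last by field.
by rewrite divr_ge0.
Qed.

(** The Gaussian formula at base point u = 0: the linear term disappears and r is left only through
    r^2. This is the source of the squares theta_i^2. *)
Lemma block_gauss (t : T) : exists WD : R * R, [/\ 0 < WD.1, 0 <= WD.2 &
  forall r, (\int[iid (@gauss R) N]_z (block_fun r (t, z))%:E =
    (WD.1 * expR (r ^+ 2 * WD.2))%:E)%E].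
Proof.
pose B (u w : 'rV[R]_m) := c ^+ 2 * dotp u w.
pose l (u : 'rV[R]_m) := c * dotp eta u.
have pB : is_psd B.
  split=> [u w|w|u]; rewrite /B; first by rewrite dotpC.
    by split=> *; rewrite ?dotpDl ?dotpZl; ring.
  by rewrite mulr_ge0 ?sqr_ge0 ?dotp_ge0.
have ll : is_lin l by split=> *; rewrite /l ?dotpDr ?dotpZr; ring.
have [W [D [B' [l' [W0 D0 pB' ll' E]]]]] :=
  gauss_psd (fun j => tnth t j : 'rV[R]_m) pB ll.
exists (W, D / 2); split => //=; first by rewrite divr_ge0.
move=> r; have := E 0 r.
have [B'C B'l _] := pB'.
have -> : B' 0 0 = 0 by have := (B'l 0).2 0 0; rewrite scale0r mul0r.
have -> : l' 0 = 0 by have := ll'.2 0 0; rewrite scale0r mul0r.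
rewrite oppr0 mul0r mulr0 addr0 expR0 mulr1 mulrA => <-.
by apply: eq_integral => z _; rewrite /block_fun /= add0r.
Qed.

Lemma block_mixture : exists H k : R -> R,
  [/\ forall t, 0 <= t -> 0 < H t,
      forall t t', 0 <= t -> 0 <= t' -> H t * expR (k t * (t' - t)) <= H t' &
      forall r, (\int[iid rho N]_t \int[iid (@gauss R) N]_z (block_fun r (t, z))%:E =
        (H (r ^+ 2))%:E)%E].
Proof.
have [WD hWD] := choice block_gauss.
pose W t := (WD t).1; pose D t := (WD t).2.
have W0 t : 0 < W t by case: (hWD t).
have D0 t : 0 <= D t by case: (hWD t).
have E t r : (\int[iid (@gauss R) N]_z (block_fun r (t, z))%:E =
    (W t * expR (r ^+ 2 * D t))%:E)%E by case: (hWD t).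
have b0 r u : (0 <= (block_fun r u)%:E)%E by rewrite lee_fin expR_ge0.
have mI r : measurable_fun setT (fun t => W t * expR (r ^+ 2 * D t)).
  apply/measurable_EFinP.
  rewrite (_ : _ \o _ = fun t => (\int[iid (@gauss R) N]_z (block_fun r (t, z))%:E)%E).
    apply: (@measurable_fun_fubini_tonelli_F _ _ _ _ _ (iid (@gauss R) N)
      (fun u => (block_fun r u)%:E)) => //.
    by apply/measurable_EFinP; exact: measurable_block_fun.
  by apply/funext => t; rewrite E.
(* [W] and [D] come from a pointwise choice; their measurability is recovered from the block
   integrals, which are measurable by Tonelli, at r = 0 and r = 1. *)
have mW : measurable_fun setT W.
  by have := mI 0; under eq_fun do rewrite expr0n/= mul0r expR0 mulr1.
have mD : measurable_fun setT D.
  rewrite (_ : D = fun t => ln (W t * expR (1 ^+ 2 * D t)) - ln (W t)); last first.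
    apply/funext => t; rewrite lnM ?posrE ?expR_gt0// expRK expr1n mul1r.
    by rewrite addrC addKr.
  apply: measurable_funB; apply: measurableT_comp => //; exact: measurable_ln.
pose H s := fine (\int[iid rho N]_t (W t * expR (s * D t))%:E)%E.
have HE s : 0 <= s -> (\int[iid rho N]_t (W t * expR (s * D t))%:E = (H s)%:E)%E.
  move=> s0; rewrite /H fineK// ge0_fin_numE; last first.
    by apply: integral_ge0 => t _; rewrite lee_fin mulr_ge0 ?expR_ge0// ltW.
  rewrite -(sqr_sqrtr s0); set r := Num.sqrt s.
  apply: (@le_lt_trans _ _ (\int[iid rho N]_t (cst (expR (r ^+ 2 * dotp eta eta / 2))%:E t))%E).
    apply: ge0_le_integral => //.
    - by move=> t _; rewrite lee_fin mulr_ge0 ?expR_ge0// ltW.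
    - by apply/measurable_EFinP; exact: mI.
    move=> t _; rewrite -E.
    apply: (@le_trans _ _ (\int[iid (@gauss R) N]_z
        (cst (expR (r ^+ 2 * dotp eta eta / 2))%:E z))%E).
      apply: ge0_le_integral => //.
        apply/measurable_EFinP.
        by apply: (measurableT_comp (measurable_block_fun r)); exact: measurable_pair1.
      by move=> z _; rewrite lee_fin block_fun_le.
    by rewrite integral_cst//= probability_setT mule1.
  by rewrite integral_cst//= probability_setT mule1 ltry.
have [H0 [k Hk]] := log_mixture_tangent mW mD W0 D0 HE.
exists H, k; split => // r; rewrite -HE ?sqr_ge0//.
by apply: eq_integral => t _; exact: E.
Qed.

End block.

Lemma lin_kernel_prod theta c w h : lin_kernel theta c w h =
  (\prod_(i < n) block_fun c (etarow h) (theta 0 i) (tnth w.1 i, tnth w.2 i))%:E.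
Proof.
rewrite /lin_kernel -expR_sum big_split; congr (expR _)%:E.
congr (_ + _).
  rewrite dotp_sum_row mulr_sumr -sumrN mulr_suml.
  by apply: eq_bigr => i _; rewrite rowK.
rewrite -dotp_mulmx_row dotp_sum_row mulr_sumr; apply: eq_bigr => i _.
rewrite rowK row_mul.
have -> : row i theta^T *m etarow h = theta 0 i *: etarow h.
  by apply/rowP => j; rewrite !mxE big_ord1 !mxE.
by rewrite dotpZl mulrCA.
Qed.

(** Independence of the blocks factors the integral. [H] and [k] are chosen before theta, so that
    one log-convex function serves both unit vectors. *)
Lemma integral_lin_kernel c (h : ET) : exists H k : R -> R,
  [/\ forall t, 0 <= t -> 0 < H t,
      forall t t', 0 <= t -> 0 <= t' -> H t * expR (k t * (t' - t)) <= H t' &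
      forall theta, (\int[Om]_w lin_kernel theta c w h =
        (\prod_(i < n) H (theta 0 i ^+ 2))%:E)%E].
Proof.
have [H [k [H0 Hk HE]]] := block_mixture c (etarow h).
exists H, k; split => // theta.
have b0 r u : (0 <= (block_fun c (etarow h) r u)%:E)%E by rewrite lee_fin expR_ge0.
have mb r := @measurable_block_fun c (etarow h) r.
have mbE r : measurable_fun setT (fun u => (block_fun c (etarow h) r u)%:E).
  by apply/measurable_EFinP.
rewrite (@fubini_tonelli1 _ _ _ _ _ (PV N rho n) (PZ N n))//; last 2 first.
- exact: measurable_lin_kernel1.
- by move=> w; rewrite lee_fin expR_ge0.
pose a (i : 'I_n) t := fine (\int[iid (@gauss R) N]_z
  (block_fun c (etarow h) (theta 0 i) (t, z))%:E)%E.
have aE i t : (\int[iid (@gauss R) N]_z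
    (block_fun c (etarow h) (theta 0 i) (t, z))%:E = (a i t)%:E)%E.
  by have [WD [_ _ E]] := block_gauss c (etarow h) t; rewrite /a E.
have ma i : measurable_fun setT (a i).
  apply/measurable_EFinP; rewrite (_ : _ \o _ = fun t => (\int[iid (@gauss R) N]_z
    (block_fun c (etarow h) (theta 0 i) (t, z))%:E)%E); last first.
    by apply/funext => t; rewrite /= aE.
  exact: (@measurable_fun_fubini_tonelli_F _ _ _ _ _ (iid (@gauss R) N)
      (fun u => (block_fun c (etarow h) (theta 0 i) u)%:E)).
have a0 i t : 0 <= a i t by rewrite -lee_fin -aE; exact: integral_ge0.
transitivity (\int[PV N rho n]_v (\prod_(i < n) a i (tnth v i))%:E)%E; last first.
  apply: integral_iid_prod => // i.
  by under eq_integral do rewrite -aE; rewrite HE.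
apply: eq_integral => v _; rewrite /fubini_F.
have := @integral_iid_prod _ _ R (iid (@gauss R) N) n
  (fun i z => block_fun c (etarow h) (theta 0 i) (tnth v i, z)) (fun i => a i (tnth v i)).
move=> <-.
- by apply: eq_integral => z _; rewrite lin_kernel_prod.
- move=> i; apply: (measurableT_comp (mb _)); exact: measurable_pair1.
- by move=> i z; exact: expR_ge0.
- by move=> i; exact: aE.
Qed.

(** Karamata's inequality for each fixed eta: after exchanging the integrals over eta and over (v,
    z), the inner integrals are products of values of a common [H] at theta_i^2 and phi_i^2. *)
Lemma proj_kernel_le (theta phi : 'rV[R]_n) c :
  enorm theta = 1 -> enorm phi = 1 ->
  majorized (\row_i theta 0 i ^+ 2) (\row_i phi 0 i ^+ 2) ->
  (\int[Om]_w proj_kernel theta c w <= \int[Om]_w proj_kernel phi c w)%E.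
Proof.
move=> t1 p1 maj.
have swap psi : enorm psi = 1 -> (\int[Om]_w proj_kernel psi c w =
    \int[PE]_h \int[Om]_w lin_kernel psi c w h)%E.
  move=> psi1; under eq_integral do rewrite -proj_kernelE//.
  apply: (@fubini_tonelli _ _ _ _ _ Om PE (fun u => lin_kernel psi c u.1 u.2)).
    exact: measurable_lin_kernel.
  by move=> u; rewrite lee_fin expR_ge0.
have k0 psi u : (0 <= lin_kernel psi c u.1 u.2)%E by rewrite lee_fin expR_ge0.
have mI psi := @measurable_fun_fubini_tonelli_G _ _ _ _ _ Om
  (fun u => lin_kernel psi c u.1 u.2) (@measurable_lin_kernel psi c) (k0 psi).
rewrite [X in (X <= _)%E](swap _ t1) [X in (_ <= X)%E](swap _ p1).
apply: ge0_le_integral.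
- exact: measurableT.
- by move=> h _; apply: integral_ge0 => w _; rewrite lee_fin expR_ge0.
- exact: mI.
- exact: mI.
move=> h _; have [H [k [H0 Hk HE]]] := integral_lin_kernel c h.
rewrite !HE lee_fin.
have := @karamata_prod _ H k n (\row_i theta 0 i ^+ 2) (\row_i phi 0 i ^+ 2) H0 Hk.
move=> /(_ _ _ maj).
under eq_bigr do rewrite mxE.
under [in X in _ <= X]eq_bigr do rewrite mxE.
by apply=> i; rewrite mxE sqr_ge0.
Qed.

(** Both sides become integrals over the same [sp] with the same [e], so it is enough to compare the
    kernels at each value c = <e, y>. *)
Theorem integral_mix_le (theta phi : 'rV[R]_n)
    (st sp : probability (borel_mx R n m) R) :
  enorm theta = 1 -> enorm phi = 1 ->
  rotation_invariant_on_usphere (block_hyperplane theta) st ->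
  rotation_invariant_on_usphere (block_hyperplane phi) sp ->
  usphere (block_hyperplane phi : set 'M[R]_(n, m)) !=set0 ->
  majorized (\row_i theta 0 i ^+ 2) (\row_i phi 0 i ^+ 2) ->
  (\int[st]_y \int[@gauss R]_g (\prod_(i < n) mix N rho (g *: row i y))%:E <=
   \int[sp]_y \int[@gauss R]_g (\prod_(i < n) mix N rho (g *: row i y))%:E)%E.
Proof.
move=> t1 p1 rt rp [e he] maj.
rewrite (integral_mix_law t1 p1 rt rp he) (integral_mix_law p1 p1 rp rp he).
have k0 psi (u : borel_mx R n m * (VT * ZT)) :
  (0 <= proj_kernel psi (dotp e u.1) u.2)%E by rewrite lee_fin expR_ge0.
have mI psi (psi1 : enorm psi = 1) := @measurable_fun_fubini_tonelli_F _ _ _ _ _ Om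
  _ (measurable_proj_kernel e psi1) (k0 psi).
apply: ge0_le_integral.
- exact: measurableT.
- by move=> y _; apply: integral_ge0 => w _; rewrite lee_fin expR_ge0.
- exact: mI.
- exact: mI.
by move=> y _; exact: proj_kernel_le.
Qed.

End schur.

(** * Powers as limits of Bernstein functions *)

Section power_as_bernstein.
Context {R : realType}.

Definition bern (L : seq (R * R)) (s : R) : R :=
  \sum_(q <- L) q.1 * (1 - expR (- (q.2 * s))).

Definition nneg_pairs (L : seq (R * R)) :=
  forall q, q \in L -> 0 <= q.1 /\ 0 <= q.2.

Lemma one_sub_expR_ge0 (x : R) : 0 <= x -> 0 <= 1 - expR (- x).
Proof. by move=> x0; rewrite subr_ge0 expR_le1 oppr_le0. Qed.

Lemma one_sub_expR_le (x : R) : 1 - expR (- x) <= x.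
Proof. by have := expR_ge1Dx (- x); lra. Qed.

Lemma bern_ge0 L s : nneg_pairs L -> 0 <= s -> 0 <= bern L s.
Proof.
move=> L0 s0; rewrite /bern big_seq; apply: sumr_ge0 => q /L0[q1 q2].
by rewrite mulr_ge0// one_sub_expR_ge0// mulr_ge0.
Qed.

Lemma measurable_bern L : measurable_fun setT (bern L).
Proof.
apply: measurable_sum => q; apply: measurable_funM => //.
apply: measurable_funB => //; apply: measurableT_comp => //.
by apply: measurableT_comp => //; exact: measurable_funM.
Qed.

(* The scaling relation forces [psi] to follow [s `^ a] up to a factor
   [rho `^ a] at every scale. *)
Lemma scaling_bounds (psi : R -> R) (rho a : R) : 1 < rho -> 0 <= a ->
  (forall s t, 0 <= s -> s <= t -> psi s <= psi t) -> 0 <= psi 1 ->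
  (forall s, 0 <= s -> psi (rho * s) = rho `^ a * psi s) ->
  forall s, 0 < s -> s `^ a * psi 1 <= rho `^ a * psi s /\
                     psi s <= rho `^ a * s `^ a * psi 1.
Proof.
move=> r1 a0 mono psi1 scale.
have r0 : 0 < rho by rewrite (lt_trans _ r1).
have lr : 0 < ln rho by rewrite ln_gt0.
have scaleX k s : 0 <= s -> psi (rho ^+ k * s) = (rho ^+ k) `^ a * psi s.
  move=> s0; elim: k => [|k IH]; first by rewrite !expr0 powR1 !mul1r.
  rewrite exprS -mulrA scale; last by rewrite mulr_ge0// exprn_ge0// ltW.
  by rewrite IH powRM ?exprn_ge0 ?(ltW r0)// mulrA.
have ge1 y : 1 <= y -> y `^ a * psi 1 <= rho `^ a * psi y /\
                     psi y <= rho `^ a * y `^ a * psi 1.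
  move=> y1; have y0 : 0 < y by rewrite (lt_le_trans _ y1).
  pose v := ln y / ln rho; have v0 : 0 <= v by rewrite divr_ge0 ?ln_ge0// ltW.
  pose j := Num.truncn v.
  have /andP[jv vj] : j%:R <= v < j.+1%:R by exact: truncn_itv.
  have E k : rho ^+ k = expR (k%:R * ln rho) by rewrite expRM_natl lnK ?posrE.
  have yE : y = expR (v * ln rho) by rewrite /v divfK ?gt_eqF// lnK.
  have l : rho ^+ j <= y by rewrite E yE ler_expR ler_wpM2r// ltW.
  have u : y <= rho ^+ j.+1 by rewrite E yE ler_expR ler_wpM2r ?ltW.
  have rj k : 0 <= rho ^+ k by rewrite exprn_ge0// ltW.
  have ra : 0 <= rho `^ a by exact: powR_ge0.
  split.
    apply: (@le_trans _ _ (rho `^ a * (rho ^+ j) `^ a * psi 1)).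
      rewrite ler_wpM2r// -powRM ?(ltW r0)// -exprS.
      by rewrite ge0_ler_powR// ?nnegrE// ltW.
    rewrite -mulrA ler_wpM2l//.
    rewrite -[X in _ <= X]/(psi y); apply: le_trans (mono _ _ (rj j) l).
    by have := scaleX j 1 ler01; rewrite mulr1 => ->.
  apply: (le_trans (mono _ _ (ltW y0) u)).
  have := scaleX j.+1 1 ler01; rewrite mulr1 => ->.
  rewrite ler_wpM2r// exprS powRM ?(ltW r0)// ler_wpM2l//.
  by rewrite ge0_ler_powR// ?nnegrE// ltW.
move=> s s0.
pose k := (Num.truncn (`|ln s| / ln rho)).+1.
have kb : 1 <= rho ^+ k * s.
  have -> : rho ^+ k * s = expR (k%:R * ln rho + ln s).
    by rewrite expRD expRM_natl !lnK ?posrE.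
  rewrite -[leLHS]expR0 ler_expR.
  have : `|ln s| / ln rho < k%:R by exact: truncnS_gt.
  rewrite ltr_pdivrMr// => h; have := ler_norm (- ln s); rewrite normrN; lra.
have [h1 h2] := ge1 _ kb.
have s0' := ltW s0.
have K0 : 0 < (rho ^+ k) `^ a by rewrite powR_gt0// exprn_gt0.
rewrite scaleX// powRM ?exprn_ge0 ?(ltW r0)// in h1 h2.
move: K0 h1 h2; set K := (rho ^+ k) `^ a => K0 h1 h2.
split; rewrite -(ler_pM2l K0).
  by apply: le_trans (le_trans h1 _); rewrite le_eqVlt; apply/orP; left; apply/eqP; ring.
by apply: (le_trans h2); rewrite le_eqVlt; apply/orP; left; apply/eqP; ring.
Qed.

Section geometric_sum.
Variables (rho a : R).
Hypotheses (r1 : 1 < rho) (a0 : 0 < a) (a1 : a < 1).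

Let r0 : 0 < rho. Proof. exact: lt_trans ltr01 r1. Qed.

(** The substitution l = rho^v turns s^a = C int l^(-a-1) (1 - exp(- l s)) dl into a multiple of the
    integral of [g v s] over real v. The sum over integer v is its discretization and still scales
    exactly under s -> rho s. *)
Let g (v s : R) := rho `^ (- (a * v)) * (1 - expR (- (rho `^ v * s))).

(** The window of indices v = 0, ..., n - 1 and v = -1, ..., -n of the two-sided series. *)
Let L n := [seq (rho `^ (- (a * i%:R)), rho `^ i%:R) | i <- index_iota 0 n] ++
           [seq (rho `^ (- (a * - i.+1%:R)), rho `^ (- i.+1%:R)) | i <- index_iota 0 n].

Let psiN n s := bern (L n) s.

Let psiNE n s : psiN n s = \sum_(0 <= i < n) (g i%:R s + g (- i.+1%:R) s).
Proof. by rewrite /psiN /bern big_cat !big_map [RHS]big_split. Qed.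

Let L_ge0 n : nneg_pairs (L n).
Proof.
by move=> q; rewrite mem_cat => /orP[] /mapP[i _ ->] /=; split; exact: powR_ge0.
Qed.

Let g_ge0 v s : 0 <= s -> 0 <= g v s.
Proof.
by move=> s0; rewrite mulr_ge0 ?powR_ge0// one_sub_expR_ge0// mulr_ge0 ?powR_ge0.
Qed.

Let g_shift v s : g v (rho * s) = rho `^ a * g (v + 1) s.
Proof.
have rn x y : (x + y == 0 :> R) ==> (rho != 0) by rewrite (gt_eqF r0) implybT.
have e1 : rho `^ (- (a * (v + 1))) = rho `^ (- (a * v)) * rho `^ (- a).
  by rewrite -powRD// mulrDr mulr1 opprD.
have e2 : rho `^ (v + 1) = rho `^ v * rho by rewrite powRD// powRr1// ltW.
have e3 : rho `^ a * rho `^ (- a) = 1 by rewrite -powRD// subrr powRr0.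
rewrite /g e1 e2 -(mulrA (rho `^ v)) -(mulrA _ (rho `^ (- a))).
by rewrite [RHS]mulrCA (mulrA (rho `^ a)) e3 mul1r.
Qed.

(** Ratios of the geometric majorants of the two halves: [x] for v >= 0, from 1 - exp(- t) <= 1, and
    [y] for v < 0, from 1 - exp(- t) <= t. Both are below 1 exactly because 0 < a < 1. *)
Let x := rho `^ (- a).
Let y := rho `^ (a - 1).

Let x01 : 0 < x < 1.
Proof.
rewrite powR_gt0//= /x powRN invf_lt1 ?powR_gt0//.
have : 1 `^ a < rho `^ a by rewrite gt0_ltr_powR// ?nnegrE// ltW.
by rewrite powR1.
Qed.

Let y01 : 0 < y < 1.
Proof.
rewrite powR_gt0//= /y -opprB powRN invf_lt1 ?powR_gt0//.
have : 1 `^ (1 - a) < rho `^ (1 - a) by rewrite gt0_ltr_powR ?subr_gt0// ?nnegrE// ltW.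
by rewrite powR1.
Qed.

Let g_nat_le i s : g i%:R s <= x ^+ i.
Proof.
rewrite /g -mulNr powRrM powR_mulrn ?powR_ge0// -/x.
by rewrite ler_piMr ?gerBl ?expR_ge0 ?exprn_ge0 ?powR_ge0.
Qed.

Let g_neg_le i s : 0 <= s -> g (- i%:R) s <= s * y ^+ i.
Proof.
move=> s0; have rn u v : (u + v == 0 :> R) ==> (rho != 0) by rewrite (gt_eqF r0) implybT.
have -> : s * y ^+ i = rho `^ (- (a * - i%:R)) * (rho `^ (- i%:R) * s).
  rewrite mulrA -powRD// mulrC; congr (_ * _).
  by rewrite /y -powR_mulrn ?powR_ge0// -powRrM; congr (_ `^ _); ring.
by rewrite /g ler_wpM2l ?powR_ge0// one_sub_expR_le.
Qed.

Let psiN_nd s : 0 <= s -> nondecreasing_seq (psiN ^~ s).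
Proof.
move=> s0; apply/nondecreasing_seqP => n.
by rewrite !psiNE big_nat_recr//= lerDl addr_ge0// g_ge0.
Qed.

Let psiN_ub s n : 0 <= s -> psiN n s <= (1 - x)^-1 + s * (1 - y)^-1.
Proof.
move=> s0; rewrite psiNE big_split/=; apply: lerD.
  have /andP[xp x1] := x01.
  have xn : `|x| < 1 by rewrite ger0_norm// ltW.
  have /= := @geometric_le_lim _ n 1 x ler01 xp xn; rewrite mul1r.
  by apply: le_trans; apply: ler_sum => i _ /=; rewrite mul1r g_nat_le.
have /andP[yp y1] := y01.
have yn : `|y| < 1 by rewrite ger0_norm// ltW.
have /= := @geometric_le_lim _ n s y s0 yp yn.
apply: le_trans; apply: ler_sum => i _ /=.
apply: (le_trans (g_neg_le i.+1 s0)); rewrite ler_wpM2l//.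
by rewrite exprS ger_pMl ?exprn_gt0// ltW.
Qed.

Let psi s := limn (psiN ^~ s).

Let psi_cvg s : 0 <= s -> psiN ^~ s @ \oo --> psi s.
Proof.
move=> s0; apply: nondecreasing_is_cvgn; first exact: psiN_nd.
by exists ((1 - x)^-1 + s * (1 - y)^-1) => _ [n _ <-]; exact: psiN_ub.
Qed.

Let psiN_le s n : 0 <= s -> psiN n s <= psi s.
Proof.
by move=> s0; apply: nondecreasing_cvgn_le; [exact: psiN_nd|exact: psi_cvg].
Qed.

Let psi_mono s t : 0 <= s -> s <= t -> psi s <= psi t.
Proof.
move=> s0 st; apply: (ler_cvg_to (psi_cvg s0) (psi_cvg (le_trans s0 st))).
apply: nearW => n; rewrite !psiNE; apply: ler_sum => i _.
by apply: lerD; rewrite /g ler_wpM2l ?powR_ge0// lerB// ler_expR lerN2 ler_wpM2l ?powR_ge0.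
Qed.

Let psi1_gt0 : 0 < psi 1.
Proof.
apply: (@lt_le_trans _ _ (psiN 1 1)); last exact: psiN_le.
rewrite psiNE big_nat1 ltr_pwDl ?g_ge0//.
rewrite /g mulr0 oppr0 !powRr0 !mul1r subr_gt0.
by rewrite expR_lt1 ltrN10.
Qed.

Let psi_scale s : 0 <= s -> psi (rho * s) = rho `^ a * psi s.
Proof.
move=> s0; have rs0 : 0 <= rho * s by rewrite mulr_ge0// ltW.
(* Passing from s to rho s moves the window [-n, n - 1] to [-n + 1, n]; the term gained and the term
   lost both tend to 0. *)
have shift n : psiN n (rho * s) =
    rho `^ a * (psiN n s + g n%:R s - g (- n%:R) s).
  elim: n => [|n IH]; first by rewrite !psiNE !big_nil oppr0 add0r subrr mulr0.
  rewrite !psiNE !big_nat_recr//= -!psiNE IH !g_shift.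
  have -> : n%:R + 1 = n.+1%:R :> R by rewrite -natr1.
  have -> : - n.+1%:R + 1 = - n%:R :> R by rewrite -natr1; ring.
  move: (psiN n s) (g n%:R s) (g (- n%:R) s) (g n.+1%:R s) (g (- n.+1%:R) s).
  by move=> A B C D E; ring.
have gn0 : (fun n => g n%:R s) @ \oo --> 0.
  apply: (@squeeze_cvgr _ _ _ _ (cst 0) (fun n => x ^+ n)).
  - by apply: nearW => n; rewrite g_ge0//= g_nat_le.
  - exact: cvg_cst.
  - by apply: cvg_expr; have /andP[xp x1] := x01; rewrite ger0_norm// ltW.
have gm0 : (fun n => g (- n%:R) s) @ \oo --> 0.
  apply: (@squeeze_cvgr _ _ _ _ (cst 0) (fun n => s * y ^+ n)).
  - by apply: nearW => n; rewrite g_ge0//= g_neg_le.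
  - exact: cvg_cst.
  - rewrite -[X in _ --> X](mulr0 s); apply: cvgM; first exact: cvg_cst.
    by apply: cvg_expr; have /andP[yp y1] := y01; rewrite ger0_norm// ltW.
have C : (fun n => psiN n (rho * s)) @ \oo --> rho `^ a * (psi s + 0 - 0).
  under eq_cvg do rewrite shift.
  apply: cvgM; first exact: cvg_cst.
  exact: (cvgB (cvgD (psi_cvg s0) gn0) gm0).
rewrite addr0 subr0 in C.
by apply/cvg_lim.
Qed.

(** The two-sided series, normalized to be 1 at s = 1. By its scaling relation it stays within a
    factor rho^a of s^a, so it becomes s^a as rho tends to 1. *)
Lemma geometric_bern : exists (Ls : nat -> seq (R * R)) (f : R -> R),
  [/\ forall n, nneg_pairs (Ls n), forall s, 0 <= s -> bern^~ s \o Ls @ \oo --> f s,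
      forall n s, 0 <= s -> bern (Ls n) s <= f s &
      forall s, 0 <= s -> rho `^ (- a) * s `^ a <= f s <= rho `^ a * s `^ a].
Proof.
pose c := (psi 1)^-1; have c0 : 0 < c by rewrite invr_gt0 psi1_gt0.
have bE n s : bern [seq (c * q.1, q.2) | q <- L n] s = c * psiN n s.
  rewrite /bern big_map mulr_sumr; apply: eq_bigr => q _ /=; by rewrite mulrA.
exists (fun n => [seq (c * q.1, q.2) | q <- L n]), (fun s => c * psi s); split.
- move=> n _ /mapP[q /L_ge0[q1 q2] ->] /=; split => //.
  by rewrite mulr_ge0// ltW.
- move=> s s0; rewrite /comp; under eq_cvg do rewrite bE.
  by apply: cvgM; [exact: cvg_cst|exact: psi_cvg].
- by move=> n s s0; rewrite bE ler_pM2l// psiN_le.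
move=> s; rewrite le_eqVlt => /predU1P[<-|s0].
  have -> : psi 0 = 0.
    apply/cvg_lim => //; rewrite (_ : (fun n => _) = cst 0); first exact: cvg_cst.
    apply/funext => n; rewrite psiNE big1// => i _.
    by rewrite /g !mulr0 oppr0 expR0 subrr !mulr0 addr0.
  by rewrite powR0 ?gt_eqF// !mulr0 lexx.
have [h1 h2] := scaling_bounds r1 (ltW a0) psi_mono (ltW psi1_gt0) psi_scale s0.
have rp : 0 < rho `^ a by exact: powR_gt0.
rewrite /c; apply/andP; split.
  rewrite [leRHS]mulrC ler_pdivlMr ?psi1_gt0// powRN -mulrA ler_pdivrMl//.
by rewrite [leLHS]mulrC ler_pdivrMr ?psi1_gt0.
Qed.

End geometric_sum.

(** Phrased as closure under dominated limits because two limits are nested: the series for fixed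
    rho, then rho = 1 + 1 / (k + 1) tending to 1. The majorant 2 s^a is preserved throughout, since
    rho^a <= rho <= 2, and it lets users apply dominated convergence. *)
Lemma powR_bern_ind (a : R) (P : (R -> R) -> Prop) : 0 < a <= 1 ->
  (forall L, nneg_pairs L -> (forall s, 0 <= s -> bern L s <= 2 * s `^ a) ->
    P (bern L)) ->
  (forall (f_ : nat -> R -> R) (f : R -> R), (forall k, P (f_ k)) ->
    (forall k s, 0 <= s -> 0 <= f_ k s <= 2 * s `^ a) ->
    (forall s, 0 <= s -> f_ ^~ s @ \oo --> f s) -> P f) ->
  P (fun s => s `^ a).
Proof.
move=> /andP[a0 a1] Pbern Plim.
have inv_cvg : (fun k : nat => (1 + k.+1%:R^-1 : R)) @ \oo --> (1 : R).
  rewrite -[X in _ --> X]addr0; apply: cvgD; first exact: cvg_cst.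
  exact: cvg_harmonic.
(* For a = 1 the ratio rho^(a - 1) is 1 and the series diverges. Here s is approached by (k + 1) (1
   - exp(- s / (k + 1))), squeezed through u / (1 + u) <= 1 - exp(- u) <= u. *)
move: a1; rewrite le_eqVlt => /predU1P[a1|a1].
  pose f k s := bern [:: (k.+1%:R, k.+1%:R^-1)] s.
  have fE k s : f k s = k.+1%:R * (1 - expR (- (k.+1%:R^-1 * s))).
    by rewrite /f /bern big_seq1.
  have fle k s : f k s <= s.
    rewrite fE -[leRHS](@mulVKf _ k.+1%:R) ?pnatr_eq0//.
    by rewrite ler_wpM2l// one_sub_expR_le.
  have n1 k : nneg_pairs [:: (k.+1%:R, k.+1%:R^-1)].
    by move=> q; rewrite inE => /eqP -> /=; rewrite invr_ge0 !ler0n.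
  have s2 s : 0 <= s -> s <= 2 * s `^ a by move=> s0; rewrite a1 powRr1//; lra.
  apply: (Plim f).
  - by move=> k; apply: Pbern => // s s0; apply: (le_trans (fle k s)); exact: s2.
  - by move=> k s s0; rewrite bern_ge0//= (le_trans (fle k s))// s2.
  move=> s s0; rewrite a1 powRr1//.
  apply: (@squeeze_cvgr _ _ _ _ (fun k => s / (1 + k.+1%:R^-1 * s)) (cst s)).
  - apply: nearW => k; rewrite fle andbT fE.
    set u := k.+1%:R^-1 * s; have u0 : 0 <= u by rewrite mulr_ge0// invr_ge0.
    have -> : s = k.+1%:R * u by rewrite /u mulVKf ?pnatr_eq0.
    rewrite -mulrA ler_wpM2l//.
    have := expR_ge1Dx u; rewrite expRN => h.
    have -> : u / (1 + u) = 1 - (1 + u)^-1 by field; rewrite gt_eqF//; lra.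
    by rewrite lerB// lef_pV2// posrE ?expR_gt0//; lra.
  - rewrite -[X in _ --> X]mulr1 -[X in _ * X]invr1; apply: cvgM; first exact: cvg_cst.
    apply: cvgV; rewrite ?oner_eq0//.
    rewrite -[X in _ --> X]addr0; apply: cvgD; first exact: cvg_cst.
    rewrite -(mul0r s); apply: cvgM; last exact: cvg_cst.
    exact: cvg_harmonic.
  - exact: cvg_cst.
pose rho k : R := 1 + k.+1%:R^-1.
have r1 k : 1 < rho k by rewrite ltrDl invr_gt0.
have r2 k : rho k <= 2.
  have : k.+1%:R^-1 <= 1 :> R by rewrite invf_le1// ler1n.
  by rewrite /rho (_ : 2 = 1 + 1 :> R) ?lerD2l// -mulr2n.
have /choice[f hf] : forall k, exists f : R -> R, P f /\
    forall s, 0 <= s -> (rho k) `^ (- a) * s `^ a <= f s <= (rho k) `^ a * s `^ a.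
  move=> k; have [Ls [f [Ls0 Lsf Lsle fb]]] := geometric_bern (r1 k) a0 a1.
  have ra2 : rho k `^ a <= 2.
    apply: (@le_trans _ _ (rho k `^ 1)); last by rewrite powRr1// ltW// (lt_trans _ (r1 k)).
    by rewrite ler_powR ?ltW.
  have f2 s : 0 <= s -> f s <= 2 * s `^ a.
    move=> s0; have /andP[_] := fb s s0; move/le_trans; apply.
    by rewrite ler_wpM2r// powR_ge0.
  exists f; split => //; apply: (Plim (fun n => bern (Ls n))) => //.
  - move=> n; apply: Pbern => // s s0.
    by apply: (le_trans (Lsle n s s0)); exact: f2.
  - move=> n s s0; rewrite bern_ge0//=.
    by apply: (le_trans (Lsle n s s0)); exact: f2.
have rcvg b : (fun k => rho k `^ b) @ \oo --> (1 : R).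
  rewrite (_ : (fun k => _) = fun k => expR (b * ln (rho k))); last first.
    by apply/funext => k; rewrite /powR gt_eqF// (lt_trans _ (r1 k)).
  rewrite -[X in _ --> X](@expR0 R) -[X in expR X](mulr0 b).
  apply: continuous_cvg; first exact: continuous_expR.
  apply: cvgM; first exact: cvg_cst.
  rewrite -[X in _ --> X](@ln1 R); apply: continuous_cvg => //.
  exact: continuous_ln.
apply: (Plim f).
- by move=> k; have [] := hf k.
- move=> k s s0; have [_ /(_ s s0)/andP[h1 h2]] := hf k.
  rewrite (le_trans _ h1) ?mulr_ge0 ?powR_ge0//= (le_trans h2)// ler_wpM2r ?powR_ge0//.
  apply: (@le_trans _ _ (rho k `^ 1)); last by rewrite powRr1// ltW// (lt_trans _ (r1 k)).
  by rewrite ler_powR ?ltW.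
move=> s s0.
apply: (@squeeze_cvgr _ _ _ _ (fun k => rho k `^ (- a) * s `^ a)
  (fun k => rho k `^ a * s `^ a)).
- by apply: nearW => k; have [_ /(_ s s0)] := hf k.
- rewrite -[X in _ --> X]mul1r; apply: cvgM; last exact: cvg_cst.
  exact: rcvg.
- rewrite -[X in _ --> X]mul1r; apply: cvgM; last exact: cvg_cst.
  exact: rcvg.
Qed.

End power_as_bernstein.

(** * Passage to the limit *)

Section limits_of_means.
Context {R : realType}.

Lemma le_integral_cvg d1 (T1 : measurableType d1) d2 (T2 : measurableType d2)
    (m1 : {measure set T1 -> \bar R}) (m2 : {measure set T2 -> \bar R})
    (F1 : nat -> T1 -> R) (F2 : nat -> T2 -> R) (f1 g1 : T1 -> R) (f2 g2 : T2 -> R) :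
  (forall k, measurable_fun setT (F1 k)) -> (forall k, measurable_fun setT (F2 k)) ->
  (forall x, F1 ^~ x @ \oo --> f1 x) -> (forall x, F2 ^~ x @ \oo --> f2 x) ->
  m1.-integrable setT (EFin \o g1) -> m2.-integrable setT (EFin \o g2) ->
  (forall k x, `|F1 k x| <= g1 x) -> (forall k x, `|F2 k x| <= g2 x) ->
  (forall k, (\int[m1]_x (F1 k x)%:E <= \int[m2]_x (F2 k x)%:E)%E) ->
  (\int[m1]_x (f1 x)%:E <= \int[m2]_x (f2 x)%:E)%E.
Proof.
move=> mF1 mF2 c1 c2 i1 i2 b1 b2 le12.
have D d (T : measurableType d) (m : {measure set T -> \bar R}) (F : nat -> T -> R)
    (f g : T -> R) : (forall k, measurable_fun setT (F k)) ->
    (forall x, F ^~ x @ \oo --> f x) -> m.-integrable setT (EFin \o g) ->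
    (forall k x, `|F k x| <= g x) ->
    (fun k => \int[m]_x (F k x)%:E)%E @ \oo --> (\int[m]_x (f x)%:E)%E.
  move=> mF c i b.
  have [//|||||_ _] := @dominated_convergence _ _ _ m setT measurableT
    (fun k x => (F k x)%:E) (fun x => (f x)%:E) (EFin \o g).
  - by move=> k; exact/measurable_EFinP.
  - by apply/measurable_EFinP; apply: (measurable_fun_cvg mF) => x _; exact: c.
  - by apply: aeW => x _; apply: cvg_EFin; [exact: nearW|exact: c].
  - exact: i.
  - by apply: aeW => x k _; rewrite lee_fin.
  - by [].
apply: (lee_cvg_to (D _ _ _ _ _ _ mF1 c1 i1 b1) (D _ _ _ _ _ _ mF2 c2 i2 b2)).
exact: nearW.
Qed.

Context {m n : nat}.
Notation B := (borel_mx R n m).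

(** Tested along arbitrary coordinatewise measurable maps, so that it applies directly to the scaled
    rows g y_i as functions on the product space of pairs (y, g). *)
Definition coord_measurable (f : 'rV[R]_m -> R) :=
  forall d (T : measurableType d) (X : T -> 'rV[R]_m),
  (forall i j, measurable_fun setT (fun t => X t i j)) ->
  measurable_fun setT (fun t => f (X t)).

Definition gmean (s : {measure set B -> \bar R}) (f : 'rV[R]_m -> R) : \bar R :=
  (\int[s]_y \int[@gauss R]_g (\prod_(i < n) f (g *: row i y))%:E)%E.

Lemma measurable_scale_row i :
  forall k j, measurable_fun [set: B * measurableTypeR R]
    (fun u : B * measurableTypeR R => (u.2 *: row i (u.1 : 'M[R]_(n, m))) k j).
Proof.
move=> k j; under eq_fun do rewrite !mxE.
apply: measurable_funM; first exact: measurable_snd.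
exact: (measurableT_comp (measurable_coord i j)).
Qed.

Lemma measurable_gmean_integrand f : coord_measurable f ->
  measurable_fun [set: B * measurableTypeR R]
    (fun u : B * measurableTypeR R => \prod_(i < n) f (u.2 *: row i (u.1 : 'M[R]_(n, m)))).
Proof.
by move=> mf; apply: measurable_prod => i _; apply: mf; exact: measurable_scale_row.
Qed.

Lemma gmeanE (s : probability B R) f : coord_measurable f -> (forall x, 0 <= f x) ->
  gmean s f = (\int[s \x @gauss R]_u
    (\prod_(i < n) f (u.2 *: row i (u.1 : 'M[R]_(n, m))))%:E)%E.
Proof.
move=> mf f0; rewrite fubini_tonelli1//.
  by apply/measurable_EFinP; exact: measurable_gmean_integrand.
by move=> u; rewrite lee_fin prodr_ge0.
Qed.

Lemma cvg_prod_seq (I : Type) (r : seq I) (f : I -> nat -> R) (l : I -> R) :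
  (forall i, f i @ \oo --> l i) ->
  (fun k => \prod_(i <- r) f i k) @ \oo --> \prod_(i <- r) l i.
Proof.
move=> c; elim: r => [|i r IH].
  by rewrite big_nil; under eq_cvg do rewrite big_nil; exact: cvg_cst.
by rewrite big_cons; under eq_cvg do rewrite big_cons; exact: cvgM.
Qed.

Lemma coord_measurable_cvg (f_ : nat -> 'rV[R]_m -> R) (f : 'rV[R]_m -> R) :
  (forall k, coord_measurable (f_ k)) -> (forall x, f_ ^~ x @ \oo --> f x) ->
  coord_measurable f.
Proof.
move=> mf c d T X mX.
by apply: (measurable_fun_cvg (fun k => mf k _ _ _ mX)) => t _; exact: c.
Qed.

Lemma gmean_cvg_le (st sp : probability B R) (f_ : nat -> 'rV[R]_m -> R)
    (f : 'rV[R]_m -> R) :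
  (forall k, coord_measurable (f_ k)) -> (forall k x, 0 <= f_ k x <= 1) ->
  (forall x, f_ ^~ x @ \oo --> f x) ->
  (forall k, (gmean st (f_ k) <= gmean sp (f_ k))%E) ->
  (gmean st f <= gmean sp f)%E.
Proof.
move=> mf f01 c le; have mlim := coord_measurable_cvg mf c.
have f0 x : 0 <= f x.
  apply: (ler_cvg_to (cvg_cst 0) (c x)); apply: nearW => k.
  by have /andP[] := f01 k x.
rewrite !gmeanE//.
have b k (u : B * measurableTypeR R) :
    `|\prod_(i < n) f_ k (u.2 *: row i (u.1 : 'M[R]_(n, m)))| <= cst 1 u.
  rewrite ger0_norm; last by rewrite prodr_ge0// => i _; have /andP[] := f01 k (u.2 *: row i u.1).
  by apply: prodr_ile1 => i _; exact: f01.
have cv (u : B * measurableTypeR R) :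
    (fun k => \prod_(i < n) f_ k (u.2 *: row i (u.1 : 'M[R]_(n, m)))) @ \oo -->
    \prod_(i < n) f (u.2 *: row i (u.1 : 'M[R]_(n, m))).
  by apply: cvg_prod_seq => i; exact: c.
have int1 (s : probability B R) : (s \x @gauss R)%E.-integrable setT (EFin \o cst 1).
  by have := @finite_measure_integrable_cst _ _ R
    ((s \x @gauss R)%E : probability (B * measurableTypeR R)%type R) setT 1; apply.
apply: (le_integral_cvg _ _ cv cv (int1 st) (int1 sp) b b) => k.
- exact: measurable_gmean_integrand.
- exact: measurable_gmean_integrand.
- have fk0 x : 0 <= f_ k x by have /andP[] := f01 k x.
  by rewrite -!gmeanE.
Qed.

End limits_of_means.

(** With x = c / N, the bounds exp(- x / (1 - x)) <= 1 - x <= exp(- x) are raised to the power N.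
    The shift by [K] ensures x < 1 from the first term on. *)
Lemma cvg_pow_expR (R : realType) (c : R) (K : nat) : 0 <= c -> c <= K%:R ->
  (fun k => (1 - c / (k + K).+1%:R) ^+ (k + K).+1) @ \oo --> expR (- c).
Proof.
move=> c0 cK.
pose N k : R := (k + K).+1%:R.
have N0 k : 0 < N k by rewrite ltr0n.
have cN k : c < N k by rewrite (le_lt_trans cK)// ltr_nat ltnS leq_addl.
have iN : (fun k => c / N k) @ \oo --> (0 : R).
  rewrite -[X in _ --> X](mulr0 c); apply: cvgM; first exact: cvg_cst.
  by have := @cvg_harmonic R; rewrite -(cvg_shiftn K).
apply: (@squeeze_cvgr _ _ _ _ (fun k => expR (- (c / (1 - c / N k)))) (cst (expR (- c)))).
- apply: nearW => k; set x := c / N k.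
  have x0 : 0 <= x by rewrite divr_ge0// ltW.
  have x1 : x < 1 by rewrite ltr_pdivrMr// mul1r.
  have cE : c = N k * x by rewrite /x mulrC divfK// gt_eqF.
  have E y : expR (- (N k * y)) = expR (- y) ^+ (k + K).+1 by rewrite -mulrN expRM_natl.
  rewrite -/(N k) -/x; apply/andP; split.
    rewrite {1}cE -mulrA E lerXn2r ?nnegrE ?expR_ge0 ?subr_ge0 ?(ltW x1)//.
    rewrite expRN -[leRHS]invrK lef_pV2 ?posrE ?expR_gt0 ?invr_gt0 ?subr_gt0//.
    apply: le_trans (expR_ge1Dx _); rewrite le_eqVlt; apply/orP; left; apply/eqP.
    by field; rewrite subr_eq0 gt_eqF.
  rewrite cE E lerXn2r ?nnegrE ?expR_ge0 ?subr_ge0 ?(ltW x1)//.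
  exact: expR_ge1Dx.
- apply: continuous_cvg; first exact: continuous_expR.
  apply: cvgN; rewrite -[X in _ --> X]mulr1 -[X in _ * X]invr1.
  apply: cvgM; first exact: cvg_cst.
  apply: cvgV; rewrite ?oner_eq0//.
  rewrite -[X in _ --> X]subr0; apply: cvgB; first exact: cvg_cst.
  exact: iN.
- exact: cvg_cst.
Qed.

Lemma probability_of_measure d (T : measurableType d) (R : realType)
    (nu : {measure set T -> \bar R}) : nu setT = 1%E ->
  exists rho : probability T R, rho = nu :> (set T -> \bar R).
Proof.
move=> nu1; exists (mnormalize nu (dirac point)).
apply/funext => A; rewrite /= /mnormalize /= nu1 /=.
by rewrite onee_eq0 /= invr1 mule1.
Qed.

(** * Exponentials of Bernstein means as limits of powers of Gaussian mixtures *)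

Section scale_borel.
Context {R : realType} {m : nat}.
Notation B1 := (borel_mx R 1 m).

Definition scale_borel (k : R) : B1 -> B1 := fun u => k *: (u : 'rV[R]_m).

Lemma measurable_scale_borel k : measurable_fun setT (scale_borel k).
Proof.
apply: (@measurability _ _ B1 B1 setT (scale_borel k) (@open 'rV[R]_m)) => //.
move=> _ [A oA <-]; rewrite setTI; apply: sub_sigma_algebra => /=.
by apply: open_comp oA => x _; exact: scaler_continuous.
Qed.

End scale_borel.

Section integral_bern.
Context {R : realType} d (T : measurableType d) (mu : {measure set T -> \bar R}).
Variables (M : R) (X : T -> R).
Hypothesis muM : mu setT = M%:E.
Hypothesis mX : measurable_fun setT X.
Hypothesis X0 : forall u, 0 <= X u.

Lemma integral_expR_le (l : R) : 0 <= l ->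
  exists2 E : R, 0 <= E <= M & (\int[mu]_u (expR (- (l * X u)))%:E = E%:E)%E.
Proof.
move=> l0; set I := (\int[mu]_u _)%E.
have I0 : (0 <= I)%E by apply: integral_ge0 => u _; rewrite lee_fin expR_ge0.
have IM : (I <= M%:E)%E.
  have -> : (M%:E = \int[mu]_u (cst 1 u) :> \bar R)%E by rewrite integral_cst//= mul1e.
  apply: ge0_le_integral => //.
    apply/measurable_EFinP; apply: measurableT_comp => //; apply: measurableT_comp => //.
    by apply: measurable_funM.
  by move=> u _; rewrite lee_fin expR_le1 oppr_le0 mulr_ge0.
have If : I \is a fin_num by rewrite ge0_fin_numE// (le_lt_trans IM)// ltry.
by exists (fine I); rewrite ?fineK// -!lee_fin fineK// I0 IM.
Qed.

Lemma integral_bern (L : seq (R * R)) : nneg_pairs L ->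
  exists E : R * R -> R,
   [/\ (forall q, q \in L -> (\int[mu]_u (expR (- (q.2 * X u)))%:E = (E q)%:E)%E),
       (forall q, q \in L -> 0 <= E q <= M) &
       (\int[mu]_u (bern L (X u))%:E = (\sum_(q <- L) q.1 * (M - E q))%:E)%E].
Proof.
move=> L0.
pose E (q : R * R) := fine (\int[mu]_u (expR (- (q.2 * X u)))%:E)%E.
have EE q : 0 <= q.2 -> (\int[mu]_u (expR (- (q.2 * X u)))%:E = (E q)%:E)%E /\
    0 <= E q <= M.
  by move=> q2; have [e eM eE] := integral_expR_le q2; rewrite /E eE.
exists E; split=> [q /L0[_ /EE[]]|q /L0[_ /EE[]]|] //.
elim: L L0 => [|q L IH] L0.
  by rewrite big_nil; under eq_integral do rewrite /bern big_nil; rewrite integral0.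
have L0' : nneg_pairs L by move=> q' q'L; apply: L0; rewrite inE q'L orbT.
have [q1 q2] := L0 q (mem_head _ _).
have [Eq EqM] := EE q q2.
rewrite big_cons EFinD -IH//.
under eq_integral do rewrite /bern big_cons -/(bern L _) EFinD.
have mq : measurable_fun setT (fun u => expR (- (q.2 * X u))).
  by apply: measurableT_comp => //; apply: measurableT_comp => //; exact: measurable_funM.
rewrite ge0_integralD//; last 4 first.
- by move=> u _; rewrite lee_fin mulr_ge0// one_sub_expR_ge0// mulr_ge0.
- apply/measurable_EFinP; apply: measurable_funM => //.
  exact: measurable_funB.
- by move=> u _; rewrite lee_fin bern_ge0.
- by apply/measurable_EFinP; exact: (measurableT_comp (measurable_bern L)).
congr (_ + _)%E.
under eq_integral do rewrite EFinM.
rewrite ge0_integralZl//; last 2 first.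
- by apply/measurable_EFinP; exact: measurable_funB.
- by move=> u _; rewrite lee_fin one_sub_expR_ge0// mulr_ge0.
rewrite EFinM; congr (_ * _)%E.
have : (\int[mu]_u ((1 - expR (- (q.2 * X u)))%:E + (expR (- (q.2 * X u)))%:E) = M%:E)%E.
  under eq_integral do rewrite -EFinD subrK.
  by rewrite integral_cst//= mul1e.
rewrite ge0_integralD//; last 3 first.
- by move=> u _; rewrite lee_fin one_sub_expR_ge0// mulr_ge0.
- by apply/measurable_EFinP; exact: measurable_funB.
- by apply/measurable_EFinP.
rewrite Eq => h.
by rewrite EFinB -h addeK.
Qed.

End integral_bern.

Section mixture_measure.
Context {R : realType} {m : nat} (mu : {measure set (borel_mx R 1 m) -> \bar R}).
Variable M : R.
Hypothesis muM : mu setT = M%:E.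
Hypothesis M0 : 0 < M.
Notation B1 := (borel_mx R 1 m).

(** The scale sqrt(2 l) is the one for which v = sqrt(2 l) u gives exp(- <x, v>^2 / 2) = exp(- l <x,
    u>^2). *)
Lemma weighted_measure (L : seq (R * R)) : nneg_pairs L ->
  exists nu : {measure set B1 -> \bar R}, forall h : B1 -> \bar R,
    measurable_fun setT h -> (forall u, (0 <= h u)%E) ->
    (\int[nu]_v h v = \sum_(q <- L) q.1%:E *
       \int[mu]_u h (scale_borel (Num.sqrt (2 * q.2)) u))%E.
Proof.
elim: L => [|q L IH] L0.
  exists mzero => h mh h0; rewrite big_nil; exact: integral_measure_zero.
have [|nu nuE] := IH; first by move=> q' q'L; apply: L0; rewrite inE q'L orbT.
have [q1 q2] := L0 q (mem_head _ _).
pose pm : {measure set B1 -> \bar R} :=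
  measure_function_pushforward__canonical__measure_function_Measure mu
    (measurable_scale_borel (Num.sqrt (2 * q.2))).
exists (measure_add (mscale (NngNum q1) pm) nu).
move=> h mh h0; rewrite big_cons ge0_integral_measure_add// ge0_integral_mscale//=.
rewrite nuE//; congr (_ * _ + _)%E.
exact: (ge0_integral_pushforward (measurable_scale_borel _)).
Qed.

Definition bern_mean (psi : R -> R) (x : 'rV[R]_m) : R :=
  fine (\int[mu]_u (psi (dotp x u ^+ 2))%:E)%E.

Lemma bern_meanE (L : seq (R * R)) (x : 'rV[R]_m) : nneg_pairs L ->
  exists E : R * R -> R,
   [/\ (forall q, q \in L -> (\int[mu]_u (expR (- (q.2 * dotp x u ^+ 2)))%:E = (E q)%:E)%E),
       (forall q, q \in L -> 0 <= E q <= M) &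
       (\int[mu]_u (bern L (dotp x u ^+ 2))%:E =
         (\sum_(q <- L) q.1 * (M - E q))%:E)%E].
Proof.
apply: integral_bern => //; last by move=> u; exact: sqr_ge0.
by apply: measurable_funX; exact: (measurable_dotp x).
Qed.

Lemma bern_mean_ge0 L x : nneg_pairs L -> 0 <= bern_mean (bern L) x.
Proof.
move=> L0; apply: fine_ge0; apply: integral_ge0 => u _.
by rewrite lee_fin bern_ge0// sqr_ge0.
Qed.

Lemma bern_mean_le L x : nneg_pairs L -> bern_mean (bern L) x <= (\sum_(q <- L) q.1) * M.
Proof.
move=> L0; have [E [_ E0 eq]] := bern_meanE x L0.
rewrite /bern_mean eq/= mulr_suml big_seq [leRHS]big_seq; apply: ler_sum => q qL.
have [q1 _] := L0 q qL; have /andP[e0 eM] := E0 q qL.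
by rewrite ler_wpM2l// gerBl.
Qed.

(** The link between Bernstein functions and Gaussian mixtures: exp(- B) is the limit of (1 - B / (N
    + 1))^(N + 1), and for large N the base is itself a mixture. This is why powers of mixtures are
    treated above. *)
Lemma mix1_bern L (N : nat) : nneg_pairs L -> (\sum_(q <- L) q.1) * M <= N%:R ->
  exists rho : probability B1 R, forall x,
    mix1 rho x = 1 - bern_mean (bern L) x / N.+1%:R.
Proof.
move=> L0 LN.
have N1 : 0 < N.+1%:R :> R by rewrite ltr0n.
(* The missing mass goes to the origin: the pair ([w0], 0) collapses [mu] by the scale sqrt 0 = 0
   and contributes w0 M, which brings the total to 1. The hypothesis [LN] gives w0 >= 0. *)
pose w0 := M^-1 - (\sum_(q <- L) q.1) / N.+1%:R.
have w00 : 0 <= w0.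
  rewrite subr_ge0 ler_pdivrMr// mulrC ler_pdivlMr//.
  by apply: (le_trans LN); rewrite ler_nat leqnSn.
pose L' := (w0, 0) :: [seq (q.1 / N.+1%:R, q.2) | q <- L].
have L'0 : nneg_pairs L'.
  move=> q; rewrite inE => /predU1P[->//|/mapP[q' /L0[q1 q2] ->]] /=.
  by split => //; rewrite divr_ge0// ltW.
have [nu nuE] := weighted_measure L'0.
have nu1 : nu setT = 1%E.
  have := nuE (cst 1%E); rewrite integral_cst//= mul1e => ->//.
  rewrite big_cons big_map; under eq_bigr do rewrite integral_cst//= muM mul1e -EFinM.
  rewrite integral_cst//= muM mul1e -EFinM sumEFin -EFinD; congr EFin.
  rewrite /w0 -mulr_suml -mulr_suml mulrBl mulVf ?gt_eqF//.
  by rewrite subrK.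
have [rho rhoE] := probability_of_measure nu1.
exists rho => x.
have [E [EE E0 Eb]] := bern_meanE x L0.
rewrite /bern_mean Eb/= /mix1.
have -> : (\int[rho]_v (expR (- dotp x v ^+ 2 / 2))%:E =
    (w0 * M + \sum_(q <- L) q.1 / N.+1%:R * E q)%:E)%E.
  rewrite rhoE nuE; last 2 first.
  - apply/measurable_EFinP; apply: measurableT_comp => //; apply: measurable_funM => //.
    apply: measurableT_comp => //; apply: measurable_funX; exact: (measurable_dotp x).
  - by move=> u; rewrite lee_fin expR_ge0.
  have sc (q : R * R) : 0 <= q.2 -> (\int[mu]_u (expR (- dotp x
      (scale_borel (Num.sqrt (2 * q.2)) u : 'rV[R]_m) ^+ 2 / 2))%:E =
      \int[mu]_u (expR (- (q.2 * dotp x u ^+ 2)))%:E)%E.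
    move=> q2; apply: eq_integral => u _; congr (expR _)%:E.
    rewrite /scale_borel dotpZr exprMn sqr_sqrtr ?mulr_ge0//.
    by field.
  rewrite /L' big_cons (sc (w0, 0) (lexx 0)) big_map (EFinD (w0 * M)).
  congr (_ + _)%E; last first.
    rewrite -sumEFin big_seq [RHS]big_seq; apply: eq_bigr => q qL.
    have [_ q2] := L0 q qL.
    by rewrite (sc (q.1 / N.+1%:R, q.2) q2) (EE q qL) -EFinM.
  under eq_integral do rewrite mul0r oppr0 expR0.
  by rewrite integral_cst//; rewrite [X in (_ * (_ * X))%E]muM mul1e EFinM.
rewrite /= /w0 mulrBl mulVf ?gt_eqF// -addrA; congr (_ + _).
rewrite -mulrA !mulr_suml -sumrN -big_split/= -sumrN; apply: eq_bigr => q _.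
by field; rewrite gt_eqF.
Qed.

Context {n : nat}.
Notation B := (borel_mx R n m).
Variables (theta phi : 'rV[R]_n) (st sp : probability B R).
Hypothesis t1 : enorm theta = 1.
Hypothesis p1 : enorm phi = 1.
Hypothesis rt : rotation_invariant_on_usphere (block_hyperplane theta) st.
Hypothesis rp : rotation_invariant_on_usphere (block_hyperplane phi) sp.
Hypothesis ne : usphere (block_hyperplane phi : set 'M[R]_(n, m)) !=set0.
Hypothesis maj : majorized (\row_i theta 0 i ^+ 2) (\row_i phi 0 i ^+ 2).

Lemma gmean_bern_le L : nneg_pairs L ->
  coord_measurable (fun x => expR (- bern_mean (bern L) x)) /\
  (gmean st (fun x => expR (- bern_mean (bern L) x)) <=
   gmean sp (fun x => expR (- bern_mean (bern L) x)))%E.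
Proof.
(* [K.+1] bounds the total weight times the mass, hence every power k + K + 2 is large enough for
   the mixtures to exist. *)
move=> L0; pose K := Num.truncn ((\sum_(q <- L) q.1) * M).
have LK : (\sum_(q <- L) q.1) * M <= K.+1%:R by rewrite ltW// truncnS_gt.
have /choice[rho hrho] : forall k, exists rho : probability B1 R, forall x,
    mix1 rho x = 1 - bern_mean (bern L) x / (k + K.+1).+1%:R.
  move=> k; apply: mix1_bern => //; apply: (le_trans LK).
  by rewrite ler_nat leq_addl.
pose f k := mix (k + K.+1).+1 (rho k).
have mf k : coord_measurable (f k) by move=> d T X mX; exact: measurable_mix.
have fc x : f ^~ x @ \oo --> expR (- bern_mean (bern L) x).
  rewrite /f /mix; under eq_cvg do rewrite hrho.
  apply: cvg_pow_expR; first exact: bern_mean_ge0.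
  by apply: le_trans LK; exact: bern_mean_le.
split; first exact: coord_measurable_cvg mf fc.
apply: (gmean_cvg_le mf _ fc) => k.
  move=> x; rewrite exprn_ge0 ?mix1_ge0//= exprn_ile1 ?mix1_ge0// mix1_le1//.
exact: (integral_mix_le (k + K.+1).+1 (rho k) t1 p1 rt rp ne maj).
Qed.

Lemma gmean_powR_le (a lam : R) : 0 < a <= 1 -> 0 <= lam ->
  (forall x, mu.-integrable setT (fun u : B1 => ((dotp x u ^+ 2) `^ a)%R%:E)) ->
  coord_measurable (fun x => expR (- (lam * bern_mean (fun s : R => powR s a) x))) /\
  (gmean st (fun x => expR (- (lam * bern_mean (fun s : R => powR s a) x))) <=
   gmean sp (fun x => expR (- (lam * bern_mean (fun s : R => powR s a) x))))%E.
Proof.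
move=> a01 lam0 ia.
(* The approximants converge only on s >= 0, so measurability is asked of psi(|s|), which agrees
   with psi at the squares <x, u>^2. *)
pose P (psi : R -> R) :=
  (measurable_fun setT (fun s : R => psi `|s|) /\ forall s, 0 <= s -> 0 <= psi s <= 2 * s `^ a) /\
  (coord_measurable (fun x => expR (- (lam * bern_mean psi x))) /\
  (gmean st (fun x => expR (- (lam * bern_mean psi x))) <=
   gmean sp (fun x => expR (- (lam * bern_mean psi x))))%E).
suff [] : P (fun s : R => powR s a) by [].
have md x : measurable_fun [set: B1] (fun u : B1 => dotp x u ^+ 2).
  by apply: measurable_funX; exact: (measurable_dotp x).
have mpsi (psi : R -> R) x : measurable_fun setT (fun s : R => psi `|s|) ->
    measurable_fun [set: B1] (fun u : B1 => psi (dotp x u ^+ 2)).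
  move=> h; have := measurableT_comp h (md x).
  rewrite (_ : _ \o _ = fun u : B1 => psi (dotp x u ^+ 2))//.
  by apply/funext => u /=; rewrite ger0_norm// sqr_ge0.
apply: powR_bern_ind => // [L L0 L2|f_ f Pf f2 fc].
  split; first split.
  - by apply: (measurableT_comp (measurable_bern L)); exact: normr_measurable.
  - by move=> s s0; rewrite bern_ge0//= L2.
  pose L' := [seq (lam * q.1, q.2) | q <- L].
  have L'0 : nneg_pairs L'.
    by move=> _ /mapP[q /L0[q1 q2] ->] /=; rewrite mulr_ge0.
  have E x : bern_mean (bern L') x = lam * bern_mean (bern L) x.
    have bE s : bern L' s = lam * bern L s.
      by rewrite /bern big_map mulr_sumr; apply: eq_bigr => q _; rewrite /= mulrA.
    rewrite /bern_mean; under eq_integral do rewrite bE EFinM.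
    rewrite ge0_integralZl//; last 2 first.
    - by apply/measurable_EFinP; exact: (measurableT_comp (measurable_bern L)).
    - by move=> u _; rewrite lee_fin bern_ge0// sqr_ge0.
    have [E' [_ _ ->]] := bern_meanE x L0; by [].
  have := gmean_bern_le L'0.
  rewrite (_ : (fun x => expR (- bern_mean (bern L') x)) =
    fun x => expR (- (lam * bern_mean (bern L) x)))//.
  by apply/funext => x; rewrite E.
have bc x : (fun k => bern_mean (f_ k) x) @ \oo --> bern_mean f x.
  have [|||||] := @dominated_convergence _ _ _ mu setT measurableT
    (fun k u => (f_ k (dotp x u ^+ 2))%:E) (fun u => (f (dotp x u ^+ 2))%:E)
    (fun u => (2 * (dotp x u ^+ 2) `^ a)%:E).
  - by move=> k; apply/measurable_EFinP; apply: mpsi; case: (Pf k) => [[]].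
  - apply/measurable_EFinP.
    apply: (@measurable_fun_cvg _ _ _ _ (fun k (u : B1) => f_ k (dotp x u ^+ 2))).
      by move=> k; apply: mpsi; case: (Pf k) => [[]].
    by move=> u _; apply: fc; exact: sqr_ge0.
  - by apply: aeW => u _; apply: cvg_EFin; [exact: nearW|apply: fc; exact: sqr_ge0].
  - by under eq_fun do rewrite EFinM; apply: integrableZl => //; exact: ia.
  - apply: aeW => u k _; have /andP[h1 h2] := f2 k _ (sqr_ge0 (dotp x u)).
    by rewrite lee_fin ger0_norm.
  move=> fi _ c.
  have ffin : (\int[mu]_u (f (dotp x u ^+ 2))%:E)%E \is a fin_num.
    exact: integrable_fin_num fi.
  rewrite -(fineK ffin) in c.
  exact: (fine_cvg c).
have P1 : measurable_fun setT (fun s : R => f `|s|).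
  apply: (@measurable_fun_cvg _ _ _ _ (fun k (s : R) => f_ k `|s|)).
    by move=> k; case: (Pf k) => [[]].
  by move=> s _; apply: fc.
have f0 s : 0 <= s -> 0 <= f s <= 2 * s `^ a.
  move=> s0; apply/andP; split.
    apply: (ler_cvg_to (cvg_cst 0) (fc s s0)).
    by apply: nearW => k; have /andP[] := f2 k s s0.
  apply: (ler_cvg_to (fc s s0) (cvg_cst _)).
  by apply: nearW => k; have /andP[] := f2 k s s0.
have ec x : (fun k => expR (- (lam * bern_mean (f_ k) x))) @ \oo -->
    expR (- (lam * bern_mean f x)).
  apply: continuous_cvg; first exact: continuous_expR.
  by apply: cvgN; apply: cvgM; [exact: cvg_cst|exact: bc].
have mk k : coord_measurable (fun x => expR (- (lam * bern_mean (f_ k) x))).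
  by case: (Pf k) => [_ []].
split => //; split.
  exact: (coord_measurable_cvg (f_ := fun k x => expR (- (lam * bern_mean (f_ k) x)))).
apply: (gmean_cvg_le (f_ := fun k x => expR (- (lam * bern_mean (f_ k) x)))) => //.
  move=> k x; rewrite expR_ge0/= expR_le1 oppr_le0 mulr_ge0//.
  apply: fine_ge0; apply: integral_ge0 => u _; rewrite lee_fin.
  by have /andP[] := f2 k _ (sqr_ge0 (dotp x u)).
by move=> k; case: (Pf k) => [_ []].
Qed.

End mixture_measure.

(** * From Laplace transforms to roots of homogeneous sums *)

Section homogeneous_functionals.
Context {R : realType} {m n : nat}.
Notation B := (borel_mx R n m).
Variables (theta phi : 'rV[R]_n) (st sp : probability B R).
Hypothesis rt : rotation_invariant_on_usphere (block_hyperplane theta) st.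
Hypothesis rp : rotation_invariant_on_usphere (block_hyperplane phi) sp.
Variables (T : 'rV[R]_m -> R) (a b C : R).
Hypothesis b01 : 0 < b <= 1.
Hypothesis ab : a * b = 2^-1.
Hypothesis T0 : forall x, 0 <= T x.
Hypothesis TZ : forall g x, T (g *: x) = (g ^+ 2) `^ a * T x.
Hypothesis TC : forall x, dotp x x <= 1 -> T x <= C.
Hypothesis mT : coord_measurable T.
Hypothesis gmean_le : forall lam, 0 <= lam ->
  (gmean st (fun x => expR (- (lam * T x))) <= gmean sp (fun x => expR (- (lam * T x))))%E.

Let S (y : B) : R := \sum_(i < n) T (row i (y : 'M[R]_(n, m))).
(* [S] agrees with its truncation on the unit sphere; the latter is bounded. *)
Let S' (y : B) : R := Num.min (S y) (n%:R * C).
Let h (u : B * measurableTypeR R) : R := (u.2 ^+ 2) `^ a * S' u.1.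

Let C0 : 0 <= C.
Proof. by apply: le_trans (TC (x := 0) _); rewrite ?dotp0l. Qed.

Let S0 y : 0 <= S y. Proof. exact: sumr_ge0. Qed.

Let S'0 y : 0 <= S' y. Proof. by rewrite /S' le_min S0 mulr_ge0. Qed.

Let h0 u : 0 <= h u. Proof. by rewrite /h mulr_ge0// powR_ge0. Qed.

Let S'E (y : B) : enorm (y : 'M[R]_(n, m)) = 1 -> S' y = S y.
Proof.
move=> /enorm1P y1; apply/min_idPl.
have -> : n%:R * C = \sum_(i < n) C by rewrite sumr_const card_ord mulr_natl.
apply: ler_sum => i _; apply: TC; rewrite -y1 [leRHS]dotp_sum_row (bigD1 i)//= lerDl.
by apply: sumr_ge0 => j _; exact: dotp_ge0.
Qed.

Let mS : measurable_fun setT S.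
Proof.
apply: measurable_sum => i; apply: mT => k j.
under eq_fun do rewrite mxE; exact: measurable_coord.
Qed.

Let mS' : measurable_fun setT S'.
Proof. by apply: measurable_minr. Qed.

Let mh : measurable_fun setT h.
Proof.
apply: measurable_funM; last first.
  by apply: (measurableT_comp mS'); exact: measurable_fst.
apply: (measurableT_comp (measurable_powR a)).
by apply: measurable_funX; exact: measurable_snd.
Qed.

Let integral_exp (sigma : probability B R) (xi : 'rV[R]_n) (lam : R) : 0 <= lam ->
  rotation_invariant_on_usphere (block_hyperplane xi) sigma ->
  (\int[sigma \x @gauss R]_u (expR (- (lam * h u)))%:E =
   gmean sigma (fun x => expR (- (lam * T x))))%E.
Proof.
move=> lam0 rs.
have me : measurable_fun setT (fun u => expR (- (lam * h u))).
  apply: (measurableT_comp (@measurable_expR R)); apply: (measurableT_comp (@oppr_measurable R _)).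
  by apply: (measurable_funM (measurable_cst lam)); exact: mh.
have mf : coord_measurable (fun x => expR (- (lam * T x))).
  move=> d U X mX.
  apply: measurableT_comp => //; apply: measurableT_comp => //; apply: measurable_funM => //.
  exact: mT.
rewrite (@fubini_tonelli1 _ _ _ _ _ _ _ (fun u => (expR (- (lam * h u)))%:E)).
apply: (integral_usphere rs).
- apply: measurable_fun_fubini_tonelli_F => //.
  exact/measurable_EFinP.
- have := @measurable_fun_fubini_tonelli_F _ _ _ _ _ (@gauss R)
    (fun u : B * measurableTypeR R => (\prod_(i < n) expR (- (lam *
      T (u.2 *: row i (u.1 : 'M[R]_(n, m))))))%:E); apply.
    by apply/measurable_EFinP; exact: (measurable_gmean_integrand mf).
  by move=> u; rewrite lee_fin prodr_ge0// => i _; exact: expR_ge0.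
- by move=> y; apply: integral_ge0 => g _; rewrite lee_fin expR_ge0.
- move=> y; apply: integral_ge0 => g _.
  by rewrite lee_fin prodr_ge0// => i _; exact: expR_ge0.
- move=> y [_ y1]; apply: eq_integral => g _.
  rewrite -expR_sum sumrN -mulr_sumr /h/= S'E//; congr (expR (- (_ * _)))%:E.
  by rewrite /S mulr_sumr; apply: eq_bigr => i _; rewrite TZ.
- exact/measurable_EFinP.
- by move=> u; rewrite lee_fin expR_ge0.
Qed.

Let integral_h (sigma : probability B R) (xi : 'rV[R]_n) :
  rotation_invariant_on_usphere (block_hyperplane xi) sigma ->
  (\int[sigma \x @gauss R]_u ((h u) `^ b)%R%:E =
   \int[@gauss R]_g `|g|%:E * \int[sigma]_y ((S y) `^ b)%R%:E)%E.
Proof.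
move=> rs.
have mhb : measurable_fun setT (fun u => (h u) `^ b).
  by apply: (measurableT_comp (measurable_powR b)).
have mSb : measurable_fun setT (fun y => ((S y) `^ b)%R%:E).
  by apply/measurable_EFinP; apply: (measurableT_comp (measurable_powR b)).
have mSb' : measurable_fun setT (fun y => ((S' y) `^ b)%R%:E).
  by apply/measurable_EFinP; apply: (measurableT_comp (measurable_powR b)).
rewrite fubini_tonelli1//; last 2 first.
- by apply/measurable_EFinP.
- by move=> u; rewrite lee_fin powR_ge0.
have -> : (\int[sigma]_y ((S y) `^ b)%R%:E = \int[sigma]_y ((S' y) `^ b)%R%:E)%E.
  apply: (integral_usphere rs) => //.
  - by move=> y; rewrite lee_fin powR_ge0.
  - by move=> y; rewrite lee_fin powR_ge0.
  - by move=> y [_ y1]; rewrite S'E.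
have mn : measurable_fun setT (fun g : measurableTypeR R => `|g|%:E).
  by apply/measurable_EFinP; exact: normr_measurable.
rewrite -ge0_integralZl//; last 2 first.
- by move=> y _; rewrite lee_fin powR_ge0.
- exact: integral_ge0.
apply: eq_integral => y _.
rewrite muleC -ge0_integralZl//; last by rewrite lee_fin powR_ge0.
apply: eq_integral => g _; rewrite -EFinM /h/=; congr EFin.
rewrite powRM ?powR_ge0// -powRrM ab powR12_sqrt ?sqr_ge0// sqrtr_sqr.
by rewrite mulrC.
Qed.

(** As a b = 1/2, the power h^b equals |g| times the b-th root of the sum on the sphere. Both sides
    thus acquire the factor E|g|, positive and finite, and the comparison reduces to Laplace
    transforms of [h], which are the means in [gmean_le]. *)
Lemma integral_root_sum_le :
  (\int[sp]_y ((\sum_(i < n) T (row i (y : 'M[R]_(n, m)))) `^ b)%R%:E <=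
   \int[st]_y ((\sum_(i < n) T (row i (y : 'M[R]_(n, m)))) `^ b)%R%:E)%E.
Proof.
have [b0 b1] := andP b01.
suff : (\int[sp \x @gauss R]_u ((h u) `^ b)%R%:E <= \int[st \x @gauss R]_u ((h u) `^ b)%R%:E)%E.
  rewrite (integral_h rp) (integral_h rt).
  have gf : (\int[@gauss R]_g `|g|%:E)%E \is a fin_num.
    by rewrite ge0_fin_numE ?gauss_norm_fin// ltW// gauss_norm_gt0.
  by rewrite lee_pmul2l// gauss_norm_gt0.
pose P (psi : R -> R) := measurable_fun setT (fun s : R => psi `|s|) /\
  (\int[sp \x @gauss R]_u (psi (h u))%:E <= \int[st \x @gauss R]_u (psi (h u))%:E)%E.
have mpsi (psi : R -> R) : measurable_fun setT (fun s : R => psi `|s|) ->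
    measurable_fun setT (fun u => psi (h u)).
  move=> mf; have := measurableT_comp mf mh.
  rewrite (_ : _ \o _ = fun u => psi (h u))//.
  by apply/funext => u /=; rewrite ger0_norm.
suff [] : P (fun s => s `^ b) by [].
apply: powR_bern_ind => // [L L0 _|f_ f Pf f2 fc].
  split; first by apply: (measurableT_comp (measurable_bern L)); exact: normr_measurable.
  have pr (s : probability B R) : (s \x @gauss R)%E setT = 1%:E.
    exact: (@probability_setT _ _ _ ((s \x @gauss R)%E : probability (B * measurableTypeR R)%type R)).
  have [Ep [EpE _ ->]] := integral_bern (pr sp) mh h0 L0.
  have [Et [EtE _ ->]] := integral_bern (pr st) mh h0 L0.
  rewrite lee_fin big_seq [leRHS]big_seq; apply: ler_sum => q qL.
  have [q1 q2] := L0 q qL.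
  (* The minus sign in 1 - E reverses the inequality between the Laplace transforms. *)
  rewrite ler_wpM2l// lerD2l lerN2 -lee_fin -EpE// -EtE//.
  rewrite (integral_exp q2 rp) (integral_exp q2 rt).
  exact: gmean_le.
have mf : measurable_fun setT (fun s : R => f `|s|).
  apply: (@measurable_fun_cvg _ _ _ _ (fun k (s : R) => f_ k `|s|)).
    by move=> k; case: (Pf k).
  by move=> s _; apply: fc.
split => //.
(* The approximants are at most 2 h^b, and the truncated sum is at most n C; what remains is a
   multiple of |g|, integrable because E|g| is finite. *)
pose G (u : B * measurableTypeR R) : R := 2 * (n%:R * C) `^ b * `|u.2|.
have iG (s : probability B R) : (s \x @gauss R)%E.-integrable setT (EFin \o G).
  apply/integrableP; split.
    apply/measurable_EFinP; apply: measurable_funM => //.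
    by apply: measurableT_comp; [exact: normr_measurable|exact: measurable_snd].
  under eq_integral do rewrite /= ger0_norm ?mulr_ge0 ?powR_ge0//.
  have mn : measurable_fun setT (fun g : measurableTypeR R => `|g|%:E).
    by apply/measurable_EFinP; exact: normr_measurable.
  rewrite fubini_tonelli1//=; last 2 first.
  - apply/measurable_EFinP; apply: measurable_funM => //.
    by apply: measurableT_comp; [exact: normr_measurable|exact: measurable_snd].
  - by move=> u; rewrite lee_fin !mulr_ge0 ?powR_ge0.
  rewrite /fubini_F/G/=; under eq_integral => y _.
    under eq_integral do rewrite EFinM.
    rewrite ge0_integralZl//; last by rewrite lee_fin !mulr_ge0 ?powR_ge0.
    over.
  rewrite integral_cst//= probability_setT mule1.
  by rewrite lte_mul_pinfty ?gauss_norm_fin// lee_fin !mulr_ge0 ?powR_ge0.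
have bG k u : `|f_ k (h u)| <= G u.
  have /andP[h1 h2] := f2 k _ (h0 u).
  rewrite ger0_norm//; apply: (le_trans h2); rewrite /G -mulrA ler_wpM2l//.
  rewrite /h powRM ?powR_ge0// -powRrM ab powR12_sqrt ?sqr_ge0// sqrtr_sqr.
  rewrite mulrC ler_wpM2r// ge0_ler_powR ?nnegrE ?(ltW b0) ?mulr_ge0//.
  by rewrite /S' ge_min lexx orbT.
apply: (le_integral_cvg (F1 := fun k u => f_ k (h u)) (F2 := fun k u => f_ k (h u))
  _ _ _ _ (iG sp) (iG st) bG bG).
- by move=> k; apply: mpsi; case: (Pf k).
- by move=> k; apply: mpsi; case: (Pf k).
- by move=> u; exact: fc.
- by move=> u; exact: fc.
- by move=> k; case: (Pf k).
Qed.

End homogeneous_functionals.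

(** * Lewis' position and duality *)

Section real_powers.
Context {R : realType}.
Implicit Types s t p A : R.

Lemma sqr_powR t p : (t ^+ 2) `^ (p / 2) = `|t| `^ p.
Proof.
by rewrite mulrC powRrM powR12_sqrt ?sqr_ge0// sqrtr_sqr.
Qed.

Lemma powR_le1 s p : 0 <= p -> 0 <= s -> s <= 1 -> s `^ p <= 1.
Proof.
move=> p0 s0 s1; have <- : 1 `^ p = 1 :> R by rewrite powR1.
by rewrite ge0_ler_powR ?nnegrE.
Qed.

(** Young's inequality with exponents p / (p - 1) and p. The first one degenerates at p = 1, where
    both sides equal t. *)
Lemma young_powR s t p : 1 <= p -> 0 <= s -> 0 <= t ->
  s `^ (p - 1) * t <= (1 - p^-1) * s `^ p + p^-1 * t `^ p.
Proof.
rewrite le_eqVlt => /predU1P[<-|p1] s0 t0.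
  by rewrite subrr powRr0 invr1 subrr !mul1r !powRr1// mul0r add0r.
have p0 : 0 < p by rewrite (lt_trans _ p1).
have q0 : 0 < p / (p - 1) by rewrite divr_gt0// subr_gt0.
have pq : (p / (p - 1))^-1 + p^-1 = 1.
  by field; rewrite !gt_eqF// subr_gt0.
have := conjugate_powR (powR_ge0 s (p - 1)) t0 q0 p0 pq.
rewrite -powRrM mulrCA divff ?mulr1; last by rewrite gt_eqF// subr_gt0.
have -> : 1 - p^-1 = (p / (p - 1))^-1 by apply/eqP; rewrite subr_eq pq.
by rewrite ![_^-1 * _]mulrC.
Qed.

(* The derivative of [`|t| `^ p / p]; the junk value [0 `^ _] at [t = 0] is
   harmless because of the factor [t]. *)
Definition powR_sg p t := t * (t ^+ 2) `^ (p / 2 - 1).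

Lemma powR_sg0 p : powR_sg p 0 = 0. Proof. exact: mul0r. Qed.

Lemma powR_sgM p t : 1 <= p -> powR_sg p t * t = `|t| `^ p.
Proof.
move=> p1; rewrite -sqr_powR /powR_sg; have [->|t0] := eqVneq t 0.
  rewrite expr0n/= mul0r mul0r powR0// mulf_neq0// ?invr_eq0// gt_eqF//.
  by rewrite (lt_le_trans _ p1).
rewrite mulrAC -expr2 -{1}(@powRr1 _ (t ^+ 2)) ?sqr_ge0// -powRD; last first.
  by rewrite sqrf_eq0 t0 implybT.
by rewrite addrC subrK.
Qed.

(** An equality except at t = 0 with p = 1, where the right side is 0 to the power 0, that is 1. *)
Lemma normr_powR_sg p t : 1 <= p -> `|powR_sg p t| <= `|t| `^ (p - 1).
Proof.
move=> p1; have [->|t0] := eqVneq t 0; first by rewrite powR_sg0 normr0 powR_ge0.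
have nt : `|t| != 0 by rewrite normr_eq0.
rewrite -(ler_pM2r (_ : 0 < `|t|)) ?normr_gt0// -normrM powR_sgM//.
rewrite ger0_norm ?powR_ge0// -[X in _ * X](powRr1 (normr_ge0 _)) -powRD.
  by rewrite subrK.
by rewrite nt implybT.
Qed.

Lemma measurable_powR_sg p : measurable_fun setT (powR_sg p).
Proof.
apply: measurable_funM => //; apply: (measurableT_comp (measurable_powR _)).
exact: measurable_funX.
Qed.

End real_powers.

Section conull.
Context d (T : measurableType d) (R : realType) (mu : {measure set T -> \bar R}).
Variable S : set T.
Hypothesis mS : measurable S.
Hypothesis nS : mu (~` S) = 0%E.

Lemma integral_conull (f : T -> \bar R) : measurable_fun setT f ->
  (forall x, (0 <= f x)%E) -> (\int[mu]_x f x = \int[mu]_(x in S) f x)%E.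
Proof.
move=> mf f0; rewrite (ge0_negligible_integral _ _ _ _ nS)//; first by rewrite setTD setCK.
exact: measurableC.
Qed.

Lemma measure_conull : mu setT = mu S.
Proof.
have := integral_conull (measurable_cst 1%E) (fun=> lee01).
by rewrite !integral_cst// !mul1e.
Qed.

End conull.

Section lewis_position.
Context {R : realType} {m : nat} (mu : {measure set (borel_mx R 1 m) -> \bar R}).
Hypothesis hmu : isotropic mu.
Notation B1 := (borel_mx R 1 m).
Notation V := 'rV[R]_m.
Let S : set B1 := usphere (setT : set V).

Lemma measurable_unit_sphere : measurable S.
Proof.
have -> : S = usphere (block_hyperplane (0 : 'rV[R]_1)).
  apply/seteqP; split => x [_ x1]; split => //.
  by apply/block_hyperplaneE; rewrite mul0mx.
exact: measurable_usphere.
Qed.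

Let mS := measurable_unit_sphere.
Let nS : mu (~` S) = 0%E := hmu.1.

Let md (x : V) : measurable_fun [set: B1] (fun u : B1 => dotp x u).
Proof. exact: measurable_dotp. Qed.

Let md2 (x : V) : measurable_fun [set: B1] (fun u : B1 => dotp x u ^+ 2).
Proof. exact: measurable_funX. Qed.

Let dle (x : V) (u : B1) : S u -> `|dotp x u| <= enorm x.
Proof. by move=> [_ u1]; rewrite -[leRHS]mulr1 -u1 dotp_norm_le. Qed.

Lemma isotropicE (x : V) : (\int[mu]_u (dotp x u ^+ 2)%:E = (dotp x x)%:E)%E.
Proof.
have := congr1 (fun e => e `^ 2)%E (hmu.2 x).
rewrite poweR_Lnorm//= => h.
rewrite -enorm_sqr -powR_mulrn ?enorm_ge0// h.
by apply: eq_integral => u _; rewrite powR_mulrn// real_normK// num_real.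
Qed.

(** The trace of the isotropy identity: the integrals of <e_j, u>^2 over the standard basis add up
    to that of |u|^2 = 1. *)
Lemma isotropic_mass : mu setT = m%:R%:E.
Proof.
rewrite (measure_conull mS nS).
have -> : (mu S = \int[mu]_(u in S) (dotp (u : V) u)%:E)%E.
  rewrite -[LHS]mul1e -integral_cst//; apply: eq_integral => u.
  by rewrite inE => -[_ /enorm1P ->].
have E (u : V) : dotp u u = \sum_(j < m) dotp (delta_mx 0 j) u ^+ 2.
  rewrite /dotp big_ord1; apply: eq_bigr => j _; rewrite big_ord1.
  rewrite (bigD1 j)//= mxE !eqxx mul1r big1 ?addr0 ?expr2// => k kj.
  by rewrite mxE (negbTE kj) andbF mul0r.
under eq_integral do rewrite E -sumEFin.
rewrite ge0_integral_sum//; last 2 first.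
- by move=> j; apply/measurable_EFinP; exact: measurable_funTS.
- by move=> j u _; rewrite lee_fin sqr_ge0.
under eq_bigr => j _.
  rewrite -(integral_conull mS nS) ?isotropicE; last 2 first.
  - by apply/measurable_EFinP.
  - by move=> u; rewrite lee_fin sqr_ge0.
  rewrite E (bigD1 j)//= big1 => [|k kj]; last first.
    rewrite /dotp big_ord1 big1 ?expr0n// => l _; rewrite !mxE eqxx/=.
    by case: eqP => [->|]; rewrite ?mul0r// (negbTE kj) mulr0.
  rewrite addr0.
  have -> : dotp (delta_mx 0 j) (delta_mx 0 j : V) = 1.
    rewrite /dotp big_ord1 (bigD1 j)//= mxE !eqxx mul1r big1 ?addr0// => k kj.
    by rewrite mxE (negbTE kj) andbF mul0r.
  rewrite expr1n.
  over.
by rewrite sumEFin sumr_const card_ord.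
Qed.

Lemma integrable_sphere (f : B1 -> R) (C : R) : measurable_fun setT f ->
  (forall u, S u -> `|f u| <= C) -> mu.-integrable S (EFin \o f).
Proof.
move=> mf fC; apply: measurable_bounded_integrable => //.
- by rewrite -(measure_conull mS nS) isotropic_mass ltry.
- exact: measurable_funTS.
- exists C; split; first exact: num_real.
  by move=> y Cy u Su /=; exact: le_trans (fC u Su) (ltW Cy).
Qed.

Variable p : R.
Hypothesis p12 : 1 <= p <= 2.

Let p1 : 1 <= p. Proof. by case/andP: p12. Qed.
Let p0 : 0 < p. Proof. exact: lt_le_trans p1. Qed.

Definition Xpow (x : V) : R := \int[mu]_(u in S) (`|dotp x u| `^ p).

Let mpow (x : V) : measurable_fun setT (fun u : B1 => `|dotp x u| `^ p).
Proof.
apply: (measurableT_comp (measurable_powR p)).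
by apply: measurableT_comp => //; exact: normr_measurable.
Qed.

Let ipow (x : V) : mu.-integrable S (fun u : B1 => (`|dotp x u| `^ p)%:E).
Proof.
apply: (@integrable_sphere _ (enorm x `^ p)) => // u Su.
rewrite ger0_norm ?powR_ge0// ge0_ler_powR ?nnegrE ?enorm_ge0//; first exact: ltW.
exact: dle.
Qed.

Lemma integral_Xpow (x : V) : (\int[mu]_u (`|dotp x u| `^ p)%:E = (Xpow x)%:E)%E.
Proof.
rewrite (integral_conull mS nS) /Xpow /Rintegral ?fineK//.
- exact: integrable_fin_num (ipow x).
- exact/measurable_EFinP.
Qed.

Lemma bern_mean_Xpow (x : V) : bern_mean mu (fun s : R => powR s (p / 2)) x = Xpow x.
Proof.
rewrite /bern_mean; under eq_integral do rewrite sqr_powR.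
by rewrite integral_Xpow.
Qed.

Lemma XnormE (x : V) : Xnorm mu p x = Xpow x `^ p^-1.
Proof. by rewrite /Xnorm unlock/= integral_Xpow. Qed.

Lemma Xpow_ge0 x : 0 <= Xpow x.
Proof. by apply: Rintegral_ge0 => u _; exact: powR_ge0. Qed.

Lemma XnormX x : Xnorm mu p x `^ p = Xpow x.
Proof. by rewrite XnormE -powRrM mulVf ?gt_eqF// powRr1// Xpow_ge0. Qed.

Lemma Xnorm_ge0 x : 0 <= Xnorm mu p x.
Proof. by rewrite XnormE powR_ge0. Qed.

Lemma XpowZ g x : Xpow (g *: x) = (g ^+ 2) `^ (p / 2) * Xpow x.
Proof.
rewrite /Xpow -RintegralZl//; last exact: ipow.
by apply: eq_Rintegral => u _; rewrite sqr_powR dotpZl normrM powRM.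
Qed.

Lemma XnormZ g x : 0 <= g -> Xnorm mu p (g *: x) = g * Xnorm mu p x.
Proof.
move=> g0; rewrite !XnormE XpowZ sqr_powR ger0_norm// powRM ?powR_ge0 ?Xpow_ge0//.
by rewrite -powRrM divff ?gt_eqF// powRr1.
Qed.

Lemma Xpow_le x : dotp x x <= 1 -> Xpow x <= m%:R.
Proof.
move=> x1; have -> : m%:R = \int[mu]_(u in S) (1 : R).
  by rewrite Rintegral_cst// mul1r -(measure_conull mS nS) isotropic_mass.
apply: le_Rintegral => //; first exact: ipow.
  by apply: (@integrable_sphere _ 1) => // u _; rewrite normr1.
move=> u Su; apply: powR_le1 => //; first exact: ltW.
apply: le_trans (dle x Su) _.
by rewrite -(@ler_pXn2r _ 2) ?nnegrE ?enorm_ge0// enorm_sqr expr1n.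
Qed.

(* On the sphere [|<x, u>| <= |x|], so [<x, u> ^ 2 <= |<x, u>| ^ p |x| ^ (2 - p)]. *)
Lemma enorm_le_Xnorm x : enorm x <= Xnorm mu p x.
Proof.
have [->|x0] := eqVneq x 0; first by rewrite /enorm dotp0l sqrtr0 Xnorm_ge0.
have e0 : 0 < enorm x.
  by rewrite lt0r enorm_ge0 andbT; apply: contra_neq x0; exact: enorm_eq0.
have le : enorm x ^+ 2 <= Xpow x * enorm x `^ (2 - p).
  have i2 : mu.-integrable S (fun u : B1 => (dotp x u ^+ 2)%:E).
    apply: (@integrable_sphere _ (enorm x ^+ 2)) => // u Su.
    by rewrite ger0_norm ?sqr_ge0// -real_normK ?num_real// lerXn2r ?nnegrE ?enorm_ge0// dle.
  rewrite enorm_sqr.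
  have -> : dotp x x = \int[mu]_(u in S) (dotp x u ^+ 2).
    rewrite /Rintegral -(integral_conull mS nS) ?isotropicE//.
      exact/measurable_EFinP.
    by move=> u; rewrite lee_fin sqr_ge0.
  rewrite /Xpow -RintegralZr//; last exact: ipow.
  apply: le_Rintegral => //.
    have := integrableZl mS (enorm x `^ (2 - p)) (ipow x).
    by apply: eq_integrable => // u _; rewrite /= mulrC EFinM.
  move=> u Su; rewrite -real_normK ?num_real// -powR_mulrn//.
  have [->|d0] := eqVneq `|dotp x u| 0.
    by rewrite powR0// mulr_ge0// powR_ge0.
  have {1}-> : 2%:R = p + (2 - p) :> R by rewrite addrC subrK.
  rewrite powRD ?d0 ?implybT// ler_wpM2l ?powR_ge0// ge0_ler_powR ?nnegrE ?enorm_ge0//.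
    by rewrite subr_ge0; case/andP: p12.
  exact: dle.
have {le} : enorm x `^ p <= Xpow x.
  have P0 : 0 < enorm x `^ (2 - p) by rewrite powR_gt0.
  rewrite -(ler_pM2r P0) -powRD ?(gt_eqF e0) ?implybT//.
  by rewrite addrC subrK powR_mulrn// enorm_ge0.
move=> h; rewrite XnormE -[leLHS](@powRr1 _ (enorm x)) ?enorm_ge0//.
rewrite -[in leLHS](divff (lt0r_neq0 p0)) powRrM.
by rewrite ge0_ler_powR ?nnegrE ?powR_ge0 ?Xpow_ge0// invr_ge0 ltW.
Qed.

Lemma Xnorm_eq0 x : Xnorm mu p x = 0 -> x = 0.
Proof.
move=> h; apply: enorm_eq0; apply/eqP; rewrite eq_le enorm_ge0 andbT.
by rewrite -h enorm_le_Xnorm.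
Qed.

Lemma Xnorm0 : Xnorm mu p 0 = 0.
Proof. by rewrite -(scale0r 0) XnormZ// mul0r. Qed.

Notation D := (dual_norm (Xnorm mu p)).

(** Domination of the Euclidean norm makes the [sup] in [dual_norm] a true supremum and not its
    default value. *)
Lemma dual_set_bounded (y : V) : has_ubound [set dotp x y | x in [set x : V | Xnorm mu p x <= 1]].
Proof.
exists (enorm y) => _ [x /= x1 <-].
apply: le_trans (ler_norm _) _; apply: le_trans (dotp_norm_le _ _) _.
rewrite -[leRHS]mul1r ler_wpM2r ?enorm_ge0//.
by apply: le_trans x1; exact: enorm_le_Xnorm.
Qed.

Lemma dual_norm_ge0 (y : V) : 0 <= D y.
Proof.
apply: ub_le_sup (dual_set_bounded y) _ _.
by exists 0; rewrite /= ?Xnorm0 ?dotp0l.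
Qed.

Lemma dotp_le_dual (x y : V) : dotp x y <= Xnorm mu p x * D y.
Proof.
have [N0|N0] := eqVneq (Xnorm mu p x) 0.
  by rewrite N0 (Xnorm_eq0 N0) dotp0l mul0r.
have Np : 0 < Xnorm mu p x by rewrite lt0r N0 Xnorm_ge0.
rewrite mulrC -ler_pdivrMr// mulrC -dotpZl.
apply: ub_le_sup (dual_set_bounded y) _ _.
exists ((Xnorm mu p x)^-1 *: x) => //=.
by rewrite XnormZ ?invr_ge0 ?Xnorm_ge0// mulVf.
Qed.

Lemma dual_norm_le (y : V) c : (forall x, Xpow x <= 1 -> dotp x y <= c) -> D y <= c.
Proof.
move=> h; apply: ge_sup; first by exists 0, 0; rewrite /= ?Xnorm0 ?dotp0l.
move=> _ [x /= x1 <-]; apply: h; rewrite -XnormX.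
by rewrite powR_le1 ?Xnorm_ge0// ltW.
Qed.

(** For p > 1, the gradient of [Xpow] / p at v; for p = 1, a subgradient. Up to scaling it is the
    functional that norms v. *)
Definition norming (v : V) : V :=
  \row_j \int[mu]_(u in S) (powR_sg p (dotp v u) * (u : V) 0 j).

Let mk (v : V) : measurable_fun setT (fun u : B1 => powR_sg p (dotp v u)).
Proof. exact: (measurableT_comp (measurable_powR_sg p)). Qed.

Let ik (v x : V) : mu.-integrable S (fun u : B1 => (powR_sg p (dotp v u) * dotp x u)%:E).
Proof.
apply: (@integrable_sphere _ (enorm v `^ (p - 1) * enorm x)); first exact: measurable_funM.
move=> u Su; rewrite normrM ler_pM// ?dle//.
apply: le_trans (normr_powR_sg _ p1) _.
by rewrite ge0_ler_powR ?nnegrE ?enorm_ge0 ?subr_ge0// dle.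
Qed.

Lemma dotp_norming (x v : V) :
  dotp x (norming v) = \int[mu]_(u in S) (powR_sg p (dotp v u) * dotp x u).
Proof.
have E (u : V) : dotp x u = \sum_(j < m) x 0 j * u 0 j by rewrite /dotp big_ord1.
have dE (u : V) j : u 0 j = dotp (delta_mx 0 j) u.
  rewrite /dotp big_ord1 (bigD1 j)//= mxE !eqxx mul1r big1 ?addr0// => k kj.
  by rewrite mxE (negbTE kj) andbF mul0r.
have ij j : mu.-integrable S (fun u : B1 => (powR_sg p (dotp v u) * (u : V) 0 j)%:E).
  by have := ik v (delta_mx 0 j); apply: eq_integrable => // u _; rewrite /= -dE.
rewrite E /Rintegral.
under [in RHS]eq_integral => u _.
  rewrite E mulr_sumr -sumEFin.
  under eq_bigr do rewrite mulrCA EFinM.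
  over.
rewrite integral_sum//=; last first.
  by move=> j; exact: integrableZl.
under [in RHS]eq_bigr => j _.
  rewrite integralZl// -(fineK (integrable_fin_num _ (ij j)))// -EFinM.
  over.
by rewrite sumEFin; apply: eq_bigr => j _; rewrite mxE.
Qed.

Lemma dotp_norming_self (v : V) : dotp v (norming v) = Xpow v.
Proof. by rewrite dotp_norming; apply: eq_Rintegral => u _; rewrite powR_sgM. Qed.

(** Hölder's inequality, by integrating Young's inequality for |<v, u>| / A and |<x, u>| with A the
    norm of v. After multiplication by A^(p - 1) the two terms have weights 1 - 1/p and 1/p, which
    sum to 1. *)
Lemma dual_norm_norming (c : R) (v : V) : 0 <= c ->
  D (c *: norming v) <= (c * Xnorm mu p v `^ (p - 1)).
Proof.
move=> c0; apply: dual_norm_le => x x1; rewrite dotpZr ler_wpM2l// dotp_norming.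
set A := Xnorm mu p v.
have [A0|A0] := eqVneq A 0.
  have -> : \int[mu]_(u in S) (powR_sg p (dotp v u) * dotp x u) = \int[mu]_(u in S) (0 : R).
    by apply: eq_Rintegral => u _; rewrite (Xnorm_eq0 A0) dotp0l powR_sg0 mul0r.
  by rewrite Rintegral_cst// mul0r powR_ge0.
have Ap : 0 < A by rewrite lt0r A0 Xnorm_ge0.
have Ai : 0 <= A^-1 by rewrite invr_ge0 ltW.
pose G (u : B1) : R := A `^ (p - 1) * (1 - p^-1) * A^-1 `^ p * `|dotp v u| `^ p +
   A `^ (p - 1) * p^-1 * `|dotp x u| `^ p.
have iZ k (y : V) : mu.-integrable S (EFin \o (fun u : B1 => k * `|dotp y u| `^ p)).
  rewrite (_ : _ \o _ = fun u : B1 => (k%:E * (`|dotp y u| `^ p)%:E)%E)//.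
  exact: integrableZl (ipow y).
apply: (@le_trans _ _ (\int[mu]_(u in S) G u)).
  apply: le_Rintegral => //; first exact: ik.
    have := integrableD mS (iZ (A `^ (p - 1) * (1 - p^-1) * A^-1 `^ p) v)
      (iZ (A `^ (p - 1) * p^-1) x).
    by apply: eq_integrable => // u _; rewrite /= EFinD.
  move=> u Su; apply: le_trans (ler_norm _) _; rewrite normrM.
  apply: (@le_trans _ _ (`|dotp v u| `^ (p - 1) * `|dotp x u|)).
    by rewrite ler_wpM2r// normr_powR_sg.
  have := young_powR p1 (mulr_ge0 Ai (normr_ge0 (dotp v u))) (normr_ge0 (dotp x u)).
  rewrite !powRM// => h.
  have := ler_wpM2l (powR_ge0 A (p - 1)) h.
  rewrite !mulrA -powRM ?(ltW Ap)// divff// powR1 mul1r => /le_trans; apply.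
  rewrite /G mulrDr !mulrA lexx//.
rewrite /G RintegralD// !RintegralZl//; [|exact: ipow|exact: ipow].
rewrite -/(Xpow v) -/(Xpow x) -XnormX -/A.
rewrite -[leLHS]/(A `^ (p - 1) * (1 - p^-1) * A^-1 `^ p * A `^ p + _).
rewrite -(mulrA (_ * _) (_ `^ p)) -powRM// ?(ltW Ap)// mulVf// powR1 mulr1.
rewrite -mulrA -mulrDr -[leRHS]mulr1 ler_wpM2l ?powR_ge0//.
have : p^-1 * Xpow x <= p^-1 * 1 by rewrite ler_wpM2l// invr_ge0 ltW.
by rewrite mulr1; lra.
Qed.

End lewis_position.

(** * Duality between the l_p sum of X and the l_q sum of its dual *)

Section duality.
Context {R : realType} {n m : nat} (mu : {measure set (borel_mx R 1 m) -> \bar R}).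
Hypothesis hmu : isotropic mu.
Variables (p : R) (q : \bar R).
Hypothesis p12 : 1 <= p <= 2.
Hypothesis hq : (2%:E <= q)%E.
Hypothesis hpq : (p%:E^-1 + q^-1 = 1)%E.
Implicit Types y v : 'M[R]_(n, m).
Notation X := (Xnorm mu p).
Notation D := (dual_norm X).

Definition Xsum v : R := \sum_(i < n) Xpow mu p (row i v).

Let p1 : 1 <= p. Proof. by case/andP: p12. Qed.
Let p0 : 0 < p. Proof. exact: lt_le_trans p1. Qed.

Lemma conjugateE : (q = +oo%E /\ p = 1) \/
  exists r, [/\ q = r%:E, 0 < r, p^-1 + r^-1 = 1 & (p - 1) * r = p].
Proof.
have pN0 : p != 0 by exact: lt0r_neq0.
case: q hq hpq => [r| |]//.
  rewrite lee_fin => r2; have r0 : 0 < r by rewrite (lt_le_trans _ r2).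
  have rN0 : r != 0 by exact: lt0r_neq0.
  rewrite !inver (negbTE pN0) (negbTE rN0) => -[e]; right; exists r; split=> //.
  have : p * r * (p^-1 + r^-1) = p * r by rewrite e mulr1.
  by rewrite mulrDr mulrAC divff// mul1r -mulrA divff// mulr1 mulrBl mul1r => <-; lra.
move=> _; rewrite invey adde0 inver (negbTE pN0) => -[e]; left; split => //.
by rewrite -[p]invrK e invr1.
Qed.

Lemma Xsum_ge0 v : 0 <= Xsum v.
Proof. by apply: sumr_ge0 => i _; exact: Xpow_ge0. Qed.

Let N v := Xsum v `^ p^-1.

Let NX v : N v `^ p = Xsum v.
Proof. by rewrite /N -powRrM mulVf ?lt0r_neq0// powRr1// Xsum_ge0. Qed.

Let X_le_N v i : X (row i v) <= N v.
Proof.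
rewrite (XnormE hmu p12) /N ge0_ler_powR ?nnegrE ?Xpow_ge0 ?Xsum_ge0 ?invr_ge0 ?(ltW p0)//.
by rewrite /Xsum (bigD1 i)//= lerDl sumr_ge0// => j _; exact: Xpow_ge0.
Qed.

Let dotp_le_N y v : lq_ball D q y -> dotp y v <= N v.
Proof.
move=> By.
have le : dotp y v <= \sum_(i < n) D (row i y) * X (row i v).
  rewrite dotp_sum_row; apply: ler_sum => i _.
  by rewrite dotpC mulrC; exact: dotp_le_dual.
apply: (le_trans le); case: conjugateE => [[qE pE]|[r [qE r0 pr _]]].
  rewrite qE /= in By.
  have -> : N v = Xsum v by rewrite -NX [X in _ `^ X]pE powRr1// powR_ge0.
  rewrite /Xsum; apply: ler_sum => i _.
  have -> : Xpow mu p (row i v) = X (row i v).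
    by rewrite -(XnormX hmu p12) [X in _ `^ X]pE powRr1// (Xnorm_ge0 hmu p12).
  by rewrite -[leRHS]mul1r ler_wpM2r ?(Xnorm_ge0 hmu p12)// By.
rewrite qE /= in By.
have [N0|N0] := eqVneq (N v) 0.
  rewrite big1 ?N0// => i _.
  have -> : X (row i v) = 0.
    by apply/eqP; rewrite eq_le (Xnorm_ge0 hmu p12) -[X in _ <= X]N0 X_le_N.
  by rewrite mulr0.
have Np : 0 < N v by rewrite lt0r N0 powR_ge0.
have Ni : 0 <= (N v)^-1 by rewrite invr_ge0 ltW.
rewrite -[leRHS]mul1r -ler_pdivrMr// mulr_suml.
apply: (@le_trans _ _ (\sum_(i < n) ((X (row i v) / N v) `^ p / p + D (row i y) `^ r / r))).
  apply: ler_sum => i _; rewrite -mulrA mulrC.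
  by apply: conjugate_powR => //; rewrite ?mulr_ge0 ?(Xnorm_ge0 hmu p12) ?(dual_norm_ge0 hmu p12).
rewrite big_split/= -!mulr_suml -pr; apply: lerD.
  under eq_bigr do rewrite powRM ?(Xnorm_ge0 hmu p12)// (XnormX hmu p12).
  by rewrite -mulr_suml -/(Xsum v) -NX -powRM ?(ltW Np)// divff// powR1 mul1r.
by rewrite ler_pdivrMr// mulVf ?lt0r_neq0.
Qed.

Let dotp_eq_N v : exists2 y, lq_ball D q y & dotp y v = N v.
Proof.
have D0 : D 0 = 0.
  apply/eqP; rewrite eq_le (dual_norm_ge0 hmu p12) andbT.
  by apply: (dual_norm_le hmu p12) => x _; rewrite dotp0r.
have [N0|N0] := eqVneq (N v) 0.
  exists 0; last by rewrite dotp0l N0.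
  case: conjugateE => [[-> _]|[r [-> r0 _ _]]] /=.
    by move=> i; rewrite row0 D0 ler01.
  by rewrite big1 ?ler01// => i _; rewrite row0 D0 powR0// lt0r_neq0.
have Np : 0 < N v by rewrite lt0r N0 powR_ge0.
(* With this scaling, block i has dual norm at most (X(v_i) / N(v))^(p - 1). For finite q = r the
   r-th powers sum to at most sum_i (X(v_i) / N(v))^p = 1, as (p - 1) r = p; for p = 1 the exponent
   is 0 and each bound is 1. *)
pose c := (N v `^ (p - 1))^-1.
have c0 : 0 <= c by rewrite invr_ge0 powR_ge0.
pose y : 'M[R]_(n, m) := \matrix_i (c *: norming mu p (row i v)).
have Dy i : D (row i y) <= (X (row i v) / N v) `^ (p - 1).
  rewrite rowK; apply: le_trans (dual_norm_norming hmu p12 _ c0) _.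
  rewrite powRM ?(Xnorm_ge0 hmu p12) ?invr_ge0 ?(ltW Np)// mulrC.
  by rewrite -powR_inv1 ?(ltW Np)// -powRrM mulN1r powRN.
exists y.
  case: conjugateE => [[-> pE]|[r [-> r0 _ pr]]] /=.
    by move=> i; apply: le_trans (Dy i) _; rewrite pE subrr powRr0.
  apply: (@le_trans _ _ (\sum_(i < n) (X (row i v) / N v) `^ p)).
    apply: ler_sum => i _.
    have -> : (X (row i v) / N v) `^ p = ((X (row i v) / N v) `^ (p - 1)) `^ r.
      by rewrite -powRrM pr.
    by rewrite ge0_ler_powR ?nnegrE ?(dual_norm_ge0 hmu p12) ?powR_ge0 ?(ltW r0).
  under eq_bigr do rewrite powRM ?(Xnorm_ge0 hmu p12) ?invr_ge0 ?(ltW Np)// (XnormX hmu p12).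
  by rewrite -mulr_suml -/(Xsum v) -NX -powRM ?invr_ge0 ?(ltW Np)// divff// powR1.
rewrite dotpC dotp_sum_row.
under eq_bigr do rewrite rowK dotpZr (dotp_norming_self hmu p12).
rewrite -mulr_sumr -/(Xsum v) -NX /c mulrC -powRN -powRD.
  by rewrite opprB addrC subrK powRr1// ltW.
by rewrite N0 implybT.
Qed.

(** Hölder's inequality, within each block and then across blocks, gives the upper bound; the scaled
    [norming] vectors of the rows attain it. *)
Lemma ereal_sup_lq_ball v :
  ereal_sup [set (dotp y v)%:E | y in lq_ball D q] = (Xsum v `^ p^-1)%R%:E.
Proof.
apply/eqP; rewrite eq_le; apply/andP; split.
  by apply: ge_ereal_sup => _ [y By <-]; rewrite lee_fin dotp_le_N.
apply: ereal_sup_ubound; have [y By yv] := dotp_eq_N v.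
by exists y => //; rewrite yv.
Qed.

(** The projection is self-adjoint, so it passes from the points of the ball to u. *)
Lemma ereal_sup_orth_proj (theta : 'rV[R]_n) (u : 'M[R]_(n, m)) : enorm theta = 1 ->
  ereal_sup [set (dotp a u)%:E | a in orth_proj (block_hyperplane theta) (lq_ball D q)] =
  (Xsum (hproj theta u) `^ p^-1)%R%:E.
Proof.
move=> t1; rewrite -ereal_sup_lq_ball; congr ereal_sup.
have Hu := hproj_in u t1.
apply/seteqP; split => [_ [z [Hz [x Bx xz]] <-]|_ [x Bx <-]].
  exists x => //; congr EFin.
  rewrite [RHS]dotpC -(dotp_hproj u Hz) [RHS]dotpC.
  by apply/eqP; rewrite -subr_eq0 -dotpBl xz.
exists (hproj theta x).
  split; first exact: hproj_in.
  by exists x => // h Hh; rewrite dotpBl dotp_hproj// subrr.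
by congr EFin; rewrite -(dotp_hproj x Hu) [RHS]dotpC [LHS]dotpC dotp_hproj//; exact: hproj_in.
Qed.

Lemma mean_width_orth_projE (theta : 'rV[R]_n)
    (sigma : {measure set (borel_mx R n m) -> \bar R}) :
  enorm theta = 1 -> rotation_invariant_on_usphere (block_hyperplane theta) sigma ->
  coord_measurable (Xpow mu p : 'rV[R]_m -> R) ->
  (mean_width sigma (orth_proj (block_hyperplane theta) (lq_ball D q)) =
   \int[sigma]_u (Xsum u `^ p^-1)%R%:E)%E.
Proof.
move=> t1 rs mX; rewrite /mean_width.
under eq_integral do rewrite ereal_sup_orth_proj//.
have mN (f : borel_mx R n m -> 'M[R]_(n, m)) :
    (forall i j, measurable_fun setT (fun u => f u i j)) ->
    measurable_fun setT (fun u => (Xsum (f u) `^ p^-1)%R%:E).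
  move=> mf; apply/measurable_EFinP; apply: (measurableT_comp (measurable_powR _)).
  apply: measurable_sum => i; apply: mX => k j.
  by under eq_fun do rewrite mxE; exact: mf.
apply: (integral_usphere rs).
- apply: mN => i j; rewrite /hproj; under eq_fun do rewrite 2!mxE.
  apply: measurable_funB; first exact: measurable_coord.
  apply: measurable_mulmx_fun => // k l; apply: measurable_mulmx_fun => // k' l'.
  exact: measurable_coord.
- by apply: mN => i j; exact: measurable_coord.
- by move=> u; rewrite lee_fin powR_ge0.
- by move=> u; rewrite lee_fin powR_ge0.
- by move=> u [Hu _]; rewrite hproj_id.
Qed.

End duality.

(** * Comparison of the mean widths *)

Lemma integral_root_Xsum_le (R : realType) (n m : nat)
    (mu : {measure set (borel_mx R 1 m) -> \bar R}) (p : R)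
    (theta phi : 'rV[R]_n) (st sp : probability (borel_mx R n m) R) :
  isotropic mu -> 1 <= p <= 2 -> (0 < m)%N -> enorm theta = 1 -> enorm phi = 1 ->
  rotation_invariant_on_usphere (block_hyperplane theta) st ->
  rotation_invariant_on_usphere (block_hyperplane phi) sp ->
  usphere (block_hyperplane phi : set 'M[R]_(n, m)) !=set0 ->
  majorized (\row_i theta 0 i ^+ 2) (\row_i phi 0 i ^+ 2) ->
  coord_measurable (Xpow mu p : 'rV[R]_m -> R) /\
  (\int[sp]_u (Xsum mu p (u : 'M[R]_(n, m)) `^ p^-1)%R%:E <=
   \int[st]_u (Xsum mu p (u : 'M[R]_(n, m)) `^ p^-1)%R%:E)%E.
Proof.
move=> hmu p12 m0 t1 p1 rt rp ne maj.
have /andP[pge1 ple2] := p12; have p0 : 0 < p by rewrite (lt_le_trans _ pge1).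
have M0 : 0 < m%:R :> R by rewrite ltr0n.
have a01 : 0 < p / 2 <= 1 by rewrite divr_gt0//= ler_pdivrMr// mul1r.
have ia (x : 'rV[R]_m) :
    mu.-integrable setT (fun u : borel_mx R 1 m => ((dotp x u ^+ 2) `^ (p / 2))%R%:E).
  apply/integrableP; split.
    apply/measurable_EFinP; apply: (measurableT_comp (measurable_powR _)).
    by apply: measurable_funX; exact: (measurable_dotp x).
  under eq_integral do rewrite gee0_abs ?lee_fin ?powR_ge0// sqr_powR.
  by rewrite (integral_Xpow hmu p12) ltry.
have g lam (lam0 : 0 <= lam) := gmean_powR_le (isotropic_mass hmu) M0 t1 p1 rt rp ne maj a01 lam0 ia.
have E : bern_mean mu (fun s : R => powR s (p / 2)) = Xpow mu p.
  by apply/funext => x; rewrite (bern_mean_Xpow hmu p12).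
(* The limit argument yields measurability of exp(- [Xpow]) at lam = 1; a logarithm recovers
   [Xpow]. *)
have mX : coord_measurable (Xpow mu p : 'rV[R]_m -> R).
  move=> d T f mf; have := (g _ ler01).1; rewrite E => /(_ _ _ _ mf) h.
  rewrite (_ : (fun t => _) = fun t => - ln (expR (- (1 * Xpow mu p (f t))))); last first.
    by apply/funext => t; rewrite expRK mul1r opprK.
  apply: (measurableT_comp (@oppr_measurable R _)).
  exact: (measurableT_comp (@measurable_ln R)).
split; first exact: mX.
(* Homogeneity degree a = p/2 in g^2 and root b = 1/p satisfy a b = 1/2; the bound C = m is the mass
   of [mu]. *)
apply: (integral_root_sum_le rt rp (a := p / 2) (C := m%:R)).
- by rewrite invr_gt0 p0 invf_le1.
- by rewrite mulrAC divff ?mul1r// lt0r_neq0.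
- by move=> x; exact: Xpow_ge0.
- by move=> k x; exact: XpowZ.
- by move=> x; exact: Xpow_le.
- exact: mX.
- move=> lam lam0; have [_] := g lam lam0; rewrite E; exact: id.
Qed.

Lemma rotation_invariant_ext (R : realType) (n m : nat) (H : set 'M[R]_(n, m))
    (nu : {measure set (borel_mx R n m) -> \bar R}) (rho : probability (borel_mx R n m) R) :
  rho = nu :> (set (borel_mx R n m) -> \bar R) ->
  rotation_invariant_on_usphere H nu -> rotation_invariant_on_usphere H rho.
Proof.
move=> E [h1 h2 h3]; have EA A : rho A = nu A by rewrite E.
split => [|ne|g ig Hg A mA]; first exact: etrans (EA _) h1.
  exact: etrans (EA _) (h2 ne).
exact: etrans (EA _) (etrans (h3 g ig Hg A mA) (esym (EA A))).
Qed.

Theorem corollary6 (R : realType) (m n : nat) (p : R) (q : \bar R)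
    (hq : (2%:E <= q)%E) (hpq : (p%:E^-1 + q^-1 = 1)%E)
    (mu : {measure set (borel_mx R 1 m) -> \bar R}) (hmu : isotropic mu)
    (theta phi : 'rV[R]_n) (htheta : enorm theta = 1) (hphi : enorm phi = 1)
    (sigma_theta sigma_phi : {measure set (borel_mx R n m) -> \bar R})
    (hsigma_theta :
       rotation_invariant_on_usphere (block_hyperplane theta) sigma_theta)
    (hsigma_phi :
       rotation_invariant_on_usphere (block_hyperplane phi) sigma_phi) :
  let B := lq_ball (dual_norm (Xnorm mu p)) q in
  majorized (\row_i theta 0 i ^+ 2) (\row_i phi 0 i ^+ 2) ->
  (mean_width sigma_phi (orth_proj (block_hyperplane phi) B)
     <= mean_width sigma_theta (orth_proj (block_hyperplane theta) B))%E.
Proof.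
move=> B maj.
have p12 : 1 <= p <= 2.
  case: q hq hpq {B} => [r| |]//.
    rewrite lee_fin => r2; have r0 : 0 < r by rewrite (lt_le_trans _ r2).
    (* The extended inverse of p = 0 is +oo, so the conjugacy relation excludes that value. *)
    rewrite !inver (gt_eqF r0); case: eqP => // _ [e].
    have ri : 0 < r^-1 <= 2^-1 by rewrite invr_gt0 r0 lef_pV2 ?posrE.
    have pi : 2^-1 <= p^-1 <= 1 by lra.
    have p0 : 0 < p by rewrite -invr_gt0; lra.
    rewrite -(invf_le1 p0) -[p <= 2]lef_pV2 ?posrE//.
    by rewrite andbC.
  move=> _; rewrite invey adde0 inver; case: eqP => // _ [e].
  by rewrite -[p]invrK e invr1 lexx/= ler1n.
(* If the sphere of H_phi is empty, [sigma_phi] is the zero measure and the left side is 0, while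
   the integrand on the right is nonnegative. *)
have [ne|e] := pselect (usphere (block_hyperplane phi : set 'M[R]_(n, m)) !=set0); last first.
  have s0 : sigma_phi setT = 0%E.
    have [h _ _] := hsigma_phi; rewrite -h; congr (sigma_phi _).
    by apply/seteqP; split => // x _ hx; apply: e; exists x.
  apply: (@le_trans _ _ 0%E).
    rewrite /mean_width (@eq_measure_integral _ _ _ _ mzero) ?integral_measure_zero//.
    move=> A mA _; apply/eqP; rewrite eq_le measure_ge0 andbT.
    apply: (@le_trans _ _ (sigma_phi setT)); last by rewrite s0.
    by rewrite le_measure ?inE.
  apply: integral_ge0 => u _.
  by rewrite (ereal_sup_orth_proj hmu p12 hq hpq)// lee_fin powR_ge0.
have m0 : (0 < m)%N.
  rewrite lt0n; apply/eqP => m0; have [y [_ /enorm1P y1]] := ne.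
  have : dotp y y = 0.
    rewrite /dotp big1// => i _; rewrite big1// => j _; exfalso.
    by move: (leq_ltn_trans (leq0n j) (ltn_ord j)); rewrite m0.
  by rewrite y1 => /eqP; rewrite oner_eq0.
(* The isometry between the hyperplanes transfers a unit vector, so both measures have total mass
   1. *)
have ne' : usphere (block_hyperplane theta : set 'M[R]_(n, m)) !=set0.
  have [A [_ isom _ Ap]] := @hyperplane_isometry _ _ m _ _ htheta hphi.
  have [y [Hy /enorm1P y1]] := ne; exists (A *m y); split; first exact: Ap.
  by apply/enorm1P; rewrite isom.
have [_ /(_ ne')/probability_of_measure[st stE] _] := hsigma_theta.
have [_ /(_ ne)/probability_of_measure[sp spE] _] := hsigma_phi.
have [mX le] := integral_root_Xsum_le hmu p12 m0 htheta hphi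
  (rotation_invariant_ext stE hsigma_theta) (rotation_invariant_ext spE hsigma_phi) ne maj.
rewrite !(mean_width_orth_projE hmu p12 hq hpq)//.
by rewrite -stE -spE.
Qed.
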